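(* Let $\mathbb{G}$ be a Carnot group with Carnot--Carath\'eodory distance $d$ and basis $X_1,\dots,X_m$ of the first layer $V_1$ of its Lie algebra. Let $f\colon\mathbb{G}\to\mathbb{R}$ be Lipschitz with respect to $d$. Then there exists a $\sigma$-porous set $P\subset\mathbb{G}$ such that the following implication holds at all points $x\in\mathbb{G}\setminus P$: if $X_if(x)$ exists for every $1\le i\le m$, then $f$ is Pansu differentiable at $x$.
   Context: Carnot group: a connected, simply connected finite dimensional Lie group $\mathbb{G}$ whose Lie algebra $\mathfrak{g}$ (left invariant vector fields) is stratified of step $s$: $\mathfrak{g}=V_1\oplus\cdots\oplus V_s$ with $[V_1,V_i]=V_{i+1}$ for $1\le i\le s-1$ and $[V_1,V_s]=\{0\}$, where $[V_1,V_i]=\mathrm{span}\{[a,b]:a\in V_1,b\in V_i\}$. Fix a basis $X_1,\dots,X_n$ of $\mathfrak{g}$ adapted to the stratification (a union of consecutive bases of $V_1,\dots,V_s$), so $X_1,\dots,X_m$ is a basis of $V_1$, where $m=\dim V_1$. The map $\exp\colon\mathfrak{g}\to\mathbb{G}$ is the exponential map (a diffeomorphism); $\mathbb{G}$ is identified with $\mathbb{R}^n$ via $\exp(x_1X_1+\cdots+x_nX_n)\leftrightarrow(x_1,\dots,x_n)$, so the identity is $0$. Dilations: for $r>0$, $\delta_r(x_1,\dots,x_n)=(r^{d_1}x_1,\dots,r^{d_n}x_n)$, where $d_j=i$ if $X_j\in V_i$. Carnot--Carath\'eodory distance: an absolutely continuous curve $\gamma\colon[a,b]\to\mathbb{G}$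 is horizontal if there are $u_1,\dots,u_m\in L^1[a,b]$ with $\gamma'(t)=\sum_{j=1}^m u_j(t)X_j(\gamma(t))$ for almost every $t$; its length is $L(\gamma)=\int_a^b|u(t)|\,dt$ with $|\cdot|$ the Euclidean norm on $\mathbb{R}^m$. Then $d(x,y)$ is the infimum of $L(\gamma)$ over horizontal curves $\gamma\colon[0,1]\to\mathbb{G}$ joining $x$ to $y$; write $d(x)=d(x,0)$. Directional derivative: for $f\colon\mathbb{G}\to\mathbb{R}$, $x\in\mathbb{G}$, $E\in V_1$, $Ef(x)=\lim_{t\to0}\frac{f(x\exp(tE))-f(x)}{t}$, when this limit exists. Pansu differentiability (real-valued case): a map $L\colon\mathbb{G}\to\mathbb{R}$ is group linear if $L(xy)=L(x)+L(y)$ and $L(\delta_r(x))=rL(x)$ for all $x,y\in\mathbb{G}$, $r>0$. A function $f\colon\mathbb{G}\to\mathbb{R}$ is Pansu differentiable at $x$ if there is a group linear $L$ with $\lim_{h\to0}\frac{|f(xh)-f(x)-L(h)|}{d(h)}=0$. Porosity: in a metric space $(M,\rho)$, a set $E\subset M$ is porous at $a\in M$ with constant $\lambda>0$ if there is a sequence $x_n\to a$ with $x_n\neq a$ and $B(x_n,\lambda\rho(a,x_n))\cap E=\varnothing$ for all $n$ (open balls). $E$ is porous if there is a single $\lambda>0$ such that $E$ is porous at every $a\in E$ with constant $\lambda$. A set is $\sigma$-porous if it is a countable union of porous sets. Porosity in $\mathbb{G}$ is with respect to $d$. *)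

(* Defs.v *)
From HB Require Import structures.
From mathcomp Require Import all_boot all_order all_algebra.
From mathcomp Require Import all_classical all_reals all_analysis.

Set Implicit Arguments.
Unset Strict Implicit.
Unset Printing Implicit Defensive.

Import Order.TTheory GRing.Theory Num.Theory.
Import numFieldNormedType.Exports.

Local Open Scope classical_set_scope.
Local Open Scope ring_scope.

(* Between finite-dimensional spaces, this is the usual notion of a C^k map:
   all iterated directional derivatives of order at most k exist and are
   continuous. *)
Fixpoint Ck (R : realType) (V W : normedModType R) (k : nat) (f : V -> W)
    {struct k} : Prop :=
  continuous f /\
  if k is k'.+1 then
    forall v, (forall x, derivable f x v) /\ Ck k' (fun x => 'D_v f x)
  else True.

Definition smooth (R : realType) (V W : normedModType R) (f : V -> W) : Prop :=
  forall k, Ck k f.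

Definition linear_span (R : realType) (n : nat) (A : set 'rV[R]_n) :
    set 'rV[R]_n :=
  [set v | exists2 s : seq 'rV[R]_n, {in s, forall a, A a} & v \in span s].

(* For a group law [mul] on R^n with identity 0, the Lie algebra is identified
   with the tangent space R^n at 0: [v] corresponds to the left-invariant vector
   field [lfield mul v] taking the value [v] at 0, and [lbracket] is the
   commutator XY - YX of left-invariant vector fields, evaluated at 0. *)
Definition lfield (R : realType) (n : nat)
    (mul : 'rV[R]_n -> 'rV[R]_n -> 'rV[R]_n) (v x : 'rV[R]_n) : 'rV[R]_n :=
  'D_v (mul x) 0.

Definition vf_commutator (R : realType) (n : nat)
    (X Y : 'rV[R]_n -> 'rV[R]_n) (x : 'rV[R]_n) : 'rV[R]_n :=
  'D_(X x) Y x - 'D_(Y x) X x.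

Definition lbracket (R : realType) (n : nat)
    (mul : 'rV[R]_n -> 'rV[R]_n -> 'rV[R]_n) (v w : 'rV[R]_n) : 'rV[R]_n :=
  vf_commutator (lfield mul v) (lfield mul w) 0.

Definition layer_of (R : realType) (n : nat) (deg : 'I_n -> nat) (i : nat) :
    set 'rV[R]_n :=
  [set v | forall j, deg j != i -> v 0 j = 0].

Definition brackets (R : realType) (n : nat)
    (mul : 'rV[R]_n -> 'rV[R]_n -> 'rV[R]_n) (A B : set 'rV[R]_n) :
    set 'rV[R]_n :=
  linear_span [set v | exists a b, [/\ A a, B b & v = lbracket mul a b]].

(* A Carnot group of dimension n and step s, in exponential coordinates of the
   first kind with respect to a basis X_1, ..., X_n adapted to the
   stratification: a Lie group structure on the manifold R^n (which is connected
   and simply connected) for which every line t |-> t v is the one-parameter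
   subgroup with initial velocity v, i.e. exp is the identity map.  The
   coordinate vector e_j is X_j, [cdeg j] is the index of the layer containing
   X_j, and V_i is the span of the e_j with [cdeg j = i], so that the sum of the
   layers is R^n and is direct.  The inverse of x is - x, by [cmul_exp].  The top
   layers may vanish, so a group of step at most s is also allowed. *)
Record carnot_group (R : realType) (n s : nat) := CarnotGroup {
  cdeg : 'I_n -> nat;
  cmul : 'rV[R]_n -> 'rV[R]_n -> 'rV[R]_n;
  cdeg_bounds : forall j, (1 <= cdeg j <= s)%N;
  cdeg_mono : forall i j : 'I_n, (i <= j)%N -> (cdeg i <= cdeg j)%N;
  cmulA : associative cmul;
  cmul0x : left_id 0 cmul;
  cmulx0 : right_id 0 cmul;
  cmul_smooth : smooth (fun p : 'rV[R]_n * 'rV[R]_n => cmul p.1 p.2);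
  cmul_exp : forall (v : 'rV[R]_n) (t u : R),
    cmul (t *: v) (u *: v) = (t + u) *: v;
  cstrat : forall i, (1 <= i < s)%N ->
    brackets cmul (layer_of cdeg 1) (layer_of cdeg i) = layer_of cdeg i.+1;
  cstrat_top :
    brackets cmul (layer_of cdeg 1) (layer_of cdeg s) = [set 0]
}.

Definition basis_field (R : realType) (n s : nat) (G : carnot_group R n s)
    (j : 'I_n) (x : 'rV[R]_n) : 'rV[R]_n :=
  lfield (cmul G) (delta_mx 0 j) x.

Definition dilation (R : realType) (n s : nat) (G : carnot_group R n s)
    (r : R) (x : 'rV[R]_n) : 'rV[R]_n :=
  \row_j (r ^+ cdeg G j * x 0 j).

Definition abs_continuous (R : realType) (V : normedModType R) (a b : R)
    (g : R -> V) : Prop :=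
  forall e : R, 0 < e -> exists2 d : R, 0 < d &
    forall (N : nat) (l r : 'I_N -> R),
      (forall i, a <= l i <= r i /\ r i <= b) ->
      trivIset setT (fun i => `]l i, r i[%classic) ->
      \sum_(i < N) (r i - l i) < d ->
      \sum_(i < N) `|g (r i) - g (l i)| < e.

(* Only the controls [u j] with [cdeg G j = 1], i.e. those of the basis of the
   first layer, are used.  The derivative is taken in the open interval because
   [g] is unconstrained outside [a, b]. *)
Definition horizontal (R : realType) (n s : nat) (G : carnot_group R n s)
    (a b : R) (g : R -> 'rV[R]_n) (u : 'I_n -> R -> R) : Prop :=
  [/\ abs_continuous a b g,
      forall j, cdeg G j = 1%N ->
        (@lebesgue_measure R).-integrable `[a, b] (EFin \o u j) &
      {ae (@lebesgue_measure R), forall t, `]a, b[%classic t ->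
        is_derive t 1 g
          (\sum_(j < n | cdeg G j == 1%N) u j t *: basis_field G j (g t))}].

Definition curve_length (R : realType) (n s : nat) (G : carnot_group R n s)
    (a b : R) (u : 'I_n -> R -> R) : R :=
  \int[@lebesgue_measure R]_(t in `[a, b])
    Num.sqrt (\sum_(j < n | cdeg G j == 1%N) u j t ^+ 2).

(* [inf] is the infimum of a set of reals that is bounded below by 0, and
   nonempty by the Chow-Rashevskii theorem. *)
Definition cc_dist (R : realType) (n s : nat) (G : carnot_group R n s)
    (x y : 'rV[R]_n) : R :=
  inf [set l | exists (g : R -> 'rV[R]_n) (u : 'I_n -> R -> R),
    [/\ horizontal G 0 1 g u, g 0 = x, g 1 = y & l = curve_length G 0 1 u]].

Definition cc_lipschitz (R : realType) (n s : nat) (G : carnot_group R n s)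
    (f : 'rV[R]_n -> R) : Prop :=
  exists K : R, forall x y, `|f x - f y| <= K * cc_dist G x y.

(* Existence of the directional derivative Ef(x); recall exp(tE) = t *: E. *)
Definition has_dir_derivative (R : realType) (n s : nat)
    (G : carnot_group R n s) (f : 'rV[R]_n -> R) (x E : 'rV[R]_n) : Prop :=
  cvg ((f (cmul G x (t *: E)) - f x) / t @[t --> (0 : R)^']).

Definition group_linear (R : realType) (n s : nat) (G : carnot_group R n s)
    (L : 'rV[R]_n -> R) : Prop :=
  (forall x y, L (cmul G x y) = L x + L y) /\
  (forall (r : R) x, 0 < r -> L (dilation G r x) = r * L x).

Definition pansu_differentiable (R : realType) (n s : nat)
    (G : carnot_group R n s) (f : 'rV[R]_n -> R) (x : 'rV[R]_n) : Prop :=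
  exists2 L : 'rV[R]_n -> R, group_linear G L &
    `|f (cmul G x h) - f x - L h| / cc_dist G h 0
      @[h --> (0 : 'rV[R]_n)^'] --> (0 : R).

Definition porous_at (R : realType) (M : Type) (rho : M -> M -> R)
    (E : set M) (lambda : R) (a : M) : Prop :=
  exists x : nat -> M,
    [/\ (fun k => rho (x k) a) @ \oo --> (0 : R),
        forall k, x k <> a &
        forall k, [set y | rho (x k) y < lambda * rho a (x k)] `&` E = set0].

Definition porous (R : realType) (M : Type) (rho : M -> M -> R)
    (E : set M) : Prop :=
  exists2 lambda : R, 0 < lambda & forall a, E a -> porous_at rho E lambda a.

Definition sigma_porous (R : realType) (M : Type) (rho : M -> M -> R)
    (P : set M) : Prop :=
  exists2 E : nat -> set M, (forall k, porous rho (E k)) &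
    P = \bigcup_k E k.

(* Main.v *)
Require Import Defs.
From mathcomp Require Import all_boot all_order all_algebra.
From mathcomp Require Import all_classical all_reals all_analysis.
From mathcomp Require Import measurable_realfun ring lra.

(* Chow's theorem with bounds: every [h] is a product of at most N exponentials
   exp(t_i X_(j_i)) of horizontal basis vectors with |t_i| <= C d(h).  Telescoping
   f(xh) - f(x) along this product, the i-th increment is taken in the direction
   X_(j_i) from a point y = x p with d(p) <= C d(h).  Outside a countable union of
   porosity points of sets A = {z | f(z exp(tX_j)) - f(z) is within e|t| of tq for
   |t| < r}, with q and e rational, there is z in A with d(y, z) much smaller than
   d(h), so the increment at y is t_i X_(j_i) f(x) + o(d(h)).  Right translation by
   exp(tX_j) is not an isometry, but at the scale d(h) it is uniformly continuous,
   by homogeneity.  The sum of the main terms is L(h), the sum over the first layer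
   of X_j f(x) h_j, because first layer coordinates are additive.

   Homogeneity, Chow's theorem and additivity rest on the dilations being group
   automorphisms.  A linear Lie algebra automorphism phi commutes with conjugation
   (which is linear in exponential coordinates), since both sides solve the same
   linear ODE; it then commutes with the derivative of the exponential map, hence
   maps left-invariant fields to left-invariant fields.  The lower bound on d near
   0 is a mean value inequality for absolutely continuous functions. *)

Set Implicit Arguments.
Unset Strict Implicit.
Unset Printing Implicit Defensive.

Import Order.TTheory GRing.Theory Num.Theory.
Import numFieldNormedType.Exports.

Local Open Scope classical_set_scope.
Local Open Scope ring_scope.

(** * Differential calculus on row vectors *)

(** A [carnot_group] comes with a smooth law and one-parameter subgroups, but with no
    Baker-Campbell-Hausdorff formula. Its role is taken by the expansion of the law to second order
    at 0 and by scaling. Scaling by 1/(k+1) makes conjugation additive and turns local estimates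
    into global ones. Scaling by dilations, once they are automorphisms, kills every coordinate of a
    remainder whose degree is too small for the order of that remainder; additivity of first layer
    coordinates and the leading terms of commutators come from this.

    Chow's theorem goes layer by layer: commutators of words realise any prescribed part of lowest
    degree, and the discrepancy is pushed into higher layers, which run out. Words have bounded
    length on the unit ball of d, and homogeneity carries them to every scale with the same N.

    The porosity constant must be fixed before the scale, whence a countable family over all
    1/(m+1). The points p met along the words stay bounded after rescaling, so one m serves all of
    them. Exchanging the arguments of d costs a constant, again by homogeneity. *)

Ltac vring := apply/rowP => ?; rewrite !mxE; ring.

Section RowVectors.
Variables (R : realType) (n : nat).
Implicit Types x y v : 'rV[R]_n.

Lemma coord_le_norm x i : `|x 0 i| <= `|x|.
Proof.
rewrite [leRHS]/Num.Def.normr /= mx_normrE; apply/bigmax_geP; right.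
by exists (0, i).
Qed.

Lemma norm_le_coord x (M : R) : 0 <= M -> (forall i, `|x 0 i| <= M) -> `|x| <= M.
Proof.
move=> M0 xM; rewrite [leLHS]/Num.Def.normr /= mx_normrE.
by apply: bigmax_le => // -[i j] _ /=; rewrite ord1.
Qed.

Lemma sum_coord_le x : \sum_i `|x 0 i| <= n%:R * `|x|.
Proof.
apply: le_trans (_ : \sum_(i < n) `|x| <= _).
  by apply: ler_sum => i _; apply: coord_le_norm.
by rewrite sumr_const card_ord mulr_natl.
Qed.

End RowVectors.

Lemma cvg_sum (R : realType) (V : normedModType R) (I : finType) (T : Type)
    (F : set_system T) (f : I -> T -> V) (l : I -> V) : Filter F ->
  (forall i, f i x @[x --> F] --> l i) ->
  \sum_i f i x @[x --> F] --> \sum_i l i.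
Proof.
move=> FF H; apply: (@cvg_big V I +%R 0 xpredT _ T F _ f l FF) => [|i _].
  exact: add_continuous.
exact: H.
Qed.

Lemma continuous_epsP (R : realType) (V W : normedModType R) (F : V -> W) (a : V) :
  {for a, continuous F} <-> forall e : R, 0 < e -> exists2 r : R, 0 < r &
    forall y, `|y - a| < r -> `|F y - F a| <= e.
Proof.
rewrite /prop_for /continuous_at; split=> [/(@cvgrPdist_le _ _ _ (nbhs a)) H e e0|H].
  have /nbhs_ballP[r /= r0 Hr] := H e e0; exists r => // y ya.
  by rewrite distrC; apply: Hr; rewrite -ball_normE /= distrC.
apply/(@cvgrPdist_le _ _ _ (nbhs a)) => e e0; have [r r0 Hr] := H e e0.
apply/nbhs_ballP; exists r => //= y; rewrite -ball_normE /= distrC => ya.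
by rewrite distrC; apply: Hr.
Qed.

Section DerivativeEps.
Variables (R : realType) (V W : normedModType R).

(** Multiplying out the difference quotient admits [h = 0], so that such estimates can be added and
    composed without case distinctions. *)
Lemma is_derive_epsP (F : V -> W) (a v : V) (d : W) :
  is_derive a v F d <->
  forall e : R, 0 < e -> exists2 r : R, 0 < r &
    forall h : R, `|h| < r -> `|F (a + h *: v) - F a - h *: d| <= e * `|h|.
Proof.
have key (h : R) : h != 0 ->
    `|d - h^-1 *: (F (h *: v + a) - F a)| * `|h| =
    `|F (a + h *: v) - F a - h *: d|.
  move=> h0; rewrite mulrC -normrZ scalerBr scalerA divff // scale1r.
  by rewrite distrC (addrC a).
have equiv : ((fun h => h^-1 *: ((F \o shift a) (h *: v) - F a)) h
      @[h --> (0:R)^'] --> d) <->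
  forall e : R, 0 < e -> exists2 r : R, 0 < r &
    forall h : R, `|h| < r -> `|F (a + h *: v) - F a - h *: d| <= e * `|h|.
  split=> [/cvgrPdist_le H e e0|H].
    have [r /= r0 Hr] := H e e0.
    exists r => // h hr; have [->|h0] := eqVneq h 0.
      by rewrite scale0r addr0 subrr sub0r scale0r oppr0 !normr0 mulr0.
    rewrite -key // ler_pM2r ?normr_gt0 //.
    by apply: Hr => //; rewrite /= sub0r normrN.
  apply/cvgrPdist_le => e e0; have [r r0 Hr] := H e e0.
  exists r => //= h /=; rewrite sub0r normrN => hr h0.
  by rewrite -(ler_pM2r (x := `|h|)) ?normr_gt0 // key //; apply: Hr.
split=> [[dF dE]|/equiv.2 H].
  apply/equiv.1; move/cvg_ex : dF => [l Hl]; have := cvg_lim _ Hl.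
  by move: dE; rewrite /derive => -> // ->.
by split; [apply/cvg_ex; exists d|apply: cvg_lim].
Qed.

End DerivativeEps.

Section PartialDerivatives.
Variables (R : realType) (n m : nat).
Implicit Types (F : 'rV[R]_n -> 'rV[R]_m) (x y v : 'rV[R]_n).

(** The mean value theorem is applied to each coordinate; the sup norm then gives the bound without
    a dimensional constant. *)
Lemma segment_lipschitz F x v (D : R -> 'rV[R]_m) (M : R) :
  (forall t, 0 <= t <= 1 -> is_derive (x + t *: v) v F (D t)) ->
  (forall t, 0 <= t <= 1 -> `|D t| <= M) ->
  `|F (x + v) - F x| <= M.
Proof.
move=> dF DM.
have M0 : 0 <= M by apply: le_trans (DM 0 _) => //; rewrite lexx ler01.
apply: norm_le_coord => // j.
pose f t := F (x + t *: v) 0 j.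
have df (t : R) : 0 <= t <= 1 -> is_derive t 1 f (D t 0 j).
  move=> t01; apply/is_derive_epsP => e e0.
  have /is_derive_epsP/(_ e e0)[r r0 Hr] := dF t t01.
  exists r => // h hr; apply: le_trans (Hr h hr).
  rewrite /f scalerDl addrA [h *: 1]mulr1.
  by apply: le_trans (coord_le_norm _ j); rewrite !mxE.
have [||c c01] := @MVT_segment R f (fun t => D t 0 j) 0 1 ler01.
- by move=> t; rewrite in_itv /= => /andP[t0 t1]; apply: df; rewrite !ltW.
- apply: derivable_within_continuous => t; rewrite in_itv /= => t01.
  by have [] := df t t01.
rewrite /f scale1r scale0r addr0 subr0 mulr1 !mxE => ->.
by apply: le_trans (coord_le_norm _ j) (DM _ _); rewrite in_itv in c01.
Qed.

Lemma is_deriveZ_dir F x v (c : R) d :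
  is_derive x v F d -> is_derive x (c *: v) F (c *: d).
Proof.
move=> /is_derive_epsP H; apply/is_derive_epsP => e e0.
have c1 : 0 < `|c| + 1 by rewrite ltr_wpDl.
have [r r0 Hr] := H (e / (`|c| + 1)) (divr_gt0 e0 c1).
exists (r / (`|c| + 1)); first exact: divr_gt0.
move=> h hr; rewrite !scalerA.
apply: le_trans (Hr (h * c) _) _; rewrite normrM.
  rewrite ltr_pdivlMr // in hr; apply: le_lt_trans hr.
  by rewrite ler_wpM2l // lerDl.
have -> : e / (`|c| + 1) * (`|h| * `|c|) = (e * `|h|) * (`|c| / (`|c| + 1)).
  by field; rewrite gt_eqF.
by rewrite ler_piMr ?(mulr_ge0 (ltW e0)) // ler_pdivrMr // mul1r lerDl.
Qed.

(** Going from y to x one coordinate at a time uses partial derivatives only, and a ball of the sup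
    norm is a cube, so the intermediate points [z k] stay in it. The factor n compares the sum of
    the coordinates with the sup norm. *)
Lemma box_lipschitz F (dF : 'I_n -> 'rV[R]_n -> 'rV[R]_m) (a : 'rV[R]_n) (r M : R) :
  (forall i x, `|x - a| <= r -> is_derive x (delta_mx 0 i) F (dF i x)) ->
  (forall i x, `|x - a| <= r -> `|dF i x| <= M) ->
  forall x y, `|x - a| <= r -> `|y - a| <= r ->
    `|F x - F y| <= M * n%:R * `|x - y|.
Proof.
move=> HdF HM x y xa ya.
pose z k : 'rV[R]_n := \row_i (if (i < k)%N then x 0 i else y 0 i).
have r0 : 0 <= r by apply: le_trans xa.
have step (i : 'I_n) : `|F (z i.+1) - F (z i)| <= M * `|x 0 i - y 0 i|.
  set c := x 0 i - y 0 i.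
  have -> : z i.+1 = z i + c *: delta_mx 0 i.
    apply/rowP => j; rewrite !mxE eqxx /=; case: (eqVneq j i) => [->|ji].
      by rewrite ltnS leqnn ltnn mulr1 /c addrC subrK.
    by rewrite mulr0 addr0 ltnS leq_eqVlt (inj_eq val_inj) (negbTE ji).
  have za t : 0 <= t <= 1 -> `|z i + t *: (c *: delta_mx 0 i) - a| <= r.
    move=> /andP[t0 t1]; apply: norm_le_coord => // j; rewrite !mxE eqxx /=.
    have xj := le_trans (coord_le_norm _ j) xa.
    have yj := le_trans (coord_le_norm _ j) ya; rewrite !mxE in xj yj.
    case: (eqVneq j i) => [ji|ji].
      rewrite -ji ltnn mulr1 /c -ji; move: xj yj.
      by rewrite !ler_norml => /andP[? ?] /andP[? ?]; apply/andP; split; nra.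
    by rewrite !mulr0 addr0; case: ifP.
  apply: (@segment_lipschitz _ _ _
     (fun t => c *: dF i (z i + t *: (c *: delta_mx 0 i)))) => t t01.
    by apply: is_deriveZ_dir; apply: HdF; apply: za.
  by rewrite normrZ mulrC ler_wpM2r //; apply: HM; apply: za.
have -> : F x - F y = \sum_(i < n) (F (z i.+1) - F (z i)).
  rewrite -(big_mkord xpredT (fun i => F (z i.+1) - F (z i))) telescope_sumr //.
  by congr (F _ - F _); apply/rowP => i; rewrite !mxE ?ltn_ord.
have [n0|n0] := posnP n.
  have noI (i : 'I_n) : False by case: i => i; rewrite n0.
  have -> : x = y by apply/rowP => i; case: (noI i).
  by rewrite subrr big1 => [|i]; [rewrite !normr0 mulr0|case: (noI i)].
have M0 : 0 <= M by apply: le_trans (HM (Ordinal n0) x xa).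
apply: le_trans (ler_norm_sum _ _ _) _.
apply: le_trans (ler_sum _ (fun i _ => step i)) _.
rewrite -mulr_sumr -mulrA ler_wpM2l //.
apply: le_trans (sum_coord_le _); apply: ler_sum => i _.
by rewrite !mxE.
Qed.

(** [box_lipschitz] is applied to F minus its linear part at a, whose partial derivatives are small
    near a. *)
Lemma strict_derivative F (dF : 'I_n -> 'rV[R]_n -> 'rV[R]_m) (a : 'rV[R]_n) (r : R) :
  0 < r ->
  (forall i x, `|x - a| <= r -> is_derive x (delta_mx 0 i) F (dF i x)) ->
  (forall i, {for a, continuous (dF i)}) ->
  forall e, 0 < e -> exists2 s, 0 < s & forall x y, `|x - a| <= s ->
    `|y - a| <= s ->
    `|F x - F y - \sum_i (x - y) 0 i *: dF i a| <= e * `|x - y|.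
Proof.
move=> r0 HdF cdF e e0.
pose e' := e / (n%:R + 1).
have n1 : 0 < n%:R + 1 :> R by rewrite ltr_wpDl.
have e'0 : 0 < e' by rewrite divr_gt0.
have : \forall x \near a, forall i, `|dF i a - dF i x| <= e'.
  apply: (@filter_forall _ _ (fun i x => `|dF i a - dF i x| <= e') (nbhs a)) => i.
  by have /cvgrPdist_le := cdF i; apply.
move=> /nbhs_ballP[s /= s0 Hs].
have s2 : 0 < Num.min r (s / 2) by rewrite lt_min r0 divr_gt0.
exists (Num.min r (s / 2)) => // x y xa ya.
pose G x := F x - \sum_i x 0 i *: dF i a.
have -> : F x - F y - \sum_i (x - y) 0 i *: dF i a = G x - G y.
  rewrite /G; under eq_bigr do rewrite !mxE scalerBl.
  by rewrite sumrB; set A := \sum_i _; set B := \sum_i _; vring.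
have := @box_lipschitz G (fun i x => dF i x - dF i a) a (Num.min r (s / 2)) e' _ _ x y xa ya.
move=> H; apply: le_trans (H _ _) _.
- move=> i z; rewrite le_min => /andP[za _].
  have /is_derive_epsP HF := HdF i z za; apply/is_derive_epsP => d d0.
  have [t t0 Ht] := HF d d0; exists t => // h ht.
  apply: le_trans (Ht h ht); rewrite le_eqVlt; apply/orP; left; apply/eqP.
  congr (`|_|); rewrite /G.
  have -> : \sum_i0 (z + h *: delta_mx 0 i) 0 i0 *: dF i0 a =
     \sum_i0 z 0 i0 *: dF i0 a + h *: dF i a.
    under eq_bigr do rewrite !mxE scalerDl eqxx /=.
    rewrite big_split /=; congr (_ + _); rewrite (bigD1 i) //= eqxx mulr1.
    by rewrite big1 ?addr0 // => j /negbTE ->; rewrite mulr0 scale0r.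
  set A := \sum_i0 _; set B := dF i z; set C := dF i a.
  set D := F _; set E := F _; vring.
- move=> i z; rewrite le_min => /andP[_ za]; rewrite distrC.
  apply: Hs; rewrite /= -ball_normE /= distrC.
  by apply: le_lt_trans za _; rewrite ltr_pdivrMr // ltr_pMr // ltr1n.
by rewrite ler_wpM2r // /e' mulrAC ler_pdivrMr // ler_pM2l // lerDl.
Qed.

Lemma derive_of_partial F (dF : 'I_n -> 'rV[R]_n -> 'rV[R]_m) (a : 'rV[R]_n) (r : R) v :
  0 < r ->
  (forall i x, `|x - a| <= r -> is_derive x (delta_mx 0 i) F (dF i x)) ->
  (forall i, {for a, continuous (dF i)}) ->
  is_derive a v F (\sum_i v 0 i *: dF i a).
Proof.
move=> r0 HdF cdF; apply/is_derive_epsP => e e0.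
have v1 : 0 < `|v| + 1 by rewrite ltr_wpDl.
have [s s0 Hs] := strict_derivative r0 HdF cdF (divr_gt0 e0 v1).
exists (s / (`|v| + 1)); first exact: divr_gt0.
move=> h hs; have hv : `|h * (`|v| + 1)| < s.
  by rewrite normrM (gtr0_norm v1) -ltr_pdivlMr.
have hvs : `|h *: v| <= s.
  rewrite normrZ; apply: le_trans (ltW hv); rewrite normrM ler_wpM2l //.
  by rewrite (gtr0_norm v1) lerDl.
have := Hs (a + h *: v) a; rewrite addrAC subrr add0r normr0.
move=> /(_ hvs (ltW s0)); rewrite scaler_sumr.
under eq_bigr do rewrite !mxE -scalerA; move/le_trans; apply.
rewrite normrZ mulrAC ler_pdivrMr // mulrA ler_wpM2l ?lerDl //.
by rewrite mulr_ge0 // ltW.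
Qed.

End PartialDerivatives.

(** * The group law to second order *)

Section CompactBounds.
Variables (R : realType) (n m : nat).

Lemma ball_rV_compact (r : R) : compact [set x : 'rV[R]_n | `|x| <= r].
Proof.
apply: bounded_closed_compact.
  by exists r; split; [exact: num_real|move=> M /ltW rM x /= /le_trans; apply].
have -> : [set x : 'rV[R]_n | `|x| <= r] = Num.norm @^-1` [set t | t <= r].
  by [].
by apply: closed_comp; [move=> x _; apply: norm_continuous|apply: closed_le].
Qed.

Lemma bounded_on_balls (F : 'rV[R]_n * 'rV[R]_n -> 'rV[R]_m) (r : R) :
  continuous F ->
  exists2 M, 0 <= M & forall x y, `|x| <= r -> `|y| <= r -> `|F (x, y)| <= M.
Proof.
move=> cF; have := compact_setX (@ball_rV_compact r) (@ball_rV_compact r).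
move=> /(continuous_compact (f := F)) /=.
have /[swap]/[apply] : {within [set x : 'rV[R]_n | `|x| <= r] `*`
    [set x : 'rV[R]_n | `|x| <= r], continuous F}.
  by apply: continuous_subspaceT.
move=> /compact_bounded [M [_ HM]]; exists (`|M| + 1) => [|x y xr yr].
  by rewrite addr_ge0.
by apply: (HM (`|M| + 1)) => /=; [rewrite ltr_pwDr // ler_norm|exists (x, y)].
Qed.

End CompactBounds.

(** * Taylor expansion of the group law at the identity *)

Section GroupLaw.
Variables (R : realType) (n s : nat) (G : carnot_group R n s).
Notation V := 'rV[R]_n.
Local Notation mul := (cmul G).
Local Notation "x ** y" := (mul x y) (at level 40, left associativity).
Implicit Types x y z v w : V.

Local Notation cm := (fun p : V * V => mul p.1 p.2).
Definition mul_d1 i (p : V * V) : V := 'D_((delta_mx 0 i, 0) : V * V) cm p.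
Definition mul_d2 i (p : V * V) : V := 'D_((0, delta_mx 0 i) : V * V) cm p.
Definition mul_d12 k i (p : V * V) : V :=
  'D_((delta_mx 0 k, 0) : V * V) (mul_d2 i) p.

Lemma derive_fst (F : V * V -> V) x y v d :
  is_derive (x, y) ((v, 0) : V * V) F d -> is_derive x v (fun x => F (x, y)) d.
Proof.
move=> /is_derive_epsP H; apply/is_derive_epsP => e e0.
have [r r0 Hr] := H e e0; exists r => // h /Hr.
by rewrite [X in F X](_ : _ = (x + h *: v, y)) //; congr (_, _); rewrite /= scaler0 addr0.
Qed.

Lemma derive_snd (F : V * V -> V) x y v d :
  is_derive (x, y) ((0, v) : V * V) F d -> is_derive y v (fun y => F (x, y)) d.
Proof.
move=> /is_derive_epsP H; apply/is_derive_epsP => e e0.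
have [r r0 Hr] := H e e0; exists r => // h /Hr.
by rewrite [X in F X](_ : _ = (x, y + h *: v)) //; congr (_, _); rewrite /= scaler0 addr0.
Qed.

Lemma mul_d1P i x y : is_derive x (delta_mx 0 i) (mul^~ y) (mul_d1 i (x, y)).
Proof.
apply: (@derive_fst cm); apply: derivableP.
by have [_ /(_ (delta_mx 0 i, 0))[H _]] := cmul_smooth G 1.
Qed.

Lemma mul_d2P i x y : is_derive y (delta_mx 0 i) (mul x) (mul_d2 i (x, y)).
Proof.
apply: (@derive_snd cm); apply: derivableP.
by have [_ /(_ (0, delta_mx 0 i))[H _]] := cmul_smooth G 1.
Qed.

Lemma mul_d12P k i x y :
  is_derive x (delta_mx 0 k) (fun x => mul_d2 i (x, y)) (mul_d12 k i (x, y)).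
Proof.
apply: (@derive_fst (mul_d2 i)); apply: derivableP.
have [_ /(_ (0, delta_mx 0 i))[_ H]] := cmul_smooth G 2.
by have [_ /(_ (delta_mx 0 k, 0))[]] := H.
Qed.

Lemma mul_d1_continuous i : continuous (mul_d1 i).
Proof. by have [_ /(_ (delta_mx 0 i, 0))[_ []]] := cmul_smooth G 1. Qed.

Lemma mul_d2_continuous i : continuous (mul_d2 i).
Proof. by have [_ /(_ (0, delta_mx 0 i))[_ []]] := cmul_smooth G 1. Qed.

Lemma mul_d12_continuous k i : continuous (mul_d12 k i).
Proof.
have [_ /(_ (0, delta_mx 0 i))[_ H]] := cmul_smooth G 2.
by have [_ /(_ (delta_mx 0 k, 0))[_ []]] := H.
Qed.

Lemma continuous_fst_at (F : V * V -> V) y : continuous F -> continuous (fun x => F (x, y)).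
Proof.
move=> cF x; apply: (@continuous_comp _ _ _ (fun x => (x, y)) F); last exact: cF.
by rewrite /prop_for /continuous_at; exact: cvg_pair (@cvg_id _ (nbhs x)) (cvg_cst y).
Qed.

Lemma continuous_snd_at (F : V * V -> V) x : continuous F -> continuous (fun y => F (x, y)).
Proof.
move=> cF y; apply: (@continuous_comp _ _ _ (fun y => (x, y)) F); last exact: cF.
by rewrite /prop_for /continuous_at; exact: cvg_pair (cvg_cst x) (@cvg_id _ (nbhs y)).
Qed.

Lemma common_bound (I : finType) (F : I -> V * V -> V) (r : R) :
  (forall i, continuous (F i)) ->
  exists2 M, 0 <= M & forall i x y, `|x| <= r -> `|y| <= r -> `|F i (x, y)| <= M.
Proof.
move=> cF; have /choice[M HM] i : exists M, 0 <= M /\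
    forall x y, `|x| <= r -> `|y| <= r -> `|F i (x, y)| <= M.
  by have [M M0 HM] := bounded_on_balls r (cF i); exists M.
exists (\sum_i M i) => [|i x y xr yr].
  by apply: sumr_ge0 => i _; have [] := HM i.
apply: le_trans (_ : M i <= _); first by have [_] := HM i; apply.
by rewrite (bigD1 i) //= lerDl; apply: sumr_ge0 => j _; have [] := HM j.
Qed.

Lemma mul_lipschitz (r : R) : exists2 C, 0 <= C & forall x y x' y',
  `|x| <= r -> `|y| <= r -> `|x'| <= r -> `|y'| <= r ->
  `|x ** y - x' ** y'| <= C * (`|x - x'| + `|y - y'|).
Proof.
have [M1 M10 H1] := common_bound r mul_d1_continuous.
have [M2 M20 H2] := common_bound r mul_d2_continuous.
have n0 : 0 <= n%:R :> R by [].
exists ((M1 + M2) * n%:R) => [|x y x' y' xr yr x'r y'r].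
  by rewrite mulr_ge0 // addr_ge0.
rewrite -(subrK (x' ** y) (x ** y)) -addrA.
apply: le_trans (ler_normD _ _) _; rewrite mulrDr; apply: lerD.
  apply: le_trans (@box_lipschitz _ _ _ (mul^~ y)
    (fun i x => mul_d1 i (x, y)) 0 r M1 _ _ x x' _ _) _; rewrite ?subr0 //.
  - by move=> i z _; apply: mul_d1P.
  - by move=> i z; rewrite subr0 => zr; apply: H1.
  by rewrite !ler_wpM2r // lerDl.
apply: le_trans (@box_lipschitz _ _ _ (mul x')
  (fun i y => mul_d2 i (x', y)) 0 r M2 _ _ y y' _ _) _; rewrite ?subr0 //.
- by move=> i z _; apply: mul_d2P.
- by move=> i z; rewrite subr0 => zr; apply: H2.
by rewrite !ler_wpM2r // lerDr.
Qed.

(** The bilinear term of the expansion of the law at (0, 0). Pure second order terms vanish because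
    x ** 0 = x and 0 ** y = y. The Lie bracket is its antisymmetrisation, see [lbracketE]. *)
Definition mul_bilin x y : V :=
  \sum_k \sum_i (x 0 k * y 0 i) *: mul_d12 k i (0, 0).

Lemma mul_d20 i y : mul_d2 i (0, y) = delta_mx 0 i.
Proof.
have [_ <-] := mul_d2P i 0 y.
have -> : mul 0 = id by apply/funext => z; rewrite cmul0x.
by rewrite derive_id.
Qed.

(** The remainder [H] vanishes for y = 0, and its derivatives [K i] in y vanish for x = 0. Applying
    [box_lipschitz] in x to [K i] and then in y to [H] produces the product |x| |y|. The matrix B is
    free so as to serve twice: the derivatives at the origin give the second order expansion, and B
    = 0 gives the bound [mul_sub_add] on balls of any radius. *)
Lemma mul_bilinear_approx (B : 'I_n -> 'I_n -> V) (r e : R) :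
  0 <= r ->
  (forall k i x y, `|x| <= r -> `|y| <= r -> `|mul_d12 k i (x, y) - B k i| <= e) ->
  forall x y, `|x| <= r -> `|y| <= r ->
    `|x ** y - x - y - \sum_k \sum_i (x 0 k * y 0 i) *: B k i| <=
    e * n%:R ^+ 2 * `|x| * `|y|.
Proof.
move=> r0 HB x y xr yr.
have addE (f : 'I_n -> V) (z : V) h i :
    \sum_k (z + h *: delta_mx 0 i) 0 k *: f k = \sum_k z 0 k *: f k + h *: f i.
  under eq_bigr do rewrite !mxE scalerDl eqxx /=.
  rewrite big_split /=; congr (_ + _); rewrite (bigD1 i) //= eqxx mulr1.
  by rewrite big1 ?addr0 // => j /negbTE ->; rewrite mulr0 scale0r.
pose K i x y : V := mul_d2 i (x, y) - delta_mx 0 i - \sum_k x 0 k *: B k i.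
have HK i x0 y0 : `|x0| <= r -> `|y0| <= r -> `|K i x0 y0| <= e * n%:R * `|x0|.
  move=> x0s y0s; have K0 : K i 0 y0 = 0.
    by rewrite /K mul_d20 subrr sub0r big1 ?oppr0 // => k _; rewrite mxE scale0r.
  rewrite -[K i x0 y0]subr0 -K0 -[in leRHS](subr0 x0).
  apply: (@box_lipschitz _ _ _ (K i ^~ y0)
    (fun k x => mul_d12 k i (x, y0) - B k i) 0 r); rewrite ?subr0 ?normr0 //.
    move=> k z zs; have /is_derive_epsP H := mul_d12P k i z y0.
    apply/is_derive_epsP => d d0; have [t t0 Ht] := H d d0; exists t => // h /Ht.
    congr (`| _ | <= _); rewrite /K addE.
    set A := \sum_k0 _; set C := B _ _; set D := mul_d12 _ _ _.
    by set E := mul_d2 _ _; set F := mul_d2 _ _; set P := delta_mx _ _; vring.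
  by move=> k z; rewrite subr0 => zs; apply: HB.
pose Bs y i := y 0 i *: \sum_k x 0 k *: B k i.
have BsE y' : \sum_k \sum_i (x 0 k * y' 0 i) *: B k i =
    \sum_i y' 0 i *: \sum_k x 0 k *: B k i.
  rewrite exchange_big; apply: eq_bigr => i _; rewrite scaler_sumr.
  by apply: eq_bigr => k _; rewrite scalerA mulrC.
pose H y := x ** y - x - y - \sum_i y 0 i *: \sum_k x 0 k *: B k i.
have H0 : H 0 = 0.
  rewrite /H cmulx0 subrr sub0r oppr0 add0r big1 ?oppr0 // => k _.
  by rewrite mxE scale0r.
rewrite BsE -/(H y) -[H y]subr0 -H0 -[in leRHS](subr0 y).
apply: le_trans (@box_lipschitz _ _ _ H (fun i y => K i x y) 0 r
  (e * n%:R * `|x|) _ _ y 0 _ _) _; rewrite ?subr0 ?normr0 //.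
- move=> i z zs; have /is_derive_epsP H' := mul_d2P i x z.
  apply/is_derive_epsP => d d0; have [t t0 Ht] := H' d d0; exists t => // h /Ht.
  congr (`| _ | <= _); rewrite /H /K (addE (fun i => \sum_k x 0 k *: B k i)).
  set A := \sum_i0 _; set C := \sum_k _; set D := mul_d2 _ _; set P := _ ** _.
  by set E := _ ** _; set F := delta_mx _ _; vring.
- by move=> i z; rewrite subr0 => zs; apply: HK.
by rewrite le_eqVlt; apply/orP; left; apply/eqP; ring.
Qed.

Lemma mul_second_order (e : R) : 0 < e -> exists2 r, 0 < r &
  forall x y, `|x| <= r -> `|y| <= r ->
    `|x ** y - x - y - mul_bilin x y| <= e * `|x| * `|y|.
Proof.
move=> e0; pose e' := e / (n%:R ^+ 2 + 1).
have n1 : 0 < n%:R ^+ 2 + 1 :> R by rewrite ltr_wpDl // exprn_ge0.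
have e'0 : 0 < e' by rewrite divr_gt0.
have : \forall p \near ((0, 0) : V * V), forall ki : 'I_n * 'I_n,
    `|mul_d12 ki.1 ki.2 (0, 0) - mul_d12 ki.1 ki.2 p| <= e'.
  apply: (@filter_forall _ _ (fun ki p =>
    `|mul_d12 ki.1 ki.2 (0, 0) - mul_d12 ki.1 ki.2 p| <= e')
    (nbhs ((0, 0) : V * V))) => ki.
  by have /cvgrPdist_le := @mul_d12_continuous ki.1 ki.2 (0, 0); apply.
move=> /nbhs_ballP[r /= r0 Hs].
have r2 : r / 2 < r by rewrite ltr_pdivrMr // ltr_pMr // ltr1n.
exists (r / 2) => [|x y xr yr]; first by rewrite divr_gt0.
apply: le_trans (@mul_bilinear_approx (fun k i => mul_d12 k i (0, 0))
   (r / 2) e' _ _ x y xr yr) _; first by rewrite divr_ge0 // ltW.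
  move=> k i z w zr wr; rewrite distrC; apply: (Hs (z, w) _ (k, i)).
  by split => /=; rewrite -ball_normE /= sub0r normrN; apply: le_lt_trans r2.
rewrite ler_wpM2r // ler_wpM2r // /e' mulrAC ler_pdivrMr // ler_pM2l //.
by rewrite lerDl.
Qed.

Lemma mul_sub_add (r : R) : 0 <= r -> exists2 C, 0 <= C &
  forall x y, `|x| <= r -> `|y| <= r -> `|x ** y - x - y| <= C * `|x| * `|y|.
Proof.
move=> r0; have [M M0 HM] := common_bound r
  (fun ki : 'I_n * 'I_n => @mul_d12_continuous ki.1 ki.2).
exists (M * n%:R ^+ 2) => [|x y xr yr]; first by rewrite mulr_ge0 ?exprn_ge0.
have := @mul_bilinear_approx (fun _ _ => 0) r M r0 _ x y xr yr.
rewrite big1 ?subr0; last by move=> k _; rewrite big1 // => i _; rewrite scaler0.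
by apply => k i z w zr wr; rewrite subr0; apply: (HM (k, i)).
Qed.

Lemma lfieldE v x : lfield mul v x = \sum_i v 0 i *: mul_d2 i (x, 0).
Proof.
have [_ H] := @derive_of_partial _ _ _ (mul x) (fun i y => mul_d2 i (x, y)) 0 1 v
  ltr01 (fun i y _ => mul_d2P i x y)
  (fun i => @continuous_snd_at _ x (@mul_d2_continuous i) 0).
by rewrite /lfield H.
Qed.

Lemma lfield0 v : lfield mul v 0 = v.
Proof.
by rewrite lfieldE [RHS]row_sum_delta; apply: eq_bigr => i _; rewrite mul_d20.
Qed.

Lemma derive_lfield v w : 'D_v (lfield mul w) 0 = mul_bilin v w.
Proof.
have H1 i x : is_derive x (delta_mx 0 i) (lfield mul w)
    (\sum_k w 0 k *: mul_d12 i k (x, 0)).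
  have -> : lfield mul w = \sum_k (w 0 k *: (fun x => mul_d2 k (x, 0))).
    by apply/funext => z; rewrite lfieldE fct_sumE.
  apply: is_derive_sum => k; apply: is_deriveZ; exact: mul_d12P.
have H2 i : {for 0, continuous (fun x => \sum_k w 0 k *: mul_d12 i k (x, 0))}.
  apply: (@cvg_sum _ _ _ _ (nbhs (0 : V))) => k; apply: cvgZl_tmp.
  exact: (@continuous_fst_at _ 0 (@mul_d12_continuous i k) 0).
have [_ ->] := @derive_of_partial _ _ _ _ _ 0 1 v ltr01 (fun i x _ => H1 i x) H2.
apply: eq_bigr => k _; rewrite scaler_sumr; apply: eq_bigr => i _.
by rewrite scalerA.
Qed.

Lemma lbracketE v w : lbracket mul v w = mul_bilin v w - mul_bilin w v.
Proof. by rewrite /lbracket /vf_commutator !lfield0 !derive_lfield. Qed.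

End GroupLaw.

(** * Brackets and conjugation *)

Section GroupAlgebra.
Variables (R : realType) (n s : nat) (G : carnot_group R n s).
Notation V := 'rV[R]_n.
Local Notation "x ** y" := (cmul G x y) (at level 40, left associativity).
Local Notation "[< x , y >]" := (lbracket (cmul G) x y).
Implicit Types x y z v w : V.

Lemma mul_bilinDl x y z :
  mul_bilin G (x + y) z = mul_bilin G x z + mul_bilin G y z.
Proof.
rewrite /mul_bilin -big_split; apply: eq_bigr => k _ /=; rewrite -big_split /=.
by apply: eq_bigr => i _; rewrite mxE mulrDl scalerDl.
Qed.

Lemma mul_bilinDr x y z :
  mul_bilin G x (y + z) = mul_bilin G x y + mul_bilin G x z.
Proof.
rewrite /mul_bilin -big_split; apply: eq_bigr => k _ /=; rewrite -big_split /=.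
by apply: eq_bigr => i _; rewrite mxE mulrDr scalerDl.
Qed.

Lemma lbracketDl x y z : [<x + y, z>] = [<x, z>] + [<y, z>].
Proof. by rewrite !lbracketE mul_bilinDl mul_bilinDr opprD addrACA. Qed.

Lemma lbracketZl (t : R) x y : [<t *: x, y>] = t *: [<x, y>].
Proof.
rewrite !lbracketE /mul_bilin scalerBr !scaler_sumr.
congr (_ - _); apply: eq_bigr => k _; rewrite scaler_sumr; apply: eq_bigr => i _.
  by rewrite mxE scalerA mulrA.
by rewrite mxE scalerA mulrCA.
Qed.

Lemma lbracketC x y : [<x, y>] = - [<y, x>].
Proof. by rewrite !lbracketE opprB. Qed.

Lemma lbracketDr x y z : [<x, y + z>] = [<x, y>] + [<x, z>].
Proof. by rewrite lbracketC lbracketDl (lbracketC x y) (lbracketC x z) opprD. Qed.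

Lemma lbracketZr (t : R) x y : [<x, t *: y>] = t *: [<x, y>].
Proof. by rewrite lbracketC lbracketZl (lbracketC x y) scalerN. Qed.

Lemma lbracketNl x y : [<- x, y>] = - [<x, y>].
Proof. by rewrite -scaleN1r lbracketZl scaleN1r. Qed.

Lemma lbracketNr x y : [<x, - y>] = - [<x, y>].
Proof. by rewrite -scaleN1r lbracketZr scaleN1r. Qed.

Lemma lbracket0l y : [<0, y>] = 0.
Proof. by have := lbracketZl 0 0 y; rewrite !scale0r. Qed.

Lemma mul_bilin_bound : exists2 C, 0 <= C &
  forall x y, `|mul_bilin G x y| <= C * `|x| * `|y|.
Proof.
exists (\sum_k \sum_i `|mul_d12 G k i (0, 0)|) => [|x y].
  by apply: sumr_ge0 => k _; apply: sumr_ge0.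
apply: le_trans (ler_norm_sum _ _ _) _; rewrite -mulrA mulr_suml; apply: ler_sum => k _.
apply: le_trans (ler_norm_sum _ _ _) _; rewrite mulr_suml; apply: ler_sum => i _.
by rewrite normrZ normrM mulrC ler_wpM2l // ler_pM // coord_le_norm.
Qed.

Lemma lbracket_bound : exists2 C, 0 <= C & forall x y, `|[<x, y>]| <= C * `|x| * `|y|.
Proof.
have [C C0 HC] := mul_bilin_bound; exists (C + C) => [|x y]; first exact: addr_ge0.
rewrite lbracketE; apply: le_trans (ler_normB _ _) _; rewrite !mulrDl.
by apply: lerD; [exact: HC|rewrite mulrAC; exact: HC].
Qed.

Lemma cmul_xN x : x ** (- x) = 0.
Proof. by have := cmul_exp G x 1 (-1); rewrite scale1r scaleN1r subrr scale0r. Qed.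

Lemma cmul_Nx x : (- x) ** x = 0.
Proof. by have := cmul_xN (- x); rewrite opprK. Qed.

Lemma cmulKx x y : (- x) ** (x ** y) = y.
Proof. by rewrite cmulA cmul_Nx cmul0x. Qed.

Lemma cmulKVx x y : x ** (- x ** y) = y.
Proof. by rewrite cmulA cmul_xN cmul0x. Qed.

Lemma cmulxK x y : y ** x ** (- x) = y.
Proof. by rewrite -cmulA cmul_xN cmulx0. Qed.

Lemma cmulxVK x y : y ** (- x) ** x = y.
Proof. by rewrite -cmulA cmul_Nx cmulx0. Qed.

Lemma cmul_opp x y : - (x ** y) = (- y) ** (- x).
Proof.
rewrite -[RHS](cmulKx (x ** y)).
by rewrite [(x ** y) ** _]cmulA cmulxK cmul_xN cmulx0.
Qed.

(** Integer multiples are group powers, hence are respected by every endomorphism of the group, in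
    particular by conjugation. *)
Lemma cmul_iter x k : iter k (cmul G x) 0 = k%:R *: x.
Proof.
elim: k => [|k IH] /=; first by rewrite scale0r.
by rewrite IH -{1}(scale1r x) cmul_exp -[in RHS]natr1 addrC.
Qed.

(** * Conjugation as the adjoint representation *)

Definition group_conj x y := x ** y ** (- x).

Lemma cconjM x y z : group_conj x (y ** z) = group_conj x y ** group_conj x z.
Proof. by rewrite /group_conj !cmulA cmulxVK. Qed.

Lemma cconj0 x : group_conj x 0 = 0.
Proof. by rewrite /group_conj cmulx0 cmul_xN. Qed.

Lemma cconj0l y : group_conj 0 y = y.
Proof. by rewrite /group_conj cmul0x oppr0 cmulx0. Qed.

Lemma cconj_comp x y z : group_conj (x ** y) z = group_conj x (group_conj y z).
Proof. by rewrite /group_conj cmul_opp !cmulA. Qed.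

Lemma cconjKN x z : group_conj (- x) (group_conj x z) = z.
Proof. by rewrite -cconj_comp cmul_Nx cconj0l. Qed.

Lemma cconjMn x k y : group_conj x (k%:R *: y) = k%:R *: group_conj x y.
Proof.
rewrite -!cmul_iter; elim: k => [|k IH] /=; first exact: cconj0.
by rewrite cconjM IH.
Qed.

Lemma cconjVn x k y : group_conj x (k.+1%:R^-1 *: y) = k.+1%:R^-1 *: group_conj x y.
Proof.
have k0 : k.+1%:R != 0 :> R by rewrite pnatr_eq0.
have E : k.+1%:R *: group_conj x (k.+1%:R^-1 *: y) = group_conj x y.
  by rewrite -cconjMn scalerA divff // scale1r.
by rewrite -E scalerA mulVf // scale1r.
Qed.

(** Together with [cconjVn], this extends an estimate on conjugation that is homogeneous in the
    vector from a ball around 0 to the whole space. *)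
Lemma small_by_scaling x (P : V -> Prop) (r : R) : 0 < r ->
  (forall x, `|x| <= r -> P x) -> exists k, P (k.+1%:R^-1 *: x).
Proof.
move=> r0 HP; exists (Num.bound (`|x| / r)); apply: HP.
set k := Num.bound _; have k0 : 0 < k.+1%:R :> R by [].
rewrite normrZ normfV (gtr0_norm k0) ler_pdivrMl // -ler_pdivrMr //.
apply: le_trans (_ : k%:R <= _); last by rewrite ler_nat.
by apply: ltW; apply: archi_boundP; rewrite divr_ge0 // ltW.
Qed.

Lemma sandwich_lipschitz (A r : R) : exists2 C, 0 <= C & forall a b x y,
  `|a| <= A -> `|b| <= A -> `|x| <= r -> `|y| <= r ->
  `|a ** x ** b - a ** y ** b| <= C * `|x - y|.
Proof.
pose B := `|A| + `|r|; have B0 : 0 <= B by rewrite addr_ge0.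
have [C1 C10 H1] := mul_lipschitz G B.
have D0 : 0 <= C1 * (B + B) by rewrite mulr_ge0 // addr_ge0.
have [C2 C20 H2] := mul_lipschitz G (C1 * (B + B) + B).
exists (C2 * C1) => [|a b x y aA bA xr yr]; first exact: mulr_ge0.
have AB c : `|c| <= A -> `|c : V| <= B.
  by move=> cA; rewrite /B; move: (ler_norm A) (normr_ge0 r); lra.
have rB c : `|c| <= r -> `|c : V| <= B.
  by move=> cr; rewrite /B; move: (ler_norm r) (normr_ge0 A); lra.
have Hm c : `|c| <= B -> `|a ** c| <= C1 * (B + B) + B.
  move=> cB; have := H1 a c 0 0; rewrite cmulx0 !subr0 normr0 => Hc.
  apply: le_trans (Hc (AB _ aA) cB B0 B0) _; rewrite ler_wpDr // ler_wpM2l //.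
  by rewrite lerD // AB.
rewrite -mulrA; apply: le_trans (H2 _ _ _ _ (Hm _ (rB _ xr)) _ (Hm _ (rB _ yr)) _) _.
- by rewrite ler_wpDl // AB.
- by rewrite ler_wpDl // AB.
rewrite subrr normr0 addr0 ler_wpM2l //.
apply: le_trans (H1 _ _ _ _ (AB _ aA) (rB _ xr) (AB _ aA) (rB _ yr)) _.
by rewrite subrr normr0 add0r.
Qed.

Lemma cconj_bound (r : R) : exists2 C, 0 <= C &
  forall x y, `|x| <= r -> `|group_conj x y| <= C * `|y|.
Proof.
have [C C0 HC] := sandwich_lipschitz r 1.
exists C => // x y xr.
have [|k] := @small_by_scaling y (fun y => `|group_conj x y| <= C * `|y|) 1 ltr01.
  move=> {}y y1; rewrite -[group_conj x y]subr0 -(cconj0 x) -[in leRHS](subr0 y).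
  by apply: HC; rewrite ?normrN ?normr0.
have k0 : 0 < k.+1%:R^-1 :> R by rewrite invr_gt0.
by rewrite cconjVn !normrZ mulrCA ler_pM2l // normr_gt0 gt_eqF.
Qed.

Lemma cconj_continuous x : continuous (group_conj x).
Proof.
move=> y; have [C C0 HC] := sandwich_lipschitz `|x| (`|y| + 1).
apply/continuous_epsP => e e0; have C1 : 0 < C + 1 by rewrite ltr_wpDl.
exists (Num.min 1 (e / (C + 1))) => [|z]; first by rewrite lt_min ltr01 divr_gt0.
rewrite lt_min => /andP[/ltW zy1 /ltW zy].
have zb : `|z| <= `|y| + 1.
  by have := ler_normD (z - y) y; rewrite subrK; move: zy1; lra.
apply: le_trans (HC _ _ _ _ _ _ _ _) _; rewrite ?normrN ?lerDl //.
by move: zy; rewrite ler_pdivlMr // mulrC; apply: le_trans; rewrite ler_wpM2r // lerDl.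
Qed.

Definition nharm (k : nat) : R := k.+1%:R^-1.

Lemma nharm_gt0 k : 0 < nharm k. Proof. by rewrite invr_gt0. Qed.

Lemma nharmV k : k.+1%:R * nharm k = 1.
Proof. by rewrite divff // pnatr_eq0. Qed.

Lemma nharm_cvg0 : nharm k @[k --> \oo] --> (0 : R).
Proof. exact: cvg_harmonic. Qed.

(** Lie product formula: at scale 1/(k+1) the law differs from addition by O(1/k^2), by
    [mul_sub_add]. The factors vary with k so that the formula also applies to difference quotients,
    as in [dexpD]. *)
Lemma trotter (u v : nat -> V) x y :
  u k @[k --> \oo] --> x -> v k @[k --> \oo] --> y ->
  k.+1%:R *: ((nharm k *: u k) ** (nharm k *: v k)) @[k --> \oo] --> x + y.
Proof.
move=> Hu Hv; set r := `|x| + `|y| + 1.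
have r0 : 0 <= r by rewrite !addr_ge0.
have [C C0 HC] := mul_sub_add G r0.
have -> : (fun k => k.+1%:R *: ((nharm k *: u k) ** (nharm k *: v k))) =
  (fun k => k.+1%:R *: ((nharm k *: u k) ** (nharm k *: v k)) - (u k + v k)) +
  (fun k => u k + v k) by apply/funext => k; rewrite !fctE subrK.
rewrite -[X in _ --> X]add0r; apply: cvgD; last exact: cvgD.
have bound (w : nat -> V) z : `|z| + 1 <= r -> w k @[k --> \oo] --> z ->
    \forall k \near \oo, `|w k| <= r.
  move=> zr /cvgrPdist_le /(_ 1 ltr01); apply: filterS => k.
  have := ler_normB z (z - w k); rewrite subKr; move: zr; lra.
have D1 : 0 < C * r * r + 1 by rewrite ltr_wpDl // !mulr_ge0.
apply/cvgrPdist_le => e e0.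
have /cvgrPdist_le/(_ _ (divr_gt0 e0 D1)) := nharm_cvg0.
have bu : \forall k \near \oo, `|u k| <= r.
  by apply: bound Hu; rewrite /r; move: (normr_ge0 y); lra.
have bv : \forall k \near \oo, `|v k| <= r.
  by apply: bound Hv; rewrite /r; move: (normr_ge0 x); lra.
move: bu bv; apply: filterS3 => k ur vr; rewrite sub0r normrN (gtr0_norm (nharm_gt0 k)).
rewrite ler_pdivlMr // => hk; rewrite sub0r normrN.
have h1 : nharm k <= 1 by rewrite invf_le1 // ler1n.
have h0 := nharm_gt0 k; have k0 : 0 < k.+1%:R :> R by [].
have Hn w : `|nharm k *: w| = nharm k * `|w : V| by rewrite normrZ gtr0_norm.
have hr w : `|w| <= r -> `|nharm k *: (w : V)| <= r.
  by move=> wr; rewrite Hn; move: (normr_ge0 w); nra.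
have := HC _ _ (hr _ ur) (hr _ vr); rewrite !Hn => H.
have -> : k.+1%:R *: ((nharm k *: u k) ** (nharm k *: v k)) - (u k + v k) =
    k.+1%:R *: ((nharm k *: u k) ** (nharm k *: v k) - nharm k *: u k - nharm k *: v k).
  by move: (_ ** _) => w; rewrite !scalerBr !scalerA nharmV !scale1r opprD addrA.
rewrite normrZ (gtr0_norm k0).
apply: le_trans (_ : k.+1%:R * (C * (nharm k * `|u k|) * (nharm k * `|v k|)) <= _).
  by rewrite ler_pM2l.
rewrite [leLHS](_ : _ = (k.+1%:R * nharm k) * (nharm k * (C * (`|u k| * `|v k|)))); last by ring.
rewrite nharmV mul1r; apply: le_trans hk; rewrite ler_pM2l //.
apply: le_trans (_ : C * r * r <= _); last by rewrite lerDl.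
by rewrite -mulrA ler_wpM2l // ler_pM.
Qed.

(** Conjugation commutes with products and with the scalings occurring in [trotter]; continuity
    carries this to the limit, which is the sum. *)
Lemma cconjD x y z : group_conj x (y + z) = group_conj x y + group_conj x z.
Proof.
have H1 : k.+1%:R *: ((nharm k *: group_conj x y) ** (nharm k *: group_conj x z))
    @[k --> \oo] --> group_conj x y + group_conj x z by apply: trotter; exact: cvg_cst.
have H0 : k.+1%:R *: ((nharm k *: y) ** (nharm k *: z)) @[k --> \oo] --> y + z.
  by apply: trotter; exact: cvg_cst.
have H2 : group_conj x (k.+1%:R *: ((nharm k *: y) ** (nharm k *: z))) @[k --> \oo]
    --> group_conj x (y + z).
  by apply: (cvg_comp _ _ H0); apply: cconj_continuous.
suff E : (fun k => group_conj x (k.+1%:R *: ((nharm k *: y) ** (nharm k *: z)))) =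
    (fun k => k.+1%:R *: ((nharm k *: group_conj x y) ** (nharm k *: group_conj x z))).
  by rewrite E in H2; exact: (cvg_unique _ H2 H1).
by apply/funext => k; rewrite cconjMn cconjM !cconjVn.
Qed.

Lemma cconjN x y : group_conj x (- y) = - group_conj x y.
Proof. by apply/eqP; rewrite -addr_eq0 -cconjD addNr cconj0. Qed.

Lemma cconjB x y z : group_conj x (y - z) = group_conj x y - group_conj x z.
Proof. by rewrite cconjD cconjN. Qed.

(** The expansion Ad_x = 1 + ad_x + o(|x|). It is proved for small z and extended to all z by
    homogeneity. *)
Lemma cconj_approx (e : R) : 0 < e -> exists2 r, 0 < r &
  forall x, `|x| <= r -> forall z, `|group_conj x z - z - [<x, z>]| <= e * `|x| * `|z|.
Proof.
move=> e0.
have [Cc Cc0 HCc] := cconj_bound 1.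
have [Cb Cb0 HCb] := mul_bilin_bound.
pose e' := e / 2 / (1 + Cc).
have e'0 : 0 < e' by rewrite !divr_gt0 // ltr_pwDl.
have [r0 r00 Hr0] := mul_second_order G e'0.
(* [D] is chosen so that |y - z| <= D |x| |z|. *)
pose D := Cb + Cb * Cc + e' * (1 + Cc).
have D0 : 0 <= D.
  rewrite /D; move: (mulr_ge0 Cb0 Cc0) (Cb0).
  by move: (mulr_ge0 (ltW e'0) (addr_ge0 ler01 Cc0)); lra.
pose r := Num.min 1 (Num.min r0 (e / 2 / (Cb * D + 1))).
have CD : 0 < Cb * D + 1 by rewrite ltr_wpDl // mulr_ge0.
exists r => [|x xr z]; first by rewrite !lt_min ltr01 r00 !divr_gt0.
have [x1 xr0 xe] : [/\ `|x| <= 1, `|x| <= r0 & `|x| <= e / 2 / (Cb * D + 1)].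
  by move: xr; rewrite !le_min => /and3P[].
have [||k] := @small_by_scaling z (fun z => `|group_conj x z - z - [<x, z>]| <= e * `|x| * `|z|)
    (r0 / (1 + Cc)).
- by rewrite divr_gt0 // ltr_pwDl.
- move=> {}z; rewrite ler_pdivlMr ?ltr_pwDl // mulrDr mulr1 => zr.
  have zr0 : `|z| <= r0 by apply: le_trans zr; rewrite lerDl mulr_ge0.
  set y := group_conj x z.
  have yz : `|y| <= Cc * `|z| by apply: HCc.
  have yr0 : `|y| <= r0.
    by apply: le_trans yz _; apply: le_trans zr; rewrite mulrC lerDr.
  have E1 := Hr0 x z xr0 zr0; have E2 := Hr0 y x yr0 xr0.
  have yx : y ** x = x ** z by rewrite /y /group_conj cmulxVK.
  rewrite yx in E2.
  set A := x ** z - x - z - _ in E1; set B := x ** z - y - x - _ in E2.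
  (* Both sides of y ** x = x ** z are expanded to second order, with remainders B and A. *)
  have yzE : y - z = mul_bilin G x z - mul_bilin G y x + A - B.
    by rewrite /A /B; set P := mul_bilin _ _ _; set Q := mul_bilin _ _ _;
      set S := x ** z; vring.
  have xz0 : 0 <= `|x| * `|z| by rewrite mulr_ge0.
  have yx' : `|y| * `|x| <= Cc * (`|x| * `|z|).
    by rewrite mulrC mulrCA ler_wpM2l.
  have Ab : `|A| <= e' * (`|x| * `|z|) by rewrite mulrA.
  have Bb : `|B| <= e' * (Cc * (`|x| * `|z|)).
    by apply: le_trans E2 _; rewrite -mulrA ler_pM2l.
  have AB : `|A - B| <= e / 2 * (`|x| * `|z|).
    apply: le_trans (ler_normB _ _) _; apply: le_trans (lerD Ab Bb) _.
    rewrite -mulrDr -{1}(mul1r (`|x| * `|z|)) -mulrDl mulrA ler_wpM2r //.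
    by rewrite /e' divfK // gt_eqF // ltr_pwDl.
  have yzb : `|y - z| <= D * (`|x| * `|z|).
    rewrite yzE -addrA; apply: le_trans (ler_normD _ _) _.
    rewrite /D mulrDl; apply: lerD; last first.
      apply: le_trans AB _; rewrite ler_wpM2r // /e' divfK // gt_eqF //.
      by rewrite ltr_pwDl.
    apply: le_trans (ler_normB _ _) _; rewrite mulrDl; apply: lerD.
      by rewrite mulrA.
    by apply: le_trans (HCb _ _) _; rewrite -!mulrA ler_wpM2l // mulrA.
  (* The bound [yzb] is fed back: replacing [mul_bilin G y x] by [mul_bilin G z x] costs Cb D |x|^2
     |z|, of higher order in x. *)
  have -> : y - z - [<x, z>] = - mul_bilin G (y - z) x + (A - B).
    have -> : mul_bilin G (y - z) x = mul_bilin G y x - mul_bilin G z x.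
      by rewrite -[in RHS](subrK z y) [in RHS]mul_bilinDl addrK.
    rewrite yzE lbracketE; set P := mul_bilin _ _ _; set Q := mul_bilin _ _ _.
    by set S := mul_bilin _ _ _; vring.
  apply: le_trans (ler_normD _ _) _; rewrite normrN [leRHS](_ : _ =
    e / 2 * (`|x| * `|z|) + e / 2 * (`|x| * `|z|)); last by rewrite -mulrDl -splitr mulrA.
  apply: lerD => //; apply: le_trans (HCb _ _) _.
  apply: le_trans (_ : Cb * (D * (`|x| * `|z|)) * `|x| <= _).
    by rewrite ler_wpM2r // ler_wpM2l.
  have -> : Cb * (D * (`|x| * `|z|)) * `|x| = (Cb * D * `|x|) * (`|x| * `|z|) by ring.
  rewrite ler_wpM2r //; apply: le_trans (_ : (Cb * D + 1) * `|x| <= _).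
    by rewrite ler_wpM2r // lerDl.
  by rewrite mulrC -ler_pdivlMr.
rewrite cconjVn lbracketZr -!scalerBr !normrZ mulrCA ler_pM2l //.
by rewrite normr_gt0 invr_eq0 pnatr_eq0.
Qed.

Lemma lbracket_cvg (u v : nat -> V) x y :
  u k @[k --> \oo] --> x -> v k @[k --> \oo] --> y ->
  [<u k, v k>] @[k --> \oo] --> [<x, y>].
Proof.
have cvg_coord (w : nat -> V) z i : w k @[k --> \oo] --> z -> w k 0 i @[k --> \oo] --> z 0 i.
  move=> H; exact: (@cvg_comp _ _ _ w (fun M : V => M 0 i) \oo (nbhs z) _ H
    (@coord_continuous _ _ _ 0 i z)).
have cvg_bilin (u' v' : nat -> V) x' y' :
  u' k @[k --> \oo] --> x' -> v' k @[k --> \oo] --> y' ->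
  mul_bilin G (u' k) (v' k) @[k --> \oo] --> mul_bilin G x' y'.
  move=> Hu Hv; rewrite /mul_bilin; apply: cvg_sum => k; apply: cvg_sum => i.
  by apply: cvgZr_tmp; apply: cvgM; exact: cvg_coord.
move=> Hu Hv; rewrite lbracketE; under eq_fun do rewrite lbracketE.
by apply: cvgB; apply: cvg_bilin.
Qed.

Lemma cconj_derive x z :
  k.+1%:R *: (group_conj (nharm k *: x) z - z) @[k --> \oo] --> [<x, z>].
Proof.
apply/cvgrPdist_le => e e0.
have C0 : 0 < `|x| * `|z| + 1 by rewrite ltr_wpDl // mulr_ge0.
have [r r0 Hr] := cconj_approx (divr_gt0 e0 C0).
have x0 : 0 < `|x| + 1 by rewrite ltr_wpDl.
have /cvgrPdist_le/(_ _ (divr_gt0 r0 x0)) := nharm_cvg0.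
apply: filterS => k; rewrite sub0r normrN (gtr0_norm (nharm_gt0 k)) => hk.
have k0 : 0 < k.+1%:R :> R by [].
have hx : `|nharm k *: x| = nharm k * `|x| by rewrite normrZ (gtr0_norm (nharm_gt0 k)).
have := Hr (nharm k *: x); rewrite hx => /(_ _ z) H.
have {}H := H _; rewrite lbracketZl in H.
have -> : [<x, z>] - k.+1%:R *: (group_conj (nharm k *: x) z - z) =
   - (k.+1%:R *: (group_conj (nharm k *: x) z - z - nharm k *: [<x, z>])).
  by move: (group_conj _ _ - z) => A; rewrite scalerBr scalerA nharmV scale1r opprB.
rewrite normrN normrZ (gtr0_norm k0).
apply: le_trans (_ : k.+1%:R * (e / (`|x| * `|z| + 1) * (nharm k * `|x|) * `|z|) <= _).
  rewrite ler_pM2l //; apply: H; rewrite ler_pdivlMr // in hk.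
  by apply: le_trans hk; rewrite ler_pM2l ?nharm_gt0 // lerDl.
rewrite [leLHS](_ : _ = (k.+1%:R * nharm k) *
  (e / (`|x| * `|z| + 1) * (`|x| * `|z|))); last by ring.
by rewrite nharmV mul1r mulrAC ler_pdivrMr // ler_pM2l // lerDl.
Qed.

(** Conjugation by x carries conjugation by y/(k+1) to conjugation by ([group_conj x y])/(k+1);
    differentiating this as in [cconj_derive] gives the claim. *)
Lemma cconj_lbracket x y z : group_conj x [<y, z>] = [<group_conj x y, group_conj x z>].
Proof.
have H1 := @cconj_derive (group_conj x y) (group_conj x z).
have H2 : group_conj x (k.+1%:R *: (group_conj (nharm k *: y) z - z)) @[k --> \oo]
    --> group_conj x [<y, z>].
  by apply: (cvg_comp _ _ (@cconj_derive y z)); apply: cconj_continuous.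
suff E : (fun k => group_conj x (k.+1%:R *: (group_conj (nharm k *: y) z - z))) =
    (fun k => k.+1%:R *: (group_conj (nharm k *: group_conj x y) (group_conj x z) - group_conj x z)).
  by rewrite E in H2; exact: (cvg_unique _ H2 H1).
apply/funext => k; rewrite cconjMn cconjB; congr (_ *: (_ - _)).
rewrite -cconjVn -!cconj_comp; congr (group_conj _ z).
by rewrite /group_conj cmulxVK.
Qed.

(** The derivative of [cconj_lbracket] at x = 0: the equality [E] is the discrete Leibniz rule for
    the difference quotients [D k]. *)
Lemma lbracket_jacobi x y z :
  [<x, [<y, z>]>] = [<[<x, y>], z>] + [<y, [<x, z>]>].
Proof.
pose D k w := k.+1%:R *: (group_conj (nharm k *: x) w - w).
have H1 : [<D k y, group_conj (nharm k *: x) z>] @[k --> \oo] --> [<[<x, y>], z>].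
  apply: lbracket_cvg; first exact: cconj_derive.
  have -> : (fun k => group_conj (nharm k *: x) z) = (fun k => nharm k *: D k z + z).
    by apply/funext => k; rewrite /D scalerA mulrC nharmV scale1r subrK.
  rewrite -[X in _ --> X]add0r -(scale0r [<x, z>]); apply: cvgD; last exact: cvg_cst.
  by apply: cvgZ; [exact: nharm_cvg0|exact: cconj_derive].
have H2 : [<y, D k z>] @[k --> \oo] --> [<y, [<x, z>]>].
  by apply: lbracket_cvg; [exact: cvg_cst|exact: cconj_derive].
have H3 := cvgD H1 H2; have H4 := @cconj_derive x [<y, z>].
have E : (fun k => k.+1%:R *: (group_conj (nharm k *: x) [<y, z>] - [<y, z>])) =
   (fun k => [<D k y, group_conj (nharm k *: x) z>]) + (fun k => [<y, D k z>]).
  apply/funext => k; rewrite !fctE cconj_lbracket /D.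
  rewrite lbracketZl lbracketZr -scalerDr; congr (_ *: _).
  rewrite lbracketDl lbracketDr lbracketNl lbracketNr.
  by rewrite addrA subrK.
by rewrite E in H4; exact: (cvg_unique _ H4 (H3 _)).
Qed.

End GroupAlgebra.

(** * Lie algebra homomorphisms are group homomorphisms *)

Section SmallO.
Variables (R : realType) (V : normedModType R).
Implicit Types g u v : R -> V.

(** The condition g(h) = o(h), which at [h = 0] forces g(0) = 0. *)
Definition small1 g := forall e, 0 < e -> exists2 r, 0 < r &
  forall h : R, `|h| < r -> `|g h| <= e * `|h|.

Lemma small1D u v : small1 u -> small1 v -> small1 (fun h => u h + v h).
Proof.
move=> Hu Hv e e0; have e2 : 0 < e / 2 by rewrite divr_gt0.
have [r1 r10 H1] := Hu _ e2; have [r2 r20 H2] := Hv _ e2.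
exists (Num.min r1 r2) => [|h]; first by rewrite lt_min r10.
rewrite lt_min => /andP[/H1 h1 /H2 h2]; apply: le_trans (ler_normD _ _) _.
by rewrite (splitr e) mulrDl lerD.
Qed.

Lemma small1_le (C : R) g u : small1 u -> (exists2 r, 0 < r &
  forall h, `|h| < r -> `|g h| <= C * `|u h|) -> small1 g.
Proof.
move=> Hu [r r0 Hr] e e0; have C1 : 0 < `|C| + 1 by rewrite ltr_wpDl.
have [r1 r10 H1] := Hu _ (divr_gt0 e0 C1).
exists (Num.min r r1) => [|h]; first by rewrite lt_min r0.
rewrite lt_min => /andP[/Hr h1 /H1 h2]; apply: le_trans h1 _.
apply: le_trans (_ : (`|C| + 1) * `|u h| <= _).
  by rewrite ler_wpM2r //; move: (ler_norm C); lra.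
by rewrite mulrC -ler_pdivlMr // mulrAC.
Qed.

Lemma small1N u : small1 u -> small1 (fun h => - u h).
Proof.
move=> Hu; apply: (@small1_le 1 _ u) => //; exists 1 => // h _.
by rewrite normrN mul1r.
Qed.

Lemma small1B u v : small1 u -> small1 v -> small1 (fun h => u h - v h).
Proof. by move=> Hu Hv; apply: small1D => //; apply: small1N. Qed.

Lemma small1_eq u v : (forall h, u h = v h) -> small1 u -> small1 v.
Proof. by move=> /funext <-. Qed.

Lemma small1_linear (x : V) : small1 (fun h => h *: x) -> x = 0.
Proof.
move=> H; apply/eqP; rewrite -normr_le0; apply/ler_addgt0Pl => e e0; rewrite addr0.
have [r r0 Hr] := H _ e0; have r2 : 0 < r / 2 by rewrite divr_gt0.
have h2 : r / 2 < r by move: r0; lra.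
have := Hr (r / 2); rewrite /= (gtr0_norm r2) => /(_ h2).
by rewrite normrZ (gtr0_norm r2) (mulrC (r / 2)) ler_pM2r.
Qed.

Lemma is_derive_small1 (W : normedModType R) (F : W -> V) a w d :
  is_derive a w F d <-> small1 (fun h => F (a + h *: w) - F a - h *: d).
Proof. exact: is_derive_epsP. Qed.

End SmallO.

(** Uniqueness for differential equations is used in this form: undoing one solution by the other
    gives a function with zero derivative, hence a constant. *)
Lemma small1_cst (R : realType) (n : nat) (W : R -> 'rV[R]_n) :
  (forall t, small1 (fun h => W (t + h) - W t)) -> forall a b, W a = W b.
Proof.
move=> H a b; apply/rowP => j.
apply: (@is_derive_0_is_cst R (fun t => W t 0 j) a b) => t.
apply/is_derive_epsP => e e0; have [r r0 Hr] := H t e e0; exists r => // h hr.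
rewrite [h *: 1]mulr1 scaler0 subr0; apply: le_trans (Hr h hr).
by apply: le_trans (coord_le_norm _ j); rewrite !mxE.
Qed.

(** * The differential of the exponential map and the integration of Lie algebra homomorphisms *)

Section Homomorphism.
Variables (R : realType) (n s : nat) (G : carnot_group R n s).
Notation V := 'rV[R]_n.
Local Notation mul := (cmul G).
Local Notation "x ** y" := (cmul G x y) (at level 40, left associativity).
Local Notation "[< x , y >]" := (lbracket (cmul G) x y).
Local Notation cconj := (group_conj G).
Local Notation nharm := (nharm R).
Implicit Types x y z v w : V.

(** With exp the identity map, this is the derivative at 0 in the variable a of exp(-t z) exp(t (z +
    a w)): the left-trivialised differential of exp at t z, applied to t w. *)
Definition dexp z w (t : R) : V := t *: \sum_i w 0 i *: mul_d2 G i (- (t *: z), t *: z).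

Lemma dexp_derive z w (t : R) :
  is_derive (t *: z) w (mul (- (t *: z))) (\sum_i w 0 i *: mul_d2 G i (- (t *: z), t *: z)).
Proof.
exact: (@derive_of_partial _ _ _ (mul (- (t *: z)))
  (fun i y => mul_d2 G i (- (t *: z), y)) (t *: z) 1 w ltr01
  (fun i y _ => mul_d2P G i (- (t *: z)) y)
  (fun i => @continuous_snd_at _ _ _ (- (t *: z)) (@mul_d2_continuous _ _ _ G i) (t *: z))).
Qed.

Lemma dexp_cvg z w (t : R) :
  k.+1%:R *: ((- (t *: z)) ** (t *: (z + nharm k *: w))) @[k --> \oo] --> dexp z w t.
Proof.
have /is_derive_epsP H := dexp_derive z w t; set D := \sum_i _ in H.
apply/cvgrPdist_le => e e0.
have t1 : 0 < `|t| + 1 by rewrite ltr_wpDl.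
have [r r0 Hr] := H _ (divr_gt0 e0 t1).
have q0 : 0 < r / (`|t| + 1) / 2 by rewrite !divr_gt0.
have /cvgrPdist_le/(_ _ q0) := @nharm_cvg0 R.
apply: filterS => k; rewrite sub0r normrN (gtr0_norm (nharm_gt0 R k)) => hk.
have h0 := nharm_gt0 R k; have k0 : 0 < k.+1%:R :> R by [].
have htr : `|t * nharm k| < r.
  rewrite normrM (gtr0_norm h0).
  have rE : r = r / (`|t| + 1) * (`|t| + 1) by rewrite divfK // gt_eqF.
  by rewrite rE; move: hk q0; set q := r / _; move: (normr_ge0 t); nra.
have := Hr (t * nharm k) htr; rewrite cmul_Nx subr0 => Hk.
rewrite /dexp -/D distrC.
have -> : k.+1%:R *: ((- (t *: z)) ** (t *: (z + nharm k *: w))) - t *: D =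
    k.+1%:R *: ((- (t *: z)) ** (t *: z + (t * nharm k) *: w) - (t * nharm k) *: D).
  rewrite scalerDr scalerA; move: (_ ** _) => u.
  by rewrite scalerBr [in RHS]scalerA mulrCA nharmV mulr1.
rewrite normrZ (gtr0_norm k0).
apply: le_trans (_ : k.+1%:R * (e / (`|t| + 1) * `|t * nharm k|) <= _).
  by rewrite ler_pM2l.
rewrite normrM (gtr0_norm h0).
rewrite [leLHS](_ : _ = (k.+1%:R * nharm k) * (e / (`|t| + 1) * `|t|)); last by ring.
by rewrite nharmV mul1r mulrAC ler_pdivrMr // ler_pM2l // lerDl.
Qed.

(** The product exp(-(a+b)z) exp((a+b)z') is the conjugate by exp(-bz) of exp(-az) exp(az'), times
    exp(-bz) exp(bz'). With z' = z + w/(k+1), [trotter] turns this product into a sum. Together with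
    [dexp_small], this cocycle relation plays the part of a linear differential equation for
    [dexp z w]. *)
Lemma dexpD z w (a b : R) : dexp z w (a + b) = cconj (- (b *: z)) (dexp z w a) + dexp z w b.
Proof.
pose q t k : V := (- (t *: z)) ** (t *: (z + nharm k *: w)).
have H1 := @dexp_cvg z w (a + b).
have H2 : k.+1%:R *: ((nharm k *: cconj (- (b *: z)) (k.+1%:R *: q a k)) **
    (nharm k *: (k.+1%:R *: q b k))) @[k --> \oo] -->
    cconj (- (b *: z)) (dexp z w a) + dexp z w b.
  apply: trotter; last exact: dexp_cvg.
  by apply: (cvg_comp _ _ (@dexp_cvg z w a)); apply: cconj_continuous.
suff E : (fun k => k.+1%:R *: q (a + b) k) =
    (fun k => k.+1%:R *: ((nharm k *: cconj (- (b *: z)) (k.+1%:R *: q a k)) **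
    (nharm k *: (k.+1%:R *: q b k)))).
  by rewrite -E in H2; exact: (cvg_unique _ H1 H2).
apply/funext => k; rewrite cconjMn !scalerA (mulrC (nharm k)) nharmV !scale1r.
congr (_ *: _); rewrite /q /group_conj opprK.
have -> : - ((a + b) *: z) = (- (b *: z)) ** (- (a *: z)).
  by rewrite -!scaleNr cmul_exp opprD addrC.
have -> : (a + b) *: (z + nharm k *: w) =
    (a *: (z + nharm k *: w)) ** (b *: (z + nharm k *: w)) by rewrite cmul_exp.
by rewrite !cmulA cmulxK.
Qed.

Lemma dexp_small z w : small1 (fun h => dexp z w h - h *: w).
Proof.
move=> e e0; have z1 : 0 < `|z| + 1 by rewrite ltr_wpDl.
pose F (p : V * V) := \sum_i w 0 i *: mul_d2 G i p.
have /cvgrPdist_le/(_ e e0)/nbhs_ballP[r /= r0 Hr] : F p @[p --> (0 : V * V)] --> F 0.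
  apply: (@cvg_sum _ _ _ _ (nbhs (0 : V * V))) => i; apply: cvgZl_tmp.
  exact: mul_d2_continuous.
exists (r / (`|z| + 1)) => [|h]; first exact: divr_gt0.
rewrite ltr_pdivlMr // => hr.
have hz : `|h *: z| < r.
  by apply: le_lt_trans hr; rewrite normrZ ler_wpM2l // lerDl.
rewrite /dexp -scalerBr normrZ mulrC ler_wpM2r //.
rewrite [X in _ - X](_ : w = F 0).
  rewrite distrC; apply: (Hr (- (h *: z), h *: z)).
  by split; rewrite -ball_normE /= sub0r ?opprK ?normrN.
rewrite /F [LHS]row_sum_delta; apply: eq_bigr => i _.
by rewrite (mul_d20 G i 0).
Qed.

Lemma small1_sandwich a b (u v : R -> V) (M : R) :
  (forall h, `|h| <= 1 -> `|v h| <= M) -> small1 (fun h => u h - v h) ->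
  small1 (fun h => a ** u h ** b - a ** v h ** b).
Proof.
move=> HM Huv; have [C C0 HC] := sandwich_lipschitz G (`|a| + `|b|) (M + 1).
apply: (small1_le (C := C) Huv).
have [r r0 Hr] := Huv 1 ltr01; exists (Num.min 1 r) => [|h].
  by rewrite lt_min ltr01.
rewrite lt_min => /andP[h1 /Hr hr].
have vM := HM _ (ltW h1); apply: HC; rewrite ?lerDl ?lerDr //.
  by have := ler_normD (u h - v h) (v h); rewrite subrK; move: hr; lra.
by apply: le_trans vM _; rewrite lerDl.
Qed.

Lemma lfield_small1 z y :
  small1 (fun h => z ** (h *: y) - (z + h *: lfield mul y z)).
Proof.
have /is_derive_small1 : is_derive 0 y (mul z) (lfield mul y z).
  rewrite lfieldE.
  exact: (@derive_of_partial _ _ _ (mul z) (fun i y => mul_d2 G i (z, y)) 0 1 y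
    ltr01 (fun i y _ => mul_d2P G i z y)
    (fun i => @continuous_snd_at _ _ _ z (@mul_d2_continuous _ _ _ G i) 0)).
by apply: small1_eq => h; rewrite add0r cmulx0 opprD addrA.
Qed.

Lemma line_bound z w h : `|h| <= 1 -> `|z + h *: w| <= `|z| + `|w|.
Proof.
move=> h1; apply: le_trans (ler_normD _ _) _; rewrite normrZ lerD //.
by rewrite -[leRHS]mul1r ler_wpM2r.
Qed.

Lemma dexp_line z w : small1 (fun h => (- z) ** (z + h *: w) - h *: dexp z w 1).
Proof.
have /is_derive_small1 := dexp_derive z w 1; apply: small1_eq => h.
by rewrite !scale1r cmul_Nx subr0 /dexp !scale1r.
Qed.

(** Left translation by -z of the expansion z ** (h *: y) = z + h [lfield mul y z] + o(h) recovers h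
    y. Thus left-invariant fields are described by inverting [dexp]. *)
Lemma dexp_lfield z y : dexp z (lfield mul y z) 1 = y.
Proof.
have H1 := @small1_sandwich (- z) 0 _ _ _ (@line_bound z _) (lfield_small1 z y).
have := small1D H1 (dexp_line z (lfield mul y z)).
move=> /(small1_eq (v := fun h => h *: (y - dexp z (lfield mul y z) 1))) H.
apply/esym/eqP; rewrite -subr_eq0; apply/eqP; apply: small1_linear; apply: H => h.
by rewrite !cmulx0 cmulKx scalerBr addrA subrK.
Qed.

Section LieHomomorphism.
Variable phi : V -> V.
Hypothesis phiD : forall x y, phi (x + y) = phi x + phi y.
Hypothesis phiZ : forall (t : R) x, phi (t *: x) = t *: phi x.
Variable K : R.
Hypothesis phi_bound : forall x, `|phi x| <= K * `|x|.
Hypothesis phi_lbracket : forall x y, phi [<x, y>] = [<phi x, phi y>].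

Let phiN x : phi (- x) = - phi x.
Proof. by rewrite -scaleN1r phiZ scaleN1r. Qed.

Let phiB x y : phi (x - y) = phi x - phi y.
Proof. by rewrite phiD phiN. Qed.

Let small1_phi (u : R -> V) : small1 u -> small1 (fun h => phi (u h)).
Proof. by move=> H; apply: (small1_le (C := K) H); exists 1. Qed.

Let cconj_small1 x z :
  small1 (fun h => cconj (h *: x) z - z - h *: [<x, z>]).
Proof.
move=> e e0; have C1 : 0 < `|x| * `|z| + 1 by rewrite ltr_wpDl // mulr_ge0.
have [r r0 Hr] := cconj_approx G (divr_gt0 e0 C1).
have x1 : 0 < `|x| + 1 by rewrite ltr_wpDl.
exists (r / (`|x| + 1)) => [|h]; first exact: divr_gt0.
rewrite ltr_pdivlMr // => hr; rewrite -lbracketZl.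
apply: le_trans (Hr _ _ _) _.
  by apply: le_trans (ltW hr); rewrite normrZ ler_wpM2l // lerDl.
rewrite normrZ [leLHS](_ : _ = `|h| * (e * (`|x| * `|z|) / (`|x| * `|z| + 1))); last by ring.
by rewrite mulrC ler_wpM2r // ler_pdivrMr // ler_pM2l // lerDl.
Qed.

Lemma phi_cconj x y : phi (cconj x y) = cconj (phi x) (phi y).
Proof.
(* The conjugation expected of [phi (cconj (t *: x) y)] is undone, so the claim is that W is
   constant. *)
pose W (t : R) := cconj (- (t *: phi x)) (phi (cconj (t *: x) y)).
suff E : W 1 = W 0.
  move: E; rewrite /W !scale1r !scale0r oppr0 !cconj0l => <-.
  by rewrite -{1}(opprK (phi x)) cconjKN.
apply: small1_cst => t; set z := cconj (t *: x) y.
have [C C0 HC] := cconj_bound G ((`|t| + 1) * `|phi x|).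
have H1 := small1_phi (cconj_small1 x z).
have H2 := cconj_small1 (phi x) (phi z).
apply: (small1_le (C := C) (small1B H1 H2)).
exists 1 => // h h1.
rewrite !phiB phiZ phi_lbracket; set A := [<_, _>].
(* The two conjugations start at z and at phi z; their first order terms in h agree by
   [phi_lbracket], leaving o(h). *)
have -> : W (t + h) - W t =
    cconj (- ((t + h) *: phi x)) (phi (cconj (h *: x) z) - cconj (h *: phi x) (phi z)).
  rewrite cconjB /W; congr (cconj _ (phi _) - _).
    by rewrite -cconj_comp cmul_exp addrC.
  by rewrite -cconj_comp -!scaleNr cmul_exp; congr (cconj (_ *: _) _); ring.
apply: le_trans (HC _ _ _) _.
  rewrite normrN normrZ ler_wpM2r //; apply: le_trans (ler_normD _ _) _.
  by rewrite lerD2l ltW.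
apply: ler_wpM2l => //; rewrite le_eqVlt; apply/orP; left; apply/eqP; congr (`| _ |).
by rewrite -!(addrA _ (- phi z)) -!opprD opprB subrKA.
Qed.

Lemma phi_dexp z w : phi (dexp z w 1) = dexp (phi z) (phi w) 1.
Proof.
(* By [dexpD] and [phi_cconj], the increment of Y over [t, t + h] is a conjugate of Y h, which is
   o(h) by [dexp_small]. *)
pose Y t := phi (dexp z w t) - dexp (phi z) (phi w) t.
suff E : Y 1 = Y 0.
  apply/eqP; rewrite -subr_eq0 -/(Y 1) E /Y /dexp !scale0r.
  by rewrite -(scale0r 0) phiZ !scale0r subr0.
apply: small1_cst => t.
have [C C0 HC] := cconj_bound G `|t *: phi z|.
have H := small1B (small1_phi (dexp_small z w)) (dexp_small (phi z) (phi w)).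
apply: (small1_le (C := C) H).
exists 1 => // h _.
have -> : Y (t + h) - Y t = cconj (- (t *: phi z)) (phi (dexp z w h) - dexp (phi z) (phi w) h).
  by rewrite /Y (addrC t h) !dexpD phiD phi_cconj phiN phiZ cconjB opprD addrACA addrK.
apply: le_trans (HC _ _ _) _; first by rewrite normrN.
by rewrite phiB phiZ opprB addrA subrK.
Qed.

(** The infinitesimal form of multiplicativity: phi sends left-invariant fields to left-invariant
    fields. It follows from [dexp_lfield], since phi commutes with [dexp]. *)
Lemma phi_mul_line z y : small1 (fun h => (- phi z) ** phi (z ** (h *: y)) - h *: phi y).
Proof.
set w := lfield mul y z.
have H1 := small1_phi (lfield_small1 z y).
have H2 : small1 (fun h => phi (z ** (h *: y)) - (phi z + h *: phi w)).
  by apply: small1_eq H1 => h; rewrite phiB phiD phiZ.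
have H3 := @small1_sandwich (- phi z) 0 _ _ _ (@line_bound (phi z) (phi w)) H2.
apply: small1_eq (small1D H3 (dexp_line (phi z) (phi w))) => h.
by rewrite !cmulx0 -phi_dexp dexp_lfield addrA subrK.
Qed.

Lemma phi_mul x y : phi (x ** y) = phi x ** phi y.
Proof.
(* The curve phi(x exp(t y)) is compared with the integral curve exp(t phi y) by dividing on the
   right. *)
pose F t := phi (x ** (t *: y)) ** (- (t *: phi y)).
suff E : F 1 = F 0.
  move: E; rewrite /F !scale1r !scale0r cmulx0 oppr0 cmulx0 => <-.
  by rewrite cmulxVK.
apply: small1_cst => t; set z := x ** (t *: y).
have B h : `|h| <= 1 -> `|h *: phi y| <= `|phi y|.
  by move=> h1; rewrite normrZ ler_piMl.
have [C C0 HC] := mul_lipschitz G (`|phi y| + 1).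
have [C' C'0 HC'] := sandwich_lipschitz G (`|phi z| + `|t *: phi y|) (C * 1).
have H := phi_mul_line z y; have [r r0 Hr] := H 1 ltr01.
apply: (small1_le (C := (C' * C)) H).
exists (Num.min 1 r) => [|h]; first by rewrite lt_min ltr01.
rewrite lt_min => /andP[h1 /Hr]; set g := (- phi z) ** _ => hr.
have hy := B _ (ltW h1).
have gy : `|g ** (- (h *: phi y))| <= C * `|g - h *: phi y|.
  have := HC g (- (h *: phi y)) (h *: phi y) (- (h *: phi y)).
  rewrite cmul_xN subr0 subrr normr0 addr0; apply; rewrite ?normrN.
  - have := ler_normD (g - h *: phi y) (h *: phi y); rewrite subrK.
    by move: hr hy h1; lra.
  - by move: hy; lra.
  - by move: hy; lra.
  - by move: hy; lra.
have -> : F (t + h) - F t = phi z ** (g ** (- (h *: phi y))) ** (- (t *: phi y)) -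
    phi z ** 0 ** (- (t *: phi y)).
  rewrite cmulx0 /F; congr (_ - _); rewrite /g cmulA cmulKVx.
  rewrite -cmulA -!scaleNr cmul_exp -opprD (addrC h) /z -(cmul_exp G) cmulA.
  by [].
apply: le_trans (HC' _ _ _ _ _ _ _ _) _; rewrite ?normrN ?lerDl ?lerDr //.
- apply: le_trans gy _; rewrite ler_wpM2l //; apply: le_trans hr _.
  by rewrite mul1r ltW.
- by rewrite normr0 mulr1.
by rewrite subr0 -mulrA ler_wpM2l.
Qed.

End LieHomomorphism.

End Homomorphism.

(** * Dilations and the filtration by layers *)

Section CarnotAlgebra.
Variables (R : realType) (n s : nat) (G : carnot_group R n s).
Notation V := 'rV[R]_n.
Local Notation "x ** y" := (cmul G x y) (at level 40, left associativity).
Local Notation "[< x , y >]" := (lbracket (cmul G) x y).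
Local Notation cconj := (group_conj G).
Local Notation deg := (cdeg G).
Local Notation layer := (layer_of (R := R) deg).
Local Notation e_ j := (delta_mx 0 j : V).
Local Notation delta := (dilation G).
Implicit Types x y z v w : V.
Local Opaque lbracket.

Lemma layer0 k : layer k 0.
Proof. by move=> j _; rewrite mxE. Qed.

Lemma layerD k x y : layer k x -> layer k y -> layer k (x + y).
Proof. by move=> Hx Hy j jk; rewrite mxE Hx // Hy // addr0. Qed.

Lemma layerZ k (t : R) x : layer k x -> layer k (t *: x).
Proof. by move=> Hx j jk; rewrite mxE Hx // mulr0. Qed.

Lemma layerB k x y : layer k x -> layer k y -> layer k (x - y).
Proof. by move=> Hx Hy j jk; rewrite !mxE Hx // Hy // subr0. Qed.

Lemma layer_delta j : layer (deg j) (e_ j).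
Proof.
by move=> i; rewrite !mxE eqxx /=; case: (eqVneq i j) => // ->; rewrite eqxx.
Qed.

Lemma layer_gt k x : (s < k)%N -> layer k x -> x = 0.
Proof.
move=> sk Hx; apply/rowP => j; rewrite mxE Hx //.
by have /andP[_ js] := cdeg_bounds G j; rewrite neq_ltn (leq_ltn_trans js).
Qed.

Lemma linear_span_sub (A P : set V) :
  P 0 -> (forall x y, P x -> P y -> P (x + y)) ->
  (forall (t : R) x, P x -> P (t *: x)) -> A `<=` P -> linear_span A `<=` P.
Proof.
move=> P0 PD PZ AP v [l lA] /(@coord_span _ _ _ (in_tuple l)) ->.
apply: (big_ind P) => // i _; apply: PZ; apply: AP; apply: lA.
exact: mem_nth.
Qed.

(** Induction principle provided by the stratification. For k >= s the layer k+1 is zero, so that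
    [P 0] suffices. *)
Lemma span_brackets k (P : set V) :
  P 0 -> (forall x y, P x -> P y -> P (x + y)) ->
  (forall (t : R) x, P x -> P (t *: x)) -> (0 < k)%N ->
  (forall a b, layer 1 a -> layer k b -> P [<a, b>]) -> layer k.+1 `<=` P.
Proof.
move=> P0 PD PZ k0 Pab v Hv; have [ks|sk] := ltnP k s; last first.
  by rewrite (layer_gt _ Hv).
move: Hv; rewrite -(cstrat G (i := k)) ?k0 // => Hv.
by apply: (linear_span_sub P0 PD PZ _ Hv) => _ [a [b [Ha Hb ->]]]; apply: Pab.
Qed.

(** The stratification covers i = 1. For larger i, the element x is a combination of brackets [a, b]
    with a in the first layer, and the Jacobi identity rewrites [[a, b], y] as [a, [b, y]] - [b,
    [a, y]], where the induction hypothesis is used with j and with j+1. *)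
Lemma lbracket_layer i j x y : (0 < i)%N -> (0 < j)%N ->
  layer i x -> layer j y -> layer (i + j) [<x, y>].
Proof.
move=> i0 j0; elim: i i0 j j0 x y => // i IH _ j j0 x y Hx Hy.
have base k a b : (0 < k)%N -> layer 1 a -> layer k b -> layer k.+1 [<a, b>].
  move=> k0 Ha Hb; have span_mem : brackets (cmul G) (layer 1) (layer k) [<a, b>].
    exists [:: [<a, b>]]; last by apply: memv_span; rewrite inE.
    by move=> c; rewrite inE => /eqP ->; exists a, b.
  case: (ltngtP k s) => [ks|sk|ks].
  - by rewrite -(cstrat G (i := k)) ?k0.
  - by rewrite (layer_gt sk Hb) lbracketC lbracket0l oppr0; apply: layer0.
  - move: span_mem; rewrite {1}ks (cstrat_top G) => ->; exact: layer0.
case: i IH Hx => [_|i IH] Hx; first by rewrite add1n; apply: base.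
have H0 : layer (i.+2 + j) [<0, y>] by rewrite lbracket0l; apply: layer0.
have HD x1 x2 : layer (i.+2 + j) [<x1, y>] -> layer (i.+2 + j) [<x2, y>] ->
    layer (i.+2 + j) [<x1 + x2, y>] by rewrite lbracketDl; apply: layerD.
have HZ (t : R) x1 : layer (i.+2 + j) [<x1, y>] -> layer (i.+2 + j) [<t *: x1, y>].
  by rewrite lbracketZl; apply: layerZ.
apply: (span_brackets H0 HD HZ (ltn0Sn i) _ Hx) => a b Ha Hb.
have -> : [<[<a, b>], y>] = [<a, [<b, y>]>] - [<b, [<a, y>]>].
  by rewrite lbracket_jacobi addrK.
apply: layerB; first exact: base (IH isT j j0 b y Hb Hy).
by rewrite addSnnS; exact: IH isT j.+1 isT b _ Hb (base j a y j0 Ha Hy).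
Qed.

Lemma dilation0 (r : R) : delta r 0 = 0.
Proof. by apply/rowP => j; rewrite !mxE mulr0. Qed.

Lemma dilationD (r : R) x y : delta r (x + y) = delta r x + delta r y.
Proof. by apply/rowP => j; rewrite !mxE mulrDr. Qed.

Lemma dilationZ (r t : R) x : delta r (t *: x) = t *: delta r x.
Proof. by apply/rowP => j; rewrite !mxE mulrCA. Qed.

Lemma dilation_layer (r : R) k x : layer k x -> delta r x = r ^+ k *: x.
Proof.
move=> Hx; apply/rowP => j; rewrite !mxE.
by case: (eqVneq (deg j) k) => [->//|jk]; rewrite Hx // !mulr0.
Qed.

Lemma dilation_bound (r : R) x : `|delta r x| <= (\sum_j `|r| ^+ deg j) * `|x|.
Proof.
have S0 : 0 <= \sum_j `|r| ^+ deg j by apply: sumr_ge0 => j _; apply: exprn_ge0.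
apply: norm_le_coord => [|j]; first exact: mulr_ge0.
rewrite !mxE normrM normrX; apply: ler_pM; rewrite ?exprn_ge0 ?coord_le_norm //.
by rewrite (bigD1 j) //= lerDl; apply: sumr_ge0 => i _; apply: exprn_ge0.
Qed.

Lemma lbracket_basis x y :
  [<x, y>] = \sum_i \sum_j (x 0 i * y 0 j) *: [<e_ i, e_ j>].
Proof.
have suml (f : 'I_n -> V) z : [<\sum_i f i, z>] = \sum_i [<f i, z>].
  apply: (big_ind2 (fun u v => [<u, z>] = v)) => [|u u' v v' Hu Hv|//].
    exact: lbracket0l.
  by rewrite lbracketDl Hu Hv.
have sumr (f : 'I_n -> V) z : [<z, \sum_i f i>] = \sum_i [<z, f i>].
  by rewrite lbracketC suml -sumrN; apply: eq_bigr => i _; rewrite -lbracketC.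
rewrite {1}[x]row_sum_delta suml; apply: eq_bigr => i _.
rewrite {1}[y]row_sum_delta sumr; apply: eq_bigr => j _.
by rewrite lbracketZl lbracketZr scalerA.
Qed.

Lemma dilation_lbracket (r : R) x y : delta r [<x, y>] = [<delta r x, delta r y>].
Proof.
have dsum (f : 'I_n -> V) : delta r (\sum_i f i) = \sum_i delta r (f i).
  apply: (big_ind2 (fun u v => delta r u = v)) => [|u u' v v' Hu Hv|//].
    exact: dilation0.
  by rewrite dilationD Hu Hv.
rewrite (lbracket_basis x) (lbracket_basis (delta r x)) dsum; apply: eq_bigr => i _.
rewrite dsum; apply: eq_bigr => j _; rewrite dilationZ !mxE.
have i0 : (0 < deg i)%N by case/andP: (cdeg_bounds G i).
have j0 : (0 < deg j)%N by case/andP: (cdeg_bounds G j).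
rewrite (dilation_layer _ (lbracket_layer i0 j0 (@layer_delta i) (@layer_delta j))).
by rewrite scalerA; congr (_ *: _); rewrite exprD; ring.
Qed.

Lemma dilation_mul (r : R) x y : delta r (x ** y) = delta r x ** delta r y.
Proof.
apply: (phi_mul (dilationD r) (dilationZ r) (dilation_bound r)).
exact: dilation_lbracket.
Qed.

Lemma dilation_comp (r t : R) x : delta r (delta t x) = delta (r * t) x.
Proof. by apply/rowP => j; rewrite !mxE mulrA exprMn. Qed.

Lemma dilation1 x : delta 1 x = x.
Proof. by apply/rowP => j; rewrite !mxE expr1n mul1r. Qed.

Lemma dilationN (r : R) x : delta r (- x) = - delta r x.
Proof. by rewrite -scaleN1r dilationZ scaleN1r. Qed.

(** Membership in the sum of the layers of index at least k, on which a dilation with r <= 1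
    contracts at least like r^k. *)
Definition filtered k x := forall j, (deg j < k)%N -> x 0 j = 0.

Lemma filtered1 x : filtered 1 x.
Proof. by move=> j; have /andP[j1 _] := cdeg_bounds G j; rewrite ltnNge j1. Qed.

Lemma filtered_dilation k (r : R) x : 0 <= r <= 1 -> filtered k x ->
  `|delta r x| <= r ^+ k * `|x|.
Proof.
move=> /andP[r0 r1] Hx; apply: norm_le_coord => [|j]; first by rewrite mulr_ge0 ?exprn_ge0.
rewrite mxE; have [jk|kj] := ltnP (deg j) k.
  by rewrite Hx // mulr0 normr0 mulr_ge0 ?exprn_ge0.
rewrite normrM ger0_norm ?exprn_ge0 // ler_pM ?exprn_ge0 ?coord_le_norm //.
exact: ler_wiXn2l.
Qed.

(** A coordinate of degree d scales exactly like r^d, so it cannot be o(r^m) with m >= d unless it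
    is zero. One r for each e is enough, as the inequality can be divided by r^d. *)
Lemma scaling_eq0 d m (c : R) : (d <= m)%N ->
  (forall e, 0 < e -> exists2 r, 0 < r <= 1 & r ^+ d * `|c| <= e * r ^+ m) -> c = 0.
Proof.
move=> dm H; apply/eqP; rewrite -normr_le0; apply/ler_addgt0Pl => e e0; rewrite addr0.
have [r /andP[r0 r1] Hr] := H e e0.
rewrite -(ler_pM2l (exprn_gt0 d r0)); apply: le_trans Hr _.
by rewrite mulrC ler_wpM2r ?(ltW e0) // ler_wiXn2l // ltW.
Qed.

Lemma scaling_eq0_lt d m (c C : R) : (d < m)%N -> 0 <= C ->
  (forall r, 0 < r <= 1 -> r ^+ d * `|c| <= C * r ^+ m) -> c = 0.
Proof.
case: m => // m; rewrite ltnS => dm C0 H; apply: (scaling_eq0 dm) => e e0.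
have C1 : 0 < C + 1 by rewrite ltr_wpDl.
exists (Num.min 1 (e / (C + 1))); first by rewrite lt_min ltr01 divr_gt0 // ge_min lexx.
set r := Num.min _ _.
have r0 : 0 < r by rewrite lt_min ltr01 divr_gt0.
apply: le_trans (H r _) _; first by rewrite r0 ge_min lexx.
rewrite exprS mulrA ler_wpM2r ?exprn_ge0 ?(ltW r0) //.
apply: le_trans (_ : (C + 1) * (e / (C + 1)) <= _); last by rewrite mulrC divfK // gt_eqF.
by apply: ler_pM; rewrite ?(ltW r0) ?lerDl // ge_min lexx orbT.
Qed.

Lemma le1_bound_dilation k (r : R) x : 0 < r <= 1 -> filtered k x -> `|delta r x| <= `|x|.
Proof.
move=> /andP[r0 r1] Hx; apply: le_trans (filtered_dilation _ Hx) _; first by rewrite ltW.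
by rewrite ler_piMl // exprn_ile1 // ltW.
Qed.

(** Dilating x and y, the coordinate of x ** y - x - y scales like r^(deg j), whereas [mul_sub_add]
    bounds it by a multiple of r^(2k). *)
Lemma coord_mul_filtered k x y j : filtered k x -> filtered k y ->
  (deg j < k + k)%N -> (x ** y) 0 j = x 0 j + y 0 j.
Proof.
move=> Hx Hy jk; apply/eqP; rewrite -subr_eq0; apply/eqP.
have r0 : 0 <= `|x| + `|y| by rewrite addr_ge0.
have [C C0 HC] := mul_sub_add G r0.
apply: (@scaling_eq0_lt _ _ _ (C * `|x| * `|y|) jk) => [|r r01].
  by rewrite !mulr_ge0.
have r01' : 0 <= r <= 1 by case/andP: r01 => /ltW -> ->.
have := HC (delta r x) (delta r y).
have -> : delta r x ** delta r y - delta r x - delta r y = delta r (x ** y - x - y).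
  by rewrite -dilation_mul !dilationD !dilationN.
move=> /(_ (le_trans (le1_bound_dilation r01 Hx) _)).
rewrite lerDl => /(_ (normr_ge0 _) (le_trans (le1_bound_dilation r01 Hy) _)).
rewrite lerDr => /(_ (normr_ge0 _)) H.
have -> : r ^+ deg j * `|(x ** y) 0 j - (x 0 j + y 0 j)| = `|delta r (x ** y - x - y) 0 j|.
  rewrite !mxE normrM ger0_norm ?exprn_ge0 //; last by case/andP: r01'.
  by rewrite opprD addrA.
apply: le_trans (coord_le_norm _ j) _; apply: le_trans H _.
apply: le_trans (_ : C * (r ^+ k * `|x|) * (r ^+ k * `|y|) <= _).
  by apply: ler_pM; rewrite ?mulr_ge0 // ?ler_wpM2l // filtered_dilation.
by rewrite le_eqVlt exprD; apply/orP; left; apply/eqP; ring.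
Qed.

Lemma coord_mul_horizontal x y j : deg j = 1%N -> (x ** y) 0 j = x 0 j + y 0 j.
Proof.
by move=> j1; apply: (coord_mul_filtered (@filtered1 x) (@filtered1 y)); rewrite j1.
Qed.

Lemma lbracket_filtered p q x y j : filtered p x -> filtered q y ->
  (deg j < p + q)%N -> [<x, y>] 0 j = 0.
Proof.
move=> Hx Hy jpq; have [C C0 HC] := lbracket_bound G.
apply: (@scaling_eq0_lt _ _ _ (C * `|x| * `|y|) jpq) => [|r r01].
  by rewrite !mulr_ge0.
have r01' : 0 <= r <= 1 by case/andP: r01 => /ltW -> ->.
have -> : r ^+ deg j * `|[<x, y>] 0 j| = `|[<delta r x, delta r y>] 0 j|.
  rewrite -dilation_lbracket [in RHS]mxE [in RHS]normrM ger0_norm ?exprn_ge0 //.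
  by case/andP: r01'.
apply: le_trans (coord_le_norm _ j) _; apply: le_trans (HC _ _) _.
apply: le_trans (_ : C * (r ^+ p * `|x|) * (r ^+ q * `|y|) <= _).
  by apply: ler_pM; rewrite ?mulr_ge0 // ?ler_wpM2l // filtered_dilation.
by rewrite le_eqVlt exprD; apply/orP; left; apply/eqP; ring.
Qed.

(** Let y be the conjugate of b and z = y ** (- b). Then y - b is [a, b] up to o(|a| |b|) by
    [cconj_approx], and z differs from y - b by O(|z| |b|), where |z| is itself O(|a| |b|). *)
Lemma commutator_approx (e : R) : 0 < e -> exists2 r, 0 < r & forall a b,
  `|a| <= r -> `|b| <= r -> `|cconj a b ** (- b) - [<a, b>]| <= e * `|a| * `|b|.
Proof.
move=> e0; have e2 : 0 < e / 2 by rewrite divr_gt0.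
have [r1 r10 H1] := cconj_approx G e2.
have [Cb Cb0 HCb] := lbracket_bound G.
have [Cc Cc0 HCc] := cconj_bound G 1.
have [C C0 HC] := mul_lipschitz G (Cc + 1).
pose D := C * (Cb + e / 2); have D0 : 0 <= D.
  by rewrite mulr_ge0 // addr_ge0 // ltW.
have [C' C'0 HC'] := mul_sub_add G (addr_ge0 D0 ler01).
have K1 : 0 < C' * D + 1 by rewrite ltr_wpDl // mulr_ge0.
exists (Num.min (Num.min 1 r1) (e / 2 / (C' * D + 1))) => [|a b].
  by rewrite !lt_min ltr01 r10 !divr_gt0.
rewrite !le_min => /andP[/andP[a1 ar1] ae] /andP[/andP[b1 br1] be].
set y := cconj a b; set z := y ** (- b).
have Hy := H1 a ar1 b; rewrite -/y in Hy.
have ab0 : 0 <= `|a| * `|b| by rewrite mulr_ge0.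
have yb : `|y - b| <= (Cb + e / 2) * (`|a| * `|b|).
  rewrite -(subrK [<a, b>] (y - b)); apply: le_trans (ler_normD _ _) _.
  by rewrite addrC mulrDl; apply: lerD; rewrite mulrA.
have zb : `|z| <= D * (`|a| * `|b|).
  rewrite -[z]subr0 -(cmul_xN G b) /D -mulrA.
  apply: le_trans (_ : C * (`|y - b| + `|- b - - b|) <= _).
    apply: HC; rewrite ?normrN.
    - by apply: le_trans (HCc _ _ a1) _; rewrite ler_wpDr // ler_piMr.
    - by rewrite ler_wpDl.
    - by rewrite ler_wpDl.
    - by rewrite ler_wpDl.
  by rewrite subrr normr0 addr0 ler_wpM2l.
have ab1 : `|a| * `|b| <= 1 by rewrite mulr_ile1.
have zr : `|z| <= D + 1.
  by apply: le_trans zb _; rewrite ler_wpDr // ler_piMr.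
have Hz := HC' z b zr _.
have {}Hz := Hz (le_trans b1 _); rewrite lerDr in Hz; have {Hz} := Hz D0.
rewrite {1}/z cmulxVK => Hz.
have gen (u v w t : V) : v - u = (w - t - u) - (w - v - t) by vring.
rewrite (gen _ z y b).
apply: le_trans (ler_normB _ _) _.
have -> : e * `|a| * `|b| = e / 2 * `|a| * `|b| + e / 2 * (`|a| * `|b|).
  by rewrite {1}(splitr e); ring.
apply: lerD => //; apply: le_trans Hz _.
apply: le_trans (_ : C' * (D * (`|a| * `|b|)) * `|b| <= _).
  by rewrite ler_wpM2r // ler_wpM2l.
rewrite [leLHS](_ : _ = (C' * D * `|b|) * (`|a| * `|b|)); last by ring.
rewrite ler_wpM2r //; move: be; rewrite ler_pdivlMr // mulrC; apply: le_trans.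
by rewrite ler_wpM2r // lerDl.
Qed.

Lemma dilation_cconj (r : R) x y : delta r (cconj x y) = cconj (delta r x) (delta r y).
Proof. by rewrite /group_conj !dilation_mul dilationN. Qed.

(** After dilation a is O(r) and b is O(r^k), so the error in [commutator_approx] is o(r^(k+1)). The
    new layer k+1 is the borderline degree, which is why an o and not only an O is required
    there. *)
Lemma commutator_filtered k a b j : filtered k b -> (deg j <= k.+1)%N ->
  (cconj a b ** (- b)) 0 j = [<a, b>] 0 j.
Proof.
move=> Hb jk; apply/eqP; rewrite -subr_eq0; apply/eqP.
apply: (scaling_eq0 jk) => e e0.
have K0 : 0 < `|a| * `|b| + 1 by rewrite ltr_wpDl // mulr_ge0.
have [t t0 Ht] := commutator_approx (divr_gt0 e0 K0).
have ab1 : 0 < `|a| + `|b| + 1 by rewrite ltr_wpDl // addr_ge0.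
pose r := Num.min 1 (t / (`|a| + `|b| + 1)).
have r0 : 0 < r by rewrite lt_min ltr01 divr_gt0.
have r1 : r <= 1 by rewrite ge_min lexx.
have rt : r * (`|a| + `|b| + 1) <= t by rewrite -ler_pdivlMr // ge_min lexx orbT.
exists r; first by rewrite r0.
have r01 : 0 <= r <= 1 by rewrite ltW.
have Ha' := filtered_dilation r01 (@filtered1 a); rewrite expr1 in Ha'.
have Hb' := filtered_dilation r01 Hb.
have Hb1 := filtered_dilation r01 (@filtered1 b); rewrite expr1 in Hb1.
have := Ht (delta r a) (delta r b).
have -> : cconj (delta r a) (delta r b) ** (- delta r b) - [<delta r a, delta r b>] =
    delta r (cconj a b ** (- b) - [<a, b>]).
  by rewrite -dilation_cconj -dilationN -dilation_mul -dilation_lbracket dilationD dilationN.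
move=> /(_ (le_trans Ha' _) (le_trans Hb1 _)).
have h1 : r * `|a| <= t.
  by apply: le_trans rt; rewrite ler_wpM2l ?(ltW r0) // -addrA lerDl addr_ge0.
have h2 : r * `|b| <= t.
  by apply: le_trans rt; rewrite ler_wpM2l ?(ltW r0) // addrAC lerDr addr_ge0.
move=> /(_ h1 h2) H.
have -> : r ^+ deg j * `|(cconj a b ** (- b)) 0 j - [<a, b>] 0 j| =
   `|delta r (cconj a b ** (- b) - [<a, b>]) 0 j|.
  by rewrite !mxE normrM ger0_norm // exprn_ge0 // ltW.
apply: le_trans (coord_le_norm _ j) _; apply: le_trans H _.
apply: le_trans (_ : e / (`|a| * `|b| + 1) * (r * `|a|) * (r ^+ k * `|b|) <= _).
  have q0 : 0 <= e / (`|a| * `|b| + 1) by rewrite divr_ge0 ?ltW.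
  apply: ler_pM; [by rewrite mulr_ge0|exact: normr_ge0| |exact: Hb'].
  by rewrite ler_wpM2l.
rewrite [leLHS](_ : _ = e * (`|a| * `|b|) / (`|a| * `|b| + 1) * r ^+ k.+1); last first.
  by rewrite exprS; ring.
rewrite ler_wpM2r ?exprn_ge0 ?(ltW r0) // ler_pdivrMr // ler_pM2l // lerDl //.
Qed.

End CarnotAlgebra.

(** * Chow's theorem with bounds *)

Section Reachability.
Variables (R : realType) (n s : nat) (G : carnot_group R n s).
Notation V := 'rV[R]_n.
Local Notation "x ** y" := (cmul G x y) (at level 40, left associativity).
Local Notation "[< x , y >]" := (lbracket (cmul G) x y).
Local Notation cconj := (group_conj G).
Local Notation deg := (cdeg G).
Local Notation layer := (layer_of (R := R) deg).
Local Notation e_ j := (delta_mx 0 j : V).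
Local Notation filtered := (filtered G).
Implicit Types x y z v w q : V.
Local Opaque lbracket.

(** A pair (j, t) encodes exp(t X_j), since exp is the identity in these coordinates. *)
Definition hstep (p : 'I_n * R) : V := p.2 *: e_ p.1.
Definition hprod (l : seq ('I_n * R)) : V := foldl (fun x p => x ** hstep p) 0 l.
Definition hword (C : R) (l : seq ('I_n * R)) : bool :=
  all (fun p => (deg p.1 == 1%N) && (`|p.2| <= C)) l.

Lemma foldl_hprod x l : foldl (fun x p => x ** hstep p) x l = x ** hprod l.
Proof.
rewrite /hprod; elim/last_ind: l => [|l p IH] /=; first by rewrite cmulx0.
by rewrite !foldl_rcons IH cmulA.
Qed.

Lemma hprod_cat l1 l2 : hprod (l1 ++ l2) = hprod l1 ** hprod l2.
Proof. by rewrite {1}/hprod foldl_cat foldl_hprod. Qed.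

Lemma hprod_rcons l p : hprod (rcons l p) = hprod l ** hstep p.
Proof. by rewrite /hprod foldl_rcons. Qed.

Lemma hword_le (C C' : R) l : C <= C' -> hword C l -> hword C' l.
Proof.
move=> CC; apply: sub_all => p /andP[-> pC] /=; exact: le_trans CC.
Qed.

Definition reachable (B : set V) : Prop := exists N (C : R), forall x, B x ->
  exists l, [/\ (size l <= N)%N, hword C l & hprod l = x].

Lemma reachable_sub (A B : set V) : A `<=` B -> reachable B -> reachable A.
Proof. by move=> AB [N [C H]]; exists N, C => x /AB /H. Qed.

Lemma reachable_mul (A B : set V) : reachable A -> reachable B ->
  reachable [set z | exists x y, [/\ A x, B y & z = x ** y]].
Proof.
move=> [N [C H]] [N' [C' H']]; exists (N + N')%N, (Num.max C C').
move=> _ [x [y [/H[l [l1 l2 <-]] /H'[l' [l'1 l'2 <-]] ->]]].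
exists (l ++ l'); split; first by rewrite size_cat leq_add.
  rewrite /hword all_cat; apply/andP; split.
    by apply: hword_le l2; rewrite le_max lexx.
  by apply: hword_le l'2; rewrite le_max lexx orbT.
by rewrite hprod_cat.
Qed.

Lemma reachable_opp (A : set V) : reachable A -> reachable [set - x | x in A].
Proof.
move=> [N [C H]]; exists N, C => _ [x /H[l [l1 l2 <-]] <-].
exists (rev (map (fun p => (p.1, - p.2)) l)); split.
- by rewrite size_rev size_map.
- rewrite /hword all_rev all_map; apply: sub_all l2 => p /= /andP[-> pC].
  by rewrite normrN.
elim/last_ind: {l1 l2} l => [|l p IH] /=; first by rewrite /hprod /= oppr0.
rewrite map_rcons rev_rcons hprod_rcons cmul_opp -IH -cat1s hprod_cat.
by congr (_ ** _); rewrite /hprod /= cmul0x /hstep /= scaleNr.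
Qed.

Lemma reachable_commutator (A B : set V) : reachable A -> reachable B ->
  reachable [set z | exists x y, [/\ A x, B y & z = cconj x y ** (- y)]].
Proof.
move=> HA HB; have := reachable_mul (reachable_mul (reachable_mul HA HB)
  (reachable_opp HA)) (reachable_opp HB).
apply: reachable_sub => _ [x [y [Ax By ->]]].
exists (cconj x y), (- y); split => //; last by exists y.
exists (x ** y), (- x); split => //; last by exists x.
by exists x, y.
Qed.

Lemma hprod_bound N (C : R) : exists M, forall l, (size l <= N)%N -> hword C l ->
  `|hprod l| <= M.
Proof.
elim: N => [|N [M HM]].
  by exists 0 => l; rewrite leqn0 => /nilP -> _; rewrite normr0.
have [D D0 HD] := mul_lipschitz G (`|M| + `|C|).
exists (D * (`|M| + `|C|) + `|M|) => l; case/lastP: l => [|l p].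
  by rewrite normr0 addr_ge0 // mulr_ge0 // addr_ge0.
rewrite size_rcons ltnS /hword all_rcons => lN /andP[/andP[_ pC] lC].
rewrite hprod_rcons; have lM := le_trans (HM l lN lC) (ler_norm M).
have hC : `|hstep p| <= `|C|.
  rewrite normrZ; apply: le_trans (_ : `|p.2| * 1 <= _).
    rewrite ler_wpM2l //; apply: norm_le_coord => // i; rewrite !mxE eqxx /=.
    by case: (i == p.1); rewrite ?normr1 ?normr0.
  by rewrite mulr1 (le_trans pC) // ler_norm.
have MC0 : 0 <= `|M| + `|C| by rewrite addr_ge0.
have := HD (hprod l) (hstep p) 0 0; rewrite cmulx0 !subr0 normr0 => H.
apply: le_trans (H _ _ MC0 MC0) _.
- by rewrite ler_wpDr.
- by rewrite ler_wpDl.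
by rewrite ler_wpDr // ler_wpM2l // lerD.
Qed.

Lemma reachable_bounded (B : set V) : reachable B -> exists M, forall x, B x -> `|x| <= M.
Proof.
move=> [N [C H]]; have [M HM] := hprod_bound N C; exists M => x /H[l [l1 l2 <-]].
exact: HM.
Qed.

(* The multiples of [v] by scalars in [-r, r] are leading terms of elements of
   a single reachable set. *)
Definition leading k v : Prop := forall r : R, exists2 B, reachable B &
  forall c, `|c| <= r -> exists2 q, B q &
    forall j, (deg j <= k)%N -> q 0 j = (c *: v) 0 j.

Lemma filtered_coord k q v : layer k v ->
  (forall j, (deg j <= k)%N -> q 0 j = v 0 j) -> filtered k q.
Proof.
by move=> Hv Hq j jk; rewrite Hq ?(ltnW jk) // Hv // neq_ltn jk.
Qed.

Lemma filteredS k q v : (forall j, (deg j <= k)%N -> q 0 j = v 0 j) ->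
  filtered k.+1 (q - v).
Proof. by move=> H j jk; rewrite !mxE H // subrr. Qed.

Lemma coord_mul_leading k q (q' : V) v (v' : V) : (0 < k)%N -> layer k v -> layer k v' ->
  (forall j, (deg j <= k)%N -> q 0 j = v 0 j) ->
  (forall j, (deg j <= k)%N -> q' 0 j = v' 0 j) ->
  forall j, (deg j <= k)%N -> (q ** q') 0 j = (v + v') 0 j.
Proof.
move=> k0 Lv Lv' H H' j jk.
rewrite (coord_mul_filtered (filtered_coord Lv H) (filtered_coord Lv' H')).
  by rewrite H // H' // mxE.
by apply: leq_ltn_trans jk _; rewrite -{1}[k]addn0 ltn_add2l.
Qed.

Lemma reachable0 : reachable [set 0].
Proof. by exists 0%N, 0 => _ ->; exists [::]. Qed.

Lemma leading0 k : leading k 0.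
Proof.
move=> r; exists [set 0]; first exact: reachable0.
by move=> c _; exists 0 => // j _; rewrite scaler0.
Qed.

Lemma leadingZ k (t : R) v : leading k v -> leading k (t *: v).
Proof.
move=> H r; have [B HB Hc] := H (r * `|t|); exists B => // c cr.
have [|q Bq Hq] := Hc (c * t); first by rewrite normrM ler_wpM2r.
by exists q => // j jk; rewrite Hq // scalerA.
Qed.

Lemma leadingD k u v : (0 < k)%N -> layer k u -> layer k v ->
  leading k u -> leading k v -> leading k (u + v).
Proof.
move=> k0 Lu Lv Hu Hv r; have [A HA Ha] := Hu r; have [B HB Hb] := Hv r.
exists [set z | exists x y, [/\ A x, B y & z = x ** y]]; first exact: reachable_mul.
move=> c cr; have [x Ax Hx] := Ha c cr; have [y By Hy] := Hb c cr.
exists (x ** y); first by exists x, y.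
rewrite scalerDr; apply: (coord_mul_leading k0 _ _ Hx Hy); exact: layerZ.
Qed.

Lemma leading1 v : layer 1 v -> leading 1 v.
Proof.
move=> Hv; have -> : v = \sum_j v 0 j *: e_ j by rewrite -row_sum_delta.
pose P u := layer 1 u /\ leading 1 u.
suff : P (\sum_j v 0 j *: e_ j) by case.
apply: (big_ind P) => [|x y [Lx Hx] [Ly Hy]|j _].
- by split; [exact: layer0|exact: leading0].
- by split; [exact: layerD|exact: leadingD].
have [j1|j1] := eqVneq (deg j) 1%N; last first.
  by rewrite Hv // scale0r; split; [exact: layer0|exact: leading0].
split; first by apply: layerZ; have := @layer_delta _ _ _ G j; rewrite j1.
apply: leadingZ => r; exists [set c *: e_ j | c in [set c : R | `|c| <= r]].
  exists 1%N, r => _ [c cr <-]; exists [:: (j, c)]; split => //.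
    by rewrite /hword /= j1 eqxx /=; move: cr => /= ->.
  by rewrite /hprod /= cmul0x.
by move=> c cr; exists (c *: e_ j); [exists c|].
Qed.

(** The commutator of x and y has leading term [x, y] by [commutator_filtered]. Replacing x by c a
    and y by b changes the bracket only in degrees above k+1. The scalar c is carried by x alone, so
    one fixed y serves all c. *)
Lemma leading_lbracket k a b : (0 < k)%N -> layer 1 a -> layer k b ->
  leading 1 a -> leading k b -> leading k.+1 [<a, b>].
Proof.
move=> k0 La Lb Ha Hb r; have [A HA HAq] := Ha r; have [B HB HBq] := Hb 1.
have [|y By Hy] := HBq 1; first by rewrite normr1.
rewrite scale1r in Hy.
exists [set z | exists x y, [/\ A x, B y & z = cconj x y ** (- y)]].
  exact: reachable_commutator.
move=> c cr; have [x Ax Hx] := HAq c cr.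
exists (cconj x y ** (- y)); first by exists x, y.
move=> j jk; rewrite (commutator_filtered _ (filtered_coord Lb Hy) jk).
have E1 : [<x, y>] = [<x - c *: a, y>] + [<c *: a, y>].
  by rewrite -(lbracketDl G (x - c *: a) (c *: a) y) subrK.
have E2 : [<c *: a, y>] = [<c *: a, y - b>] + [<c *: a, b>].
  by rewrite -(lbracketDr G (c *: a) (y - b) b) subrK.
rewrite E1 E2 (lbracketZl G c a b).
have H1 := lbracket_filtered (j := j) (filteredS Hx) (filtered_coord Lb Hy).
have H2 := lbracket_filtered (j := j) (@filtered1 _ _ _ G (c *: a)) (filteredS Hy).
by rewrite [LHS]mxE H1 ?add0r ?ltnS // [LHS]mxE H2 ?add0r.
Qed.

Lemma leading_layer k v : (0 < k)%N -> layer k v -> leading k v.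
Proof.
case: k => // k _; elim: k v => [v|k IH v Hv]; first exact: leading1.
pose P u := layer k.+2 u /\ leading k.+2 u.
suff : P v by case.
have P0 : P 0 by split; [exact: layer0|exact: leading0].
have PD x y : P x -> P y -> P (x + y).
  by move=> [Lx Hx] [Ly Hy]; split; [exact: layerD|exact: leadingD].
have PZ (t : R) x : P x -> P (t *: x).
  by move=> [Lx Hx]; split; [exact: layerZ|exact: leadingZ].
apply: (span_brackets P0 PD PZ (ltn0Sn k) _ Hv) => a b La Lb; split.
  exact: (@lbracket_layer _ _ _ G 1 k.+1).
by apply: leading_lbracket => //; [exact: leading1|exact: IH].
Qed.

(** Multiplying the words for the basis vectors of the layer upgrades [leading] from single lines to
    a whole ball, because products add leading terms. *)
Lemma leading_uniform k (r : R) : (0 < k)%N -> exists2 B, reachable B &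
  forall v, layer k v -> `|v| <= r -> exists2 q, B q &
    forall j, (deg j <= k)%N -> q 0 j = v 0 j.
Proof.
move=> k0.
have H (l : seq 'I_n) : {in l, forall i, deg i = k} -> exists2 B, reachable B &
    forall c : 'I_n -> R, (forall i, `|c i| <= r) -> exists2 q, B q &
      forall j, (deg j <= k)%N -> q 0 j = (\sum_(i <- l) c i *: e_ i) 0 j.
  elim: l => [_|i l IH Hl].
    exists [set 0]; first exact: reachable0.
    by move=> c _; exists 0 => // j _; rewrite big_nil.
  have [|B HB HBc] := IH; first by move=> i' i'l; apply: Hl; rewrite inE i'l orbT.
  have ik : deg i = k by apply: Hl; rewrite inE eqxx.
  have Li : layer k (e_ i) by rewrite -ik; apply: layer_delta.
  have [A HA HAc] := leading_layer k0 Li r.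
  exists [set z | exists x y, [/\ A x, B y & z = x ** y]]; first exact: reachable_mul.
  move=> c cr; have [x Ax Hx] := HAc _ (cr i); have [y By Hy] := HBc c cr.
  exists (x ** y); first by exists x, y.
  rewrite big_cons; apply: (coord_mul_leading k0 _ _ Hx Hy); first exact: layerZ.
  rewrite big_seq; apply: (big_ind (layer k)) => [|u v|i' i'l].
  - exact: layer0.
  - exact: layerD.
  by apply: layerZ; rewrite -(Hl i'); [exact: layer_delta|rewrite inE i'l orbT].
have [|B HB HBc] := H [seq i <- enum 'I_n | deg i == k].
  by move=> i; rewrite mem_filter => /andP[/eqP].
exists B => // v Lv vr; have [i|q Bq Hq] := HBc (fun i => v 0 i).
  exact: le_trans (coord_le_norm _ _) vr.
have vE : v = \sum_(i | deg i == k) v 0 i *: e_ i.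
  rewrite {1}[v]row_sum_delta (bigID (fun i => deg i == k)) /=.
  rewrite [X in _ + X]big1 ?addr0 // => i ik.
  by rewrite Lv // scale0r.
by exists q => // j jk; rewrite Hq // [in RHS]vE big_filter big_enum_cond.
Qed.

(** The lowest layer is stripped off: a reachable q with the same coordinates as x up to degree k
    leaves (- q) ** x in the next step of the filtration, still bounded. The counter m bounds the
    remaining steps; once k > s only x = 0 is left. *)
Lemma reachable_filtered m k (r : R) : (s < k + m)%N -> (0 < k)%N ->
  reachable [set x | filtered k x /\ `|x| <= r].
Proof.
elim: m k r => [|m IH] k r sk k0.
  apply: reachable_sub reachable0 => x [Hx _]; apply/rowP => j; rewrite mxE Hx //.
  by have /andP[_ js] := cdeg_bounds G j; rewrite (leq_ltn_trans js) // -(addn0 k).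
have [B HB HBq] := leading_uniform r k0.
have [M HM] := reachable_bounded HB.
have [C C0 HC] := mul_lipschitz G (`|M| + `|r|).
have HF := IH k.+1 (C * (`|M| + `|r|)); rewrite addSnnS in HF.
apply: reachable_sub (reachable_mul HB (HF sk isT)) => x [Hx xr].
pose v : V := \row_j (if deg j == k then x 0 j else 0).
have Lv : layer k v by move=> j jk; rewrite mxE (negbTE jk).
have [|q Bq Hq] := HBq v Lv.
  apply: norm_le_coord => [|j]; first exact: le_trans xr.
  rewrite mxE; case: ifP => _; first exact: le_trans (coord_le_norm _ _) xr.
  by rewrite normr0 (le_trans _ xr).
have xv j : (deg j <= k)%N -> x 0 j = v 0 j.
  by rewrite mxE leq_eqVlt => /orP[->//|jk]; rewrite ltn_eqF // Hx.
exists q, ((- q) ** x); split => //; last by rewrite cmulKVx.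
split.
  have Hq' j : (deg j <= k)%N -> (- q) 0 j = (- v) 0 j by move=> jk; rewrite !mxE Hq ?mxE.
  have LNv : layer k (- v) by rewrite -scaleN1r; apply: layerZ.
  move=> j jk; rewrite (coord_mul_leading k0 LNv Lv Hq' xv) //.
  by rewrite addNr mxE.
have MC0 : 0 <= `|M| + `|r| by rewrite addr_ge0.
have := HC (- q) x 0 0; rewrite cmulx0 !subr0 normr0 normrN => H.
have qM := le_trans (HM q Bq) (ler_norm M); have xr' := le_trans xr (ler_norm r).
apply: le_trans (H _ _ MC0 MC0) _.
- by rewrite ler_wpDr.
- by rewrite ler_wpDl.
by rewrite ler_wpM2l // lerD.
Qed.

Lemma reachable_ball (r : R) : reachable [set x | `|x| <= r].
Proof.
apply: reachable_sub (@reachable_filtered s 1 r _ isT) => [x xr|].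
  by split => //; apply: filtered1.
by rewrite add1n.
Qed.

End Reachability.

(** * A mean value inequality for absolutely continuous functions *)

Section IntervalChain.
Variable R : realType.
Implicit Types (l : seq (R * R)) (phi : R -> R).

(* [chain a b l]: [l] lists, from right to left, non-overlapping closed
   intervals contained in [a, b]. *)
Fixpoint chain (a b : R) l : bool :=
  if l is p :: l' then [&& a <= p.1, p.1 <= p.2, p.2 <= b & chain a p.1 l']
  else a <= b.

Lemma chain_widen a b c l : b <= c -> chain a b l -> chain a c l.
Proof.
move=> bc; case: l => /= [ab|p l /and4P[-> -> pb ->]]; first exact: le_trans bc.
by rewrite (le_trans pb bc).
Qed.

Lemma chain_bounds a b l i : chain a b l -> (i < size l)%N ->
  a <= (nth (0, 0) l i).1 <= (nth (0, 0) l i).2 /\ (nth (0, 0) l i).2 <= b.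
Proof.
elim: l b i => // p l IH b [|i] /= /and4P[ap pp pb pl]; first by rewrite ap pp pb.
rewrite ltnS => il; have [-> H] := IH _ _ pl il; split => //.
exact: le_trans H (le_trans pp pb).
Qed.

Lemma chain_disjoint a b l i j : chain a b l -> (i < j < size l)%N ->
  (nth (0, 0) l j).2 <= (nth (0, 0) l i).1.
Proof.
elim: l b i j => [|p l IH] b i [|j] //=; rewrite ?andbF ?ltn0 ?andbF //.
move=> /and4P[ap pp pb pl]; case: i => [|i] /=; rewrite ?ltnS.
  by move=> jl; have [] := chain_bounds pl jl.
by move=> ij; apply: (IH p.1).
Qed.

Lemma abs_continuous_chain phi (a b e : R) : abs_continuous a b phi -> 0 < e ->
  exists2 d, 0 < d & forall l, chain a b l -> \sum_(p <- l) (p.2 - p.1) < d ->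
    \sum_(p <- l) `|phi p.2 - phi p.1| < e.
Proof.
move=> AC e0; have [d d0 Hd] := AC e e0; exists d => // l cl.
rewrite !(big_nth (0, 0)) !big_mkord => ld.
apply: (Hd _ (fun i => (nth (0, 0) l i).1) (fun i => (nth (0, 0) l i).2)) => //.
  by move=> i; apply: chain_bounds cl (ltn_ord i).
apply/trivIsetP => i j _ _ ij; rewrite -subset0 => t [] /=.
rewrite !in_itv /= => /andP[i1 i2] /andP[j1 j2].
case: (ltngtP i j) => [lt_ij|lt_ji|/val_inj eij]; last by rewrite eij eqxx in ij.
  have := chain_disjoint cl (i := i) (j := j); rewrite lt_ij ltn_ord => /(_ isT).
  by lra.
have := chain_disjoint cl (i := j) (j := i); rewrite lt_ji ltn_ord => /(_ isT).
by lra.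
Qed.

End IntervalChain.

Section AbsoluteContinuity.
Variable R : realType.
Notation mu := (@lebesgue_measure R).

(* Continuous induction: the points outside [U] are handled by comparison with
   [F], the intervals meeting the exceptional set are swept into a chain in [U]
   whose total length is controlled by [m]. *)
Lemma chain_exhaustion (phi F m : R -> R) (U : set R) (e : R) : 0 < e ->
  open U -> U 0 -> U 1 ->
  (forall s t, 0 <= s -> s <= t -> t <= 1 -> F s <= F t) ->
  (forall s t, 0 <= s -> s <= t -> t <= 1 -> m s <= m t) ->
  (forall s t, 0 <= s -> s <= t -> t <= 1 -> `[s, t] `<=` U -> m s + (t - s) <= m t) ->
  (forall t, 0 < t < 1 -> ~ U t -> exists2 r, 0 < r & forall s, `|s - t| < r ->
     `|phi s - phi t| <= `|F s - F t| + e * `|s - t|) ->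
  exists2 l, chain 0 1 l & \sum_(p <- l) (p.2 - p.1) <= m 1 - m 0 /\
    `|phi 1 - phi 0| <= F 1 - F 0 + e + \sum_(p <- l) `|phi p.2 - phi p.1|.
Proof.
move=> e0 oU U0 U1 Fmono mmono mU good.
(* The claim on [0, t], with the allowance e spent in proportion to t. *)
pose S t := exists2 l, chain 0 t l & \sum_(p <- l) (p.2 - p.1) <= m t - m 0 /\
    `|phi t - phi 0| <= F t - F 0 + e * t + \sum_(p <- l) `|phi p.2 - phi p.1|.
suff : S 1 by case=> l cl [H1 H2]; exists l => //; rewrite mulr1 in H2.
have S0 : S 0.
  by exists [::] => //=; rewrite !big_nil !subrr normr0 mulr0 !addr0.
have goodstep s t : S s -> 0 <= s -> s <= t -> t <= 1 ->
    `|phi t - phi s| <= F t - F s + e * (t - s) -> S t.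
  move=> [l cl [H1 H2]] s0 st t1 H; exists l; first exact: chain_widen cl.
  split; first by move: (mmono _ _ s0 st t1) H1; lra.
  have := ler_normD (phi t - phi s) (phi s - phi 0); rewrite addrA subrK.
  by move: H H2; lra.
have badstep s t : S s -> 0 <= s -> s <= t -> t <= 1 -> `[s, t] `<=` U -> S t.
  move=> [l cl [H1 H2]] s0 st t1 H; exists ((s, t) :: l).
    by rewrite /= s0 st lexx cl.
  rewrite !big_cons /=; split; first by move: (mU _ _ s0 st t1 H) H1; lra.
  have := ler_normD (phi t - phi s) (phi s - phi 0); rewrite addrA subrK.
  have : 0 <= e * (t - s) by rewrite mulr_ge0 ?subr_ge0 // ltW.
  by move: (Fmono _ _ s0 st t1) H2; lra.
pose E : set R := [set t | 0 <= t <= 1 /\ S t].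
have E0 : E 0 by split; rewrite ?lexx ?ler01.
have hE : has_sup E by split; [exists 0|exists 1 => t [/andP[]]].
set c := sup E.
have c0 : 0 <= c by apply: ub_le_sup => //; case: hE.
have c1 : c <= 1 by apply: sup_le_ub; [exists 0|move=> t [/andP[]]].
have near_c r : 0 < r -> exists s, [/\ 0 <= s, c - r < s, s <= c & S s].
  move=> r0; have [s [/andP[s0 s1] Ss] sc] := sup_adherent r0 hE.
  exists s; split => //; apply: ub_le_sup; last by split => //; rewrite s0.
  by case: hE.
have above t : S t -> c < t -> 1 < t.
  move=> St ct; rewrite ltNge; apply/negP => t1.
  suff : t <= c by move: ct; lra.
  apply: ub_le_sup; first by case: hE.
  by split => //; move: c0 ct t1; lra.
have [Uc|Uc] := pselect (U c).
  have /nbhs_ballP[r /= r0 Hr] := open_nbhs_nbhs (conj oU Uc).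
  have [s [s0 sc1 sc Ss]] := near_c _ r0.
  have ball_U t : s <= t -> t < c + r -> U t.
    move=> st tr; apply: Hr; rewrite -ball_normE /= ltr_norml.
    by move: sc1 st tr; lra.
  (* The bad interval [s, t] jumps over c: either t = 1 and the claim is reached, or t > c
     contradicts the choice of c. *)
  pose t := Num.min 1 (c + r / 2).
  have t1 : t <= 1 by rewrite ge_min lexx.
  have tr : t < c + r by rewrite gt_min; apply/orP; right; move: r0; lra.
  have ct : c <= t by rewrite le_min c1 /=; move: r0; lra.
  have St : S t.
    apply: (badstep s) => //; first exact: le_trans ct.
    by move=> u /=; rewrite in_itv /= => /andP[su ut]; apply: ball_U => //; apply: le_lt_trans tr.
  case: (leP 1 (c + r / 2)) => h; first by have <- : t = 1 by apply/min_idPl.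
  have tc : t = c + r / 2 by apply/min_idPr/ltW.
  by have := above t St; move: t1 tc r0; lra.
have c01 : 0 < c < 1.
  rewrite !lt_neqAle c0 c1 !andbT; apply/andP; split; apply/eqP => ceq; apply: Uc.
    by rewrite -ceq.
  by rewrite ceq.
(* Outside U the comparison at c is used twice, from s up to c and then from c to a later time. *)
have [r r0 Hr] := good _ c01 Uc.
have [s [s0 sc1 sc Ss]] := near_c _ r0.
have Sc : S c.
  apply: (goodstep s) => //; rewrite -normrN opprB.
  apply: le_trans (Hr s _) _; first by rewrite ltr_norml; move: sc1 sc r0; lra.
  by rewrite -[`|F s - _|]normrN -[`|s - c|]normrN !opprB !ger0_norm ?subr_ge0 // Fmono.
pose t := Num.min 1 (c + r / 2).
have t1 : t <= 1 by rewrite ge_min lexx.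
have ct : c < t by rewrite lt_min; move: c01 r0; lra.
have tr : t <= c + r / 2 by rewrite ge_min lexx orbT.
have St : S t.
  apply: (goodstep c) => //; first exact: ltW.
  apply: le_trans (Hr t _) _; first by rewrite ltr_norml; move: ct tr r0; lra.
  have ct' := ltW ct.
  by rewrite !ger0_norm ?subr_ge0 // Fmono.
by have := above t St ct; move: t1; lra.
Qed.

(** Let F be a primitive of rho. Almost everywhere F' = rho, so there the increments of phi are
    dominated by those of F up to e. The other points form a null set, covered by an open U of
    measure less than the d which absolute continuity attaches to e/3; hence the chain in U
    contributes less than e/3. *)
Lemma abs_continuous_increment (phi rho : R -> R) :
  abs_continuous 0 1 phi -> mu.-integrable `[0, 1] (EFin \o rho) ->
  (forall t, 0 <= rho t) ->
  {ae mu, forall t, `]0, 1[%classic t -> forall e, 0 < e -> exists2 r, 0 < r &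
    forall h, `|h| < r -> `|phi (t + h) - phi t| <= (rho t + e) * `|h|} ->
  `|phi 1 - phi 0| <= \int[mu]_(t in `[0, 1]) rho t.
Proof.
move=> AC Irho rho0 Hphi.
have m01 := @measurable_itv R `[0, 1].
pose f := rho \_ `[0, 1].
have f0 t : 0 <= f t by rewrite /f patchE; case: ifP.
have If : mu.-integrable setT (EFin \o f).
  have := (@integrable_mkcond _ (measurableTypeR R) R mu `[0, 1] (EFin \o rho) m01).1 Irho.
  by rewrite restrict_EFin.
have IfS (D : set (measurableTypeR R)) : measurable D -> mu.-integrable D (EFin \o f).
  by move=> mD; apply: integrableS If.
pose F x := \int[mu]_(t in `]-oo, x]) f t.
have FB s t : s <= t -> F t - F s = \int[mu]_(u in `]s, t]) f u.
  by move=> st; rewrite /F Rintegral_itvB //; exact: IfS.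
have Fmono s t : s <= t -> F s <= F t.
  by move=> st; rewrite -subr_ge0 FB //; apply: Rintegral_ge0.
have HF := FTC1Ny (fun y => IfS _ (measurable_itv _)) (integrable_locally m01 Irho).
have F01 : F 1 - F 0 <= \int[mu]_(t in `[0, 1]) rho t.
  have -> : F 1 = \int[mu]_(t in `[0, 1]) rho t.
    rewrite /F /f -Rintegral_mkcondr setIidr //.
    by move=> t /=; rewrite !in_itv /= => /andP[].
  by rewrite gerBl //; apply: Rintegral_ge0.
pose good t := forall e, 0 < e -> exists2 r, 0 < r & forall h, `|h| < r ->
  `|phi (t + h) - phi t| <= (rho t + e) * `|h| /\ `|F (t + h) - F t - h * f t| <= e * `|h|.
have [A [mA A0 HA]] : {ae mu, forall t, `]0, 1[%classic t -> good t}.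
  move: HF Hphi; apply: filterS2; first exact: (ae_filter_ringOfSetsType mu).
  move=> t [dF Ft] H t01 e e0.
  have [r r0 Hr] := H t01 e e0.
  have /is_derive_epsP/(_ e e0)[r' r'0 Hr'] : is_derive t 1 F (f t).
    by rewrite -Ft derive1E; apply: derivableP.
  exists (Num.min r r') => [|h]; first by rewrite lt_min r0.
  rewrite lt_min => /andP[/Hr h1 /Hr' h2]; split=> //.
  by move: h2; rewrite [h *: 1]mulr1.
apply/ler_addgt0Pr => e e0.
have e3 : 0 < e / 3 by rewrite divr_gt0.
have [d d0 Hd] := abs_continuous_chain AC e3.
(* The endpoints join the null set so that the open cover contains them, as [chain_exhaustion]
   requires. *)
pose B := A `|` [set 0; 1].
have mB : measurable (B : set (measurableTypeR R)) by apply: measurableU => //; apply: measurableU.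
have nB : mu.-negligible B.
  apply: negligibleU; first by exists A; split.
  by apply: negligibleU; apply/negligibleP => //; exact: lebesgue_measure_set1.
have B0 : mu B = 0%E := measure_negligible mB nB.
have Boo : (mu B < +oo)%E by rewrite B0.
have [U [oU BU Ud]] := lebesgue_regularity_outer mB Boo d0.
have mU : measurable (U : set (measurableTypeR R)) := measurable_realfun.open_measurable oU.
have {}Ud : (mu U < d%:E)%E.
  apply: le_lt_trans Ud; rewrite -{1}(setDUK BU).
  by apply: le_trans (measureU2 mu mB (measurableD mU mB)) _;
    rewrite [X in (X + _ <= _)%E](_ : _ = 0%E) ?add0e //; exact: B0.
have leM (C D : set (measurableTypeR R)) : measurable C -> measurable D ->
    C `<=` D -> (mu C <= mu D)%E.
  by move=> mC mD; apply: le_measure; rewrite inE.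
pose Ut (t : R) : set R := U `&` `[0, t].
have mUt (t : R) : measurable (Ut t : set (measurableTypeR R)) by apply: measurableI.
have UtU (t : R) : (mu (Ut t) <= mu U)%E by apply: leM => //; exact: subIsetl.
have Utfin (t : R) : mu (Ut t) \is a fin_num.
  by rewrite ge0_fin_numE // (le_lt_trans (UtU t)) // (lt_trans Ud) // ltry.
pose m (t : R) := fine (mu (Ut t)).
have mE (t : R) : mu (Ut t) = (m t)%:E by rewrite fineK.
have m0 t : 0 <= m t by rewrite fine_ge0.
have m1 : m 1 < d by rewrite -lte_fin -mE (le_lt_trans (UtU 1)).
have [||||||l cl [l1 l2]] := @chain_exhaustion phi F m U (e / 3) e3 oU.
- by apply: BU; right; left.
- by apply: BU; right; right.
- by move=> s t _ st _; apply: Fmono.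
- move=> s t _ st _; rewrite -lee_fin -!mE; apply: leM => //.
  apply: setIS => u /=; rewrite !in_itv /= => /andP[-> us].
  exact: le_trans st.
- move=> s t s0 st _ stU; rewrite -lee_fin EFinD -!mE.
  have -> : (t - s)%:E = mu `]s, t].
    rewrite lebesgue_measure_itv /= lte_fin; case: ltgtP st => // -> _.
    by rewrite subrr.
  rewrite -measureU //.
  + apply: leM => //; first exact: measurableU.
    move=> u [[Uu]|] /=; rewrite !in_itv /= => /andP[us ut].
      by split => //=; rewrite in_itv /= us (le_trans ut).
    split; first by apply: stU; rewrite /= in_itv /= ltW.
    by rewrite /= in_itv /= ut andbT (le_trans s0) // ltW.
  + rewrite -subset0 => u [[_]] /=; rewrite !in_itv /= => /andP[_ us] /andP[su _].
    by move: us; rewrite leNgt su.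
- move=> t t01 nUt.
  have Gt : good t.
    have [//|nG] := pselect (good t); exfalso; apply: nUt; apply: BU; left.
    by apply: HA => /= H; apply: nG; apply: H; rewrite /= in_itv.
  (* One e/6 for the increment of phi and one for that of F make up the e/3 passed to
     [chain_exhaustion]. *)
  have e6 : 0 < e / 6 by rewrite divr_gt0.
  have [r r0 Hr] := Gt _ e6; exists r => // s sr.
  have ts : t + (s - t) = s by rewrite addrC subrK.
  have [] := Hr (s - t) sr; rewrite ts => h1 h2.
  have ft : f t = rho t.
    by rewrite /f patchE mem_set //= in_itv /=; case/andP: t01 => /ltW -> /ltW ->.
  apply: le_trans h1 _; rewrite mulrDl -ft.
  have -> : f t * `|s - t| = `|(s - t) * f t| by rewrite normrM mulrC (ger0_norm (f0 t)).
  have := ler_normB (F s - F t) (F s - F t - (s - t) * f t); rewrite subKr.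
  by move: h2 (normr_ge0 (s - t)); lra.
have ld : \sum_(p <- l) (p.2 - p.1) < d by move: l1 (m0 0) m1; lra.
by move: (Hd l cl ld) l2 F01; lra.
Qed.

End AbsoluteContinuity.

(** * Horizontal curves and the homogeneous norm *)

Section AbsContinuousLipschitz.
Variables (R : realType) (V W : normedModType R) (a b : R).

Lemma abs_continuous_lipschitz (g : R -> V) (f : R -> W) (C : R) :
  (forall s t, a <= s <= b -> a <= t <= b -> `|f s - f t| <= C * `|g s - g t|) ->
  abs_continuous a b g -> abs_continuous a b f.
Proof.
move=> fg AC e e0; have C1 : 0 < `|C| + 1 by rewrite ltr_wpDl.
have [d d0 Hd] := AC _ (divr_gt0 e0 C1); exists d => // N l r lr tlr lrd.
have := Hd N l r lr tlr lrd; rewrite ltr_pdivlMr // mulr_suml; apply: le_lt_trans.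
apply: ler_sum => i _; have [/andP[al lri] rb] := lr i.
apply: le_trans (fg _ _ _ _) _.
- by rewrite rb (le_trans al).
- by rewrite al (le_trans lri).
by rewrite mulrC ler_wpM2l //; move: (ler_norm C); lra.
Qed.

Lemma abs_continuous_id : abs_continuous a b (id : R -> R).
Proof.
move=> e e0; exists e => // N l r lr _; apply: le_lt_trans.
apply: ler_sum => i _; have [/andP[_ lri] _] := lr i.
by rewrite ger0_norm // subr_ge0.
Qed.

(** Steps of length d/2 change g by less than 1, and finitely many of them cover [a, b]. *)
Lemma abs_continuous_bounded (g : R -> V) : abs_continuous a b g ->
  exists M, forall t, a <= t <= b -> `|g t| <= M.
Proof.
move=> AC; have [d d0 Hd] := AC 1 ltr01; have d2 : 0 < d / 2 by rewrite divr_gt0.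
have step s t : a <= s -> s <= t -> t <= b -> t - s < d -> `|g t - g s| < 1.
  move=> as_ st tb std; have := Hd 1%N (fun=> s) (fun=> t).
  rewrite !big_ord1; apply => //; first by move=> _; rewrite as_ st.
  by apply/trivIsetP => i j _ _; rewrite !ord1 eqxx.
have H k t : a <= t <= b -> t - a <= k%:R * (d / 2) -> `|g t - g a| <= k%:R.
  elim: k t => [|k IH] t /andP[at_ tb].
    rewrite mul0r subr_le0 => ta; have -> : t = a by apply/eqP; rewrite eq_le ta.
    by rewrite subrr normr0.
  rewrite -natr1 => tk.
  pose s := Num.max a (t - d / 2).
  have as_ : a <= s by rewrite le_max lexx.
  have st : s <= t by rewrite ge_max at_ /=; move: d2; lra.
  have sd : t - s < d.
    by have : t - d / 2 <= s by [rewrite le_max lexx orbT]; move: d0; lra.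
  have sk : s - a <= k%:R * (d / 2).
    rewrite lerBlDr ge_max; apply/andP; split; last by move: tk; lra.
    by rewrite lerDr mulr_ge0 // ltW.
  have h1 := step s t as_ st tb sd.
  have h2 : `|g s - g a| <= k%:R by apply: IH => //; rewrite as_ (le_trans st).
  have := ler_normD (g t - g s) (g s - g a); rewrite addrA subrK.
  by move: h1 h2; lra.
exists (`|g a| + (Num.bound ((b - a) / (d / 2)))%:R) => t tab.
have ab : a <= b by case/andP: tab => /le_trans; apply.
have := ler_normD (g t - g a) (g a); rewrite subrK => H1; apply: le_trans H1 _.
rewrite addrC lerD2l; apply: H => //; rewrite -ler_pdivrMr //.
apply: le_trans (_ : (b - a) / (d / 2) <= _).
  by rewrite ler_pM2r ?invr_gt0 // lerD2r; case/andP: tab.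
by apply: ltW; apply: archi_boundP; rewrite divr_ge0 ?subr_ge0 // ltW.
Qed.

End AbsContinuousLipschitz.

Section HorizontalCurves.
Variables (R : realType) (n s : nat) (G : carnot_group R n s).
Notation V := 'rV[R]_n.
Notation mu := (@lebesgue_measure R).
Local Notation "x ** y" := (cmul G x y) (at level 40, left associativity).
Local Notation deg := (cdeg G).
Local Notation delta := (dilation G).
Implicit Types (x y z v w : V) (g : R -> V) (u : 'I_n -> R -> R).

Let m01 : measurable (`[0, 1]%classic : set (measurableTypeR R)) := @measurable_itv R `[0, 1].

Definition hvec (c : 'I_n -> R) : V := \row_j (if deg j == 1%N then c j else 0).

Definition hspeed u t : R := Num.sqrt (\sum_(j < n | deg j == 1%N) u j t ^+ 2).

(** Tangency in group form, g(t + h) = g(t) exp(h u) + o(h). This form passes directly through left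
    translations and dilations. *)
Lemma horizontal_tangentP g u (t : R) :
  is_derive t 1 g (\sum_(j < n | deg j == 1%N) u j t *: basis_field G j (g t)) <->
  small1 (fun h => g (t + h) - g t ** (h *: hvec (u ^~ t))).
Proof.
have -> : \sum_(j < n | deg j == 1%N) u j t *: basis_field G j (g t) =
    lfield (cmul G) (hvec (u ^~ t)) (g t).
  rewrite lfieldE big_mkcond; apply: eq_bigr => j _; rewrite mxE.
  case: ifP => _; last by rewrite scale0r.
  rewrite /basis_field lfieldE; congr (_ *: _); rewrite (bigD1 j) //= mxE !eqxx scale1r.
  by rewrite big1 ?addr0 // => i /negbTE ij; rewrite mxE ij scale0r.
set w := lfield _ _ _; have Hw := lfield_small1 G (g t) (hvec (u ^~ t)).
have E h : g (t + h *: 1) - g t - h *: w = g (t + h) - (g t + h *: w).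
  by rewrite [h *: 1]mulr1 opprD addrA.
split=> [/is_derive_small1|] H.
  apply: small1_eq (small1B H Hw) => h; rewrite E.
  by rewrite opprB addrA subrK.
apply/is_derive_small1; apply: small1_eq (small1D H Hw) => h; rewrite E.
by rewrite addrA subrK.
Qed.

Lemma hspeed_ge0 u t : 0 <= hspeed u t. Proof. exact: sqrtr_ge0. Qed.

Lemma hspeed_le_sum u t : hspeed u t <= \sum_(j < n | deg j == 1%N) `|u j t|.
Proof.
pose P (S Q : R) := 0 <= S /\ Q <= S ^+ 2.
have [S0 H] : P (\sum_(j < n | deg j == 1%N) `|u j t|)
    (\sum_(j < n | deg j == 1%N) u j t ^+ 2).
  apply: (big_rec2 P); first by rewrite /P expr0n.
  move=> j Q S _ [S0 H]; split; first exact: addr_ge0.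
  rewrite sqrrD real_normK ?num_real // -addrA lerD2l.
  by rewrite (le_trans H) // lerDr mulrn_wge0 // mulr_ge0.
by rewrite /hspeed -[leRHS](ger0_norm S0) -sqrtr_sqr ler_sqrt ?sqr_ge0.
Qed.

Lemma hvec_le_hspeed u t : `|hvec (u ^~ t)| <= hspeed u t.
Proof.
apply: norm_le_coord => [|j]; first exact: hspeed_ge0.
rewrite mxE; case: ifP => j1; last by rewrite normr0 hspeed_ge0.
rewrite -sqrtr_sqr /hspeed ler_sqrt; last by apply: sumr_ge0 => i _; apply: sqr_ge0.
by rewrite (bigD1 j) //= lerDl; apply: sumr_ge0 => i _; apply: sqr_ge0.
Qed.

Lemma hspeed_integrable g u : horizontal G 0 1 g u ->
  mu.-integrable `[0, 1] (EFin \o hspeed u).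
Proof.
move=> [_ Iu _].
pose S t := \sum_(j < n | deg j == 1%N) `|u j t|.
have IS : mu.-integrable `[0, 1] (EFin \o S).
  have -> : EFin \o S = (fun t => \sum_(j < n | deg j == 1%N) (`|u j t|)%:E)%E.
    by apply/funext => t; rewrite /= sumEFin.
  apply: (integrable_sum m01) => j /eqP j1.
  exact: integrable_norm (Iu j j1).
apply: (le_integrable m01 _ _ IS).
  apply/measurable_EFinP; apply: (@measurableT_comp _ _ _ _ _ _ (@Num.sqrt R)).
    by apply: continuous_measurable_fun; exact: sqrt_continuous.
  rewrite [X in measurable_fun _ X](_ : _ = (fun t =>
    \sum_j (if deg j == 1%N then u j t ^+ 2 else 0))); last first.
    by apply/funext => t; rewrite big_mkcond.
  apply: (@measurable_sum _ (measurableTypeR R) R `[0, 1] _ _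
    (fun j t => if deg j == 1%N then u j t ^+ 2 else 0)).
  move=> j; case: (deg j =P 1%N) => [j1|_] /=; last exact: measurable_cst.
  apply: (@measurable_funX _ (measurableTypeR R) R `[0, 1] (u j) 2).
  apply/measurable_EFinP.
  by have /integrableP[] := Iu j j1.
move=> t _ /=; rewrite lee_fin !ger0_norm ?hspeed_ge0 ?hspeed_le_sum //.
by apply: sumr_ge0.
Qed.

Definition cc_lengths x y : set R := [set l | exists g u,
  [/\ horizontal G 0 1 g u, g 0 = x, g 1 = y & l = curve_length G 0 1 u]].

(** The controls are kept. Absolute continuity survives because left translation is Lipschitz on the
    bounded range of g. *)
Lemma cc_lengths_translate p x y : cc_lengths x y `<=` cc_lengths (p ** x) (p ** y).
Proof.
move=> l [g [u [[AC Iu Dg] g0 g1 ->]]].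
exists (fun t => p ** g t), u; split; rewrite ?g0 ?g1; try reflexivity.
have [M HM] := abs_continuous_bounded AC.
split; [|exact: Iu|].
  have [C C0 HC] := mul_lipschitz G (`|p| + `|M|).
  apply: (@abs_continuous_lipschitz _ _ _ _ _ _ _ C _ AC) => t t' t01 t'01.
  have gM t0 : 0 <= t0 <= 1 -> `|g t0| <= `|p| + `|M|.
    by move=> /HM H; rewrite ler_wpDl // (le_trans H) // ler_norm.
  apply: le_trans (HC _ _ _ _ _ (gM _ t01) _ (gM _ t'01)) _; rewrite ?lerDl //.
  by rewrite subrr normr0 add0r.
move: Dg; apply: filterS; first exact: (ae_filter_ringOfSetsType mu).
move=> t H t01; apply/horizontal_tangentP; have /horizontal_tangentP Ht := H t01.
have [C C0 HC] := mul_lipschitz G (`|g t| + `|hvec (u ^~ t)|).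
pose B := C * (`|g t| + `|hvec (u ^~ t)|).
have HB h : `|h| <= 1 -> `|g t ** (h *: hvec (u ^~ t))| <= B.
  move=> h1; have hv : `|h *: hvec (u ^~ t)| <= `|hvec (u ^~ t)|.
    by rewrite normrZ ler_piMl.
  have := HC (g t) (h *: hvec (u ^~ t)) 0 0; rewrite cmulx0 !subr0 normr0 => H'.
  apply: le_trans (H' _ _ _ _) _; rewrite ?lerDl ?addr_ge0 //.
    by rewrite ler_wpDl.
  by rewrite ler_wpM2l // lerD2l.
apply: small1_eq (small1_sandwich G p 0 HB Ht) => h.
by rewrite !cmulx0 cmulA.
Qed.

Lemma cc_dist_translate p x y : cc_dist G (p ** x) (p ** y) = cc_dist G x y.
Proof.
congr inf; apply/seteqP; split; last exact: cc_lengths_translate.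
by move=> l /(@cc_lengths_translate (- p)); rewrite !cmulKx.
Qed.

Definition cc_norm x : R := cc_dist G 0 x.

Lemma cc_distE x y : cc_dist G x y = cc_norm ((- x) ** y).
Proof. by rewrite /cc_norm -(cc_dist_translate x 0) cmulx0 cmulKVx. Qed.

Lemma curve_length_ge0 u : 0 <= curve_length G 0 1 u.
Proof. by apply: Rintegral_ge0 => t _; apply: sqrtr_ge0. Qed.

Lemma cc_norm_le x l : cc_lengths 0 x l -> cc_norm x <= l.
Proof.
move=> H; apply: ge_inf => //; exists 0 => _ [g [u [_ _ _ ->]]].
exact: curve_length_ge0.
Qed.

Lemma cc_norm_ge0 x : 0 <= cc_norm x.
Proof.
rewrite /cc_norm /cc_dist; set A := (X in inf X).
have [[l Al]|nA] := pselect (A !=set0).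
  apply: lb_le_inf; first by exists l.
  by move=> _ [g [u [_ _ _ ->]]]; apply: curve_length_ge0.
have -> : A = set0 by apply/seteqP; split => // l Al; case: nA; exists l.
by rewrite inf0.
Qed.

Lemma cc_lengths_dilation (r : R) x y l : 0 < r -> cc_lengths x y l ->
  cc_lengths (delta r x) (delta r y) (r * l).
Proof.
move=> r0 [g [u [Hg g0 g1 ->]]]; have [AC Iu Dg] := Hg.
have hspeedZ t : hspeed (fun j t => r * u j t) t = r * hspeed u t.
  rewrite /hspeed; under eq_bigr do rewrite exprMn.
  by rewrite -mulr_sumr sqrtrM ?sqr_ge0 // sqrtr_sqr gtr0_norm.
exists (fun t => delta r (g t)), (fun j t => r * u j t); split; rewrite ?g0 ?g1; try reflexivity.
- split.
  + apply: (abs_continuous_lipschitz _ AC) => t t' _ _.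
    by rewrite -dilationN -dilationD; apply: dilation_bound.
  + move=> j j1; have := integrableZl m01 r (Iu j j1); exact.
  move: Dg; apply: filterS; first exact: (ae_filter_ringOfSetsType mu).
  move=> t H t01; apply/(@horizontal_tangentP _ (fun j t => r * u j t)).
  have /horizontal_tangentP Ht := H t01.
  apply: (small1_le (C := \sum_j `|r| ^+ deg j) Ht); exists 1 => // h _.
  have -> : h *: hvec (fun j => r * u j t) = delta r (h *: hvec (u ^~ t)).
    apply/rowP => j; rewrite !mxE; case: ifP => [/eqP ->|_]; last by rewrite !mulr0.
    by rewrite expr1 mulrCA.
  by rewrite -dilation_mul -dilationN -dilationD; apply: dilation_bound.
rewrite /curve_length -(RintegralZl r m01); last exact: hspeed_integrable Hg.
by apply: eq_Rintegral => t _; rewrite -hspeedZ.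
Qed.

(** The truncation min(1, |g|) makes one Lipschitz constant of the law suffice: where |g| <= 1 it
    grows at rate at most C times the speed, and where |g| > 1 it is locally constant. The added 1
    only makes the constant positive. *)
Lemma cc_lengths_lower_bound : exists2 C, 0 < C & forall x l,
  cc_lengths 0 x l -> Num.min 1 `|x| <= C * l.
Proof.
have [C C0 HC] := mul_lipschitz G 1.
exists (C + 1) => [|x l [g [u [Hg g0 g1 ->]]]]; first by rewrite ltr_wpDl.
have [AC Iu Dg] := Hg.
pose psi t := Num.min 1 `|g t|.
have -> : Num.min 1 `|x| = `|psi 1 - psi 0|.
  rewrite /psi g0 g1 normr0 [Num.min 1 0]min_r // subr0 ger0_norm //.
have psi_lip t t' : `|psi t - psi t'| <= 1 * `|g t - g t'|.
  rewrite mul1r; have := ler_dist_dist (g t) (g t'); rewrite !ler_norml /psi.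
  by case: (leP 1 `|g t|); case: (leP 1 `|g t'|) => h1 h2; rewrite ?subrr ?lexx; lra.
have ACpsi : abs_continuous 0 1 psi by apply: (abs_continuous_lipschitz _ AC) => t t' _ _.
have Iv := hspeed_integrable Hg.
have IC : mu.-integrable `[0, 1] (EFin \o (fun t => (C + 1) * hspeed u t)).
  by have := integrableZl m01 (C + 1) Iv; exact.
have -> : (C + 1) * curve_length G 0 1 u = \int[mu]_(t in `[0, 1]) ((C + 1) * hspeed u t).
  by rewrite (RintegralZl (C + 1) m01).
apply: abs_continuous_increment => //.
  by move=> t; rewrite mulr_ge0 ?hspeed_ge0 // addr_ge0.
move: Dg; apply: filterS; first exact: (ae_filter_ringOfSetsType mu).
move=> t H t01 e e0; have /horizontal_tangentP Ht := H t01.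
have v0 := hspeed_ge0 u t; set v := hspeed u t in v0 *.
have [r r0 Hr] := Ht e e0.
have [gt|gt] := ltP 1 `|g t|.
  have /is_derive_epsP/(_ 1 ltr01)[q q0 Hq] := H t01; set w := \sum_(j < n | _) _ in Hq.
  have w1 : 0 < `|w| + 1 by rewrite ltr_wpDl.
  have gt1 : 0 < `|g t| - 1 by rewrite subr_gt0.
  exists (Num.min q ((`|g t| - 1) / (`|w| + 1))) => [|h].
    by rewrite lt_min q0 divr_gt0.
  rewrite lt_min ltr_pdivlMr // => /andP[/Hq hq hw].
  have gth : 1 < `|g (t + h)|.
    have : `|g (t + h) - g t| <= `|h| * (`|w| + 1).
      rewrite -(subrK (h *: w) (g (t + h) - g t)); apply: le_trans (ler_normD _ _) _.
      rewrite normrZ mulrDr mulr1 addrC lerD2l; move: hq.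
      by rewrite [h *: 1]mulr1 mul1r.
    have := ler_normB (g (t + h)) (g (t + h) - g t); rewrite subKr.
    by move: hw; lra.
  rewrite /psi min_l ?(ltW gth) // min_l ?(ltW gt) // subrr normr0.
  by rewrite !(mulr_ge0, addr_ge0) // ltW.
exists (Num.min r (1 / (v + 1))) => [|h].
  by rewrite lt_min r0 divr_gt0 // ltr_wpDl.
rewrite lt_min ltr_pdivlMr ?ltr_wpDl // => /andP[/Hr hr hv].
have hv1 : `|h *: hvec (u ^~ t)| <= `|h| * v by rewrite normrZ ler_wpM2l // hvec_le_hspeed.
apply: le_trans (psi_lip _ _) _; rewrite mul1r.
have := ler_normD (g (t + h) - g t ** (h *: hvec (u ^~ t))) (g t ** (h *: hvec (u ^~ t)) - g t).
rewrite addrA subrK => /le_trans; apply.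
have := HC (g t) (h *: hvec (u ^~ t)) (g t) 0; rewrite cmulx0 subrr normr0 add0r subr0 => H1.
have h1 : `|h *: hvec (u ^~ t)| <= 1.
  by apply: le_trans hv1 _; move: hv (normr_ge0 h); lra.
have {}H1 := H1 gt h1 gt ler01.
have : C * `|h *: hvec (u ^~ t)| <= C * (`|h| * v) by rewrite ler_wpM2l.
by move: hr H1 (mulr_ge0 v0 (normr_ge0 h)); lra.
Qed.

End HorizontalCurves.

(** * Polygonal curves, and the homogeneous norm against the Euclidean norm *)

Section PolygonalCurves.
Variables (R : realType) (n s : nat) (G : carnot_group R n s).
Notation V := 'rV[R]_n.
Notation mu := (@lebesgue_measure R).
Local Notation "x ** y" := (cmul G x y) (at level 40, left associativity).
Local Notation deg := (cdeg G).
Local Notation e_ j := (delta_mx 0 j : V).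
Local Notation delta := (dilation G).
Local Notation hvec := (hvec G).
Local Notation cc_norm := (cc_norm G).
Implicit Types (x y z v w : V) (g : R -> V) (u : 'I_n -> R -> R).

Let m01 : measurable (`[0, 1]%classic : set (measurableTypeR R)) := @measurable_itv R `[0, 1].

Let mu01 : mu (`[0%R, 1%R]%classic : set R) = 1%E.
Proof. by rewrite lebesgue_measure_itv /= lte01 oppr0 adde0. Qed.

Let mu01y : (mu (`[0%R, 1%R]%classic : set R) < +oo)%E.
Proof. by rewrite mu01 ltey. Qed.

(* Lipschitz horizontal curves from 0 to [x] with controls bounded by [B] and
   finitely many exceptional times. *)
Definition lip_reach x (B : R) : Prop := exists g u,
  [/\ g 0 = 0, g 1 = x,
      exists M, forall t t', 0 <= t <= 1 -> 0 <= t' <= 1 ->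
        `|g t - g t'| <= M * `|t - t'|,
      forall j, @measurable_fun _ _ (measurableTypeR R) R setT (u j) /\
        forall t, `|u j t| <= B
    & exists bad : seq R, forall t, 0 < t < 1 -> t \notin bad ->
        small1 (fun h => g (t + h) - g t ** (h *: hvec (u ^~ t)))].

Lemma lip_reach_lengths x (B : R) : lip_reach x B ->
  exists2 l, cc_lengths G 0 x l & l <= n%:R * B.
Proof.
move=> [g [u [g0 g1 [M HM] Hu [bad Hbad]]]].
have Iu j : mu.-integrable `[0, 1] (EFin \o u j).
  have [mu_j uB] := Hu j; apply: (measurable_bounded_integrable m01).
  - exact: mu01y.
  - exact: measurable_funTS.
  - by exists B; split; [exact: num_real|move=> C BC t _ /=; apply: le_trans (uB t) (ltW BC)].
have Hg : horizontal G 0 1 g u.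
  split.
  - apply: (abs_continuous_lipschitz _ (@abs_continuous_id _ 0 1)); exact: HM.
  - by move=> j _.
  exists [set` bad]; split.
  - apply: countable_measurable => [t|]; first exact: measurable_set1.
    apply: finite_set_countable; exact: finite_seq.
  - apply: countable_lebesgue_measure0; apply: finite_set_countable; exact: finite_seq.
  move=> t /= nt; have [//|nb] := boolP (t \in bad); exfalso; apply: nt => t01.
  by apply/horizontal_tangentP; apply: Hbad => //; move: t01; rewrite /= in_itv.
exists (curve_length G 0 1 u); first by exists g, u.
have B0 (j : 'I_n) : 0 <= B by have [_ /(_ 0)] := Hu j; apply: le_trans.
have -> : n%:R * B = \int[mu]_(t in `[0, 1]) (n%:R * B).
  rewrite (Rintegral_cst _ m01); have := congr1 fine mu01; rewrite [RHS]/=.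
  by move=> /(congr1 (fun c => n%:R * B * c)) ->; rewrite mulr1.
apply: (le_Rintegral m01); first exact: hspeed_integrable Hg.
  apply: (measurable_bounded_integrable m01 mu01y); first exact: measurable_cst.
  exists (`|n%:R * B|); split; first exact: num_real.
  by move=> C BC t _ /=; apply: ltW.
move=> t _; apply: le_trans (hspeed_le_sum G u t) _.
apply: le_trans (_ : \sum_(j < n) B <= _); last first.
  by rewrite sumr_const card_ord mulr_natl.
rewrite big_mkcond; apply: ler_sum => j _; case: ifP => _; last exact: B0 j.
by have [_] := Hu j.
Qed.

Lemma lip_reach0 (B : R) : 0 <= B -> lip_reach 0 B.
Proof.
move=> B0; exists (fun=> 0), (fun _ _ => 0); split => //.
- by exists 0 => t t' _ _; rewrite subrr normr0 mul0r.
- by move=> j; split; [exact: measurable_cst|move=> t; rewrite normr0].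
exists [::] => t _ _ e e0; exists 1 => // h _; rewrite cmul0x.
rewrite [X in h *: X](_ : _ = 0) ?scaler0 ?subr0 ?normr0 ?mulr_ge0 ?(ltW e0) //.
by apply/rowP => j; rewrite !mxE; case: ifP.
Qed.

(** The given curve is run at double speed on [0, 1/2] and followed by a segment of the
    one-parameter subgroup of X_j with control 2c, so controls double. The exceptional times are
    halved, and 1/2 is added to them. *)
Lemma lip_reach_step x (B c : R) j : lip_reach x B -> deg j = 1%N -> `|c| <= B ->
  lip_reach (x ** (c *: e_ j)) (2 * B).
Proof.
move=> [g [u [g0 g1 [M HM] Hu [bad Hbad]]]] j1 cB.
pose line t := x ** ((2 * t - 1) *: (c *: e_ j)).
pose g' t := if t <= 1 / 2 then g (2 * t) else line t.
pose u' i t := if t < 1 / 2 then 2 * u i (2 * t) else (if i == j then 2 * c else 0).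
have g'line t : 1 / 2 <= t -> g' t = line t.
  rewrite le_eqVlt => /predU1P[<-|ht]; last by rewrite /g' leNgt ht.
  have half : 2 * (1 / 2) = 1 :> R by field.
  by rewrite /g' lexx /line half g1 subrr scale0r cmulx0.
exists g', u'; split.
- by rewrite /g' mulr0 ifT // divr_ge0.
- rewrite g'line; last by lra.
  by rewrite /line mulr1 [2 - 1](_ : _ = 1) ?scale1r //; lra.
- have [C C0 HC] := mul_lipschitz G (`|x| + `|c *: e_ j|).
  pose M' := 2 * `|M| + 2 * C * `|c *: e_ j|.
  have P2 : 0 <= 2 * C * `|c *: e_ j| by rewrite !mulr_ge0.
  have first_half t t' : 0 <= t <= 1 / 2 -> 0 <= t' <= 1 / 2 ->
      `|g' t - g' t'| <= M' * `|t - t'|.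
    move=> /andP[t0 t1] /andP[t'0 t'1]; rewrite /g' t1 t'1.
    apply: le_trans (HM _ _ _ _) _; [by lra|by lra|].
    rewrite -mulrBr normrM [`|2|]ger0_norm // mulrA ler_wpM2r //.
    by rewrite /M'; move: (ler_norm M) P2; lra.
  have second_half t t' : 1 / 2 <= t <= 1 -> 1 / 2 <= t' <= 1 ->
      `|g' t - g' t'| <= M' * `|t - t'|.
    move=> /andP[t0 t1] /andP[t'0 t'1]; rewrite !g'line //.
    have bnd r : 1 / 2 <= r <= 1 -> `|(2 * r - 1) *: (c *: e_ j)| <= `|x| + `|c *: e_ j|.
      move=> hr; rewrite normrZ ler_wpDl // ler_piMl // ler_norml; move: hr; lra.
    apply: le_trans (HC _ _ _ _ _ _ _ _) _; rewrite ?lerDl //.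
    - by apply: bnd; rewrite t0.
    - by apply: bnd; rewrite t'0.
    rewrite subrr normr0 add0r -scalerBl normrZ.
    have -> : 2 * t - 1 - (2 * t' - 1) = 2 * (t - t') by ring.
    rewrite normrM [`|2|]ger0_norm //.
    rewrite [leLHS](_ : _ = 2 * C * `|c *: e_ j| * `|t - t'|); last by ring.
    by rewrite ler_wpM2r // lerDr mulr_ge0.
  exists M' => t t'; wlog tt' : t t' / t <= t'.
    move=> H t01 t'01; have [|/ltW] := leP t t'; first by move=> h; apply: H.
    by move=> h; rewrite distrC [`|t - _|]distrC; apply: H.
  move=> /andP[t0 t1] /andP[t'0 t'1].
  have [h1|/ltW h1] := leP t' (1 / 2).
    by apply: first_half; rewrite ?t0 ?t'0 // (le_trans tt').
  have [h2|/ltW h2] := leP t (1 / 2); last by apply: second_half; rewrite ?h1 ?h2.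
  have H1 := first_half t (1 / 2); have H2 := second_half (1 / 2) t'.
  have := ler_normD (g' t - g' (1 / 2)) (g' (1 / 2) - g' t'); rewrite addrA subrK.
  move=> /le_trans; apply.
  have -> : `|t - t'| = `|t - 1 / 2| + `|1 / 2 - t'|.
    by rewrite -(normrN (t - t')) -(normrN (t - 1 / 2)) -(normrN (1 / 2 - t')) !ger0_norm; lra.
  rewrite mulrDr; apply: lerD; [apply: H1|apply: H2]; lra.
- move=> i; have [mui uB] := Hu i; split.
    apply: measurable_fun_ifT.
    + by apply: measurable_fun_ltr => //; exact: measurable_cst.
    + apply: measurable_funM; first exact: measurable_cst.
      apply: (measurableT_comp mui); apply: measurable_funM => //; exact: measurable_cst.
    + exact: measurable_cst.
  have B0 : 0 <= B by apply: le_trans cB.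
  move=> t; rewrite /u'; case: ifP => _.
    by rewrite normrM [`|2|]ger0_norm // ler_wpM2l.
  case: ifP => _; first by rewrite normrM [`|2|]ger0_norm // ler_wpM2l.
  by rewrite normr0 mulr_ge0.
exists (1 / 2 :: [seq b / 2 | b <- bad]) => t /andP[t0 t1].
rewrite inE negb_or => /andP[t2 tb]; have [ht|ht|ht] := ltgtP t (1 / 2).
- have tb2 : 2 * t \notin bad.
    apply: contra tb => tb; apply/mapP; exists (2 * t) => //; lra.
  have t2' : 0 < 2 * t < 1 by move: t0 ht; lra.
  move=> e e0; have e2 : 0 < e / 2 by rewrite divr_gt0.
  have [r r0 Hr] := Hbad _ t2' tb2 _ e2.
  exists (Num.min (r / 2) (1 / 2 - t)) => [|h].
    by rewrite lt_min divr_gt0 //= subr_gt0.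
  rewrite lt_min => /andP[hr hh].
  have h2 : `|2 * h| < r by rewrite normrM [`|2|]ger0_norm //; move: hr; lra.
  have := Hr _ h2; rewrite normrM [`|2|]ger0_norm //.
  rewrite [leRHS](_ : _ = e * `|h|); last by field.
  have -> : g' (t + h) = g (2 * t + 2 * h).
    rewrite /g' mulrDr ifT //; move: hh (ler_norm h); lra.
  have -> : g' t = g (2 * t) by rewrite /g' ltW.
  have -> : (2 * h) *: hvec (u ^~ (2 * t)) = h *: hvec (u' ^~ t).
    apply/rowP => i; rewrite !mxE /u' ht; case: ifP => _; last by rewrite !mulr0.
    by rewrite mulrCA mulrA.
  exact.
- move=> e e0; exists (t - 1 / 2) => [|h hh]; first by rewrite subr_gt0.
  have th : 1 / 2 <= t + h.
    by have := ler_norm (- h); rewrite normrN; move: hh; lra.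
  have ht' := ltW ht; rewrite !g'line //; have -> : hvec (u' ^~ t) = (2 * c) *: e_ j.
    apply/rowP => i; rewrite !mxE /u' ltNge (ltW ht) /= eq_sym.
    by case: (eqVneq j i) => [<-|]; rewrite ?j1 ?mulr1 ?mulr0 //; case: ifP.
  have -> : line (t + h) = line t ** (h *: ((2 * c) *: e_ j)).
    rewrite /line -cmulA [h *: _](_ : _ = (2 * h) *: (c *: e_ j)).
      by rewrite cmul_exp; congr (_ ** (_ *: _)); ring.
    by rewrite !scalerA; congr (_ *: _); ring.
  by rewrite subrr normr0 mulr_ge0 // ltW.
- by rewrite ht eqxx in t2.
Qed.

Lemma lip_reach_hprod (C : R) l : 0 <= C -> hword G C l ->
  lip_reach (hprod G l) (2 ^+ size l * C).
Proof.
move=> C0; elim/last_ind: l => [_|l p IH].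
  by apply: lip_reach0; rewrite mulr_ge0.
rewrite /hword all_rcons size_rcons => /andP[/andP[/eqP p1 pC] lC].
rewrite hprod_rcons exprS -mulrA; apply: lip_reach_step => //; first exact: IH.
apply: le_trans pC _; rewrite ler_peMl // exprn_ege1 // ler1n.
by [].
Qed.

Lemma cc_lengths_hprod N (C : R) : exists2 D, 0 <= D & forall l,
  (size l <= N)%N -> hword G C l ->
  exists2 d, cc_lengths G 0 (hprod G l) d & d <= D.
Proof.
exists (n%:R * (2 ^+ N * `|C|)) => [|l lN lC].
  by rewrite !mulr_ge0 // exprn_ge0.
have lC' := hword_le (ler_norm C) lC.
have [d Hd dl] := lip_reach_lengths (lip_reach_hprod (normr_ge0 C) lC').
exists d => //; apply: le_trans dl _; rewrite ler_wpM2l // ler_wpM2r //.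
by rewrite ler_weXn2l // ler1n.
Qed.

(** Lower bounds on all lengths give lower bounds on [inf] only for a nonempty set, as [inf] of the
    empty set defaults to 0. *)
Lemma cc_lengths_nonempty x : cc_lengths G 0 x !=set0.
Proof.
have [N [C H]] := reachable_ball G `|x|; have [l [lN lC <-]] := H x (lexx _).
by have [D _ HD] := cc_lengths_hprod N C; have [d Hd _] := HD l lN lC; exists d.
Qed.

Lemma cc_norm_hprod N (C : R) : exists2 D, 0 <= D & forall l,
  (size l <= N)%N -> hword G C l -> cc_norm (hprod G l) <= D.
Proof.
have [D D0 HD] := cc_lengths_hprod N C; exists D => // l lN lC.
by have [d Hd dD] := HD l lN lC; apply: le_trans dD; apply: cc_norm_le.
Qed.

Lemma cc_norm_dilation (r : R) x : 0 < r -> cc_norm (delta r x) = r * cc_norm x.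
Proof.
have half (q : R) y : 0 < q -> cc_norm (delta q y) <= q * cc_norm y.
  move=> q0; rewrite -ler_pdivrMl //; apply: lb_le_inf; first exact: cc_lengths_nonempty.
  move=> l Hl; rewrite ler_pdivrMl //; apply: cc_norm_le.
  by have := cc_lengths_dilation q0 Hl; rewrite dilation0.
move=> r0; apply/eqP; rewrite eq_le half //=.
rewrite -ler_pdivlMl //; have rV0 : 0 < r^-1 by rewrite invr_gt0.
have := half _ (delta r x) rV0.
by rewrite dilation_comp mulVf ?gt_eqF // dilation1.
Qed.

Lemma cc_norm_lower_bound : exists2 C, 0 < C & forall x, Num.min 1 `|x| <= C * cc_norm x.
Proof.
have [C C0 HC] := cc_lengths_lower_bound G; exists C => // x.
rewrite -ler_pdivrMl //; apply: lb_le_inf; first exact: cc_lengths_nonempty.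
by move=> l Hl; rewrite ler_pdivrMl //; apply: HC.
Qed.

Lemma cc_norm_gt0 x : x != 0 -> 0 < cc_norm x.
Proof.
move=> x0; have [C C0 HC] := cc_norm_lower_bound.
have : 0 < Num.min 1 `|x| by rewrite lt_min ltr01 normr_gt0.
by move=> /lt_le_trans /(_ (HC x)); rewrite pmulr_rgt0.
Qed.

Lemma cc_norm0 : cc_norm 0 = 0.
Proof.
have := @cc_norm_dilation 2 0 (ltr0n R 2); rewrite dilation0; lra.
Qed.

Lemma cc_norm_ball_bounded : exists2 M, 0 <= M & forall x, cc_norm x <= 1 -> `|x| <= M.
Proof.
have [C C0 HC] := cc_norm_lower_bound.
have C2 : 0 < C * 2 by rewrite mulr_gt0.
exists (\sum_j `|C * 2| ^+ deg j) => [|x x1].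
  by apply: sumr_ge0 => j _; apply: exprn_ge0.
(* This scale gives C [cc_norm y] <= 1/2, so the minimum in [cc_norm_lower_bound] is |y| and not
   1. *)
pose y := delta (C * 2)^-1 x.
have xy : x = delta (C * 2) y by rewrite dilation_comp divff ?dilation1 // gt_eqF.
have y1 : `|y| <= 1.
  have := HC y; rewrite /y cc_norm_dilation ?invr_gt0 //.
  have : C * ((C * 2)^-1 * cc_norm x) <= 1 / 2.
    have -> : C * ((C * 2)^-1 * cc_norm x) = cc_norm x / 2.
      by field; rewrite gt_eqF.
    by move: x1; lra.
  by rewrite -/y; case: (leP 1 `|y|) => h; lra.
rewrite {1}xy; apply: le_trans (dilation_bound G _ _) _.
by rewrite ler_piMr //; apply: sumr_ge0 => j _; apply: exprn_ge0.
Qed.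

Lemma cc_norm_ball_le (r : R) : exists2 D, 0 <= D & forall x, `|x| <= r -> cc_norm x <= D.
Proof.
have [N [C H]] := reachable_ball G r; have [D D0 HD] := cc_norm_hprod N C.
by exists D => // x /H[l [lN lC <-]]; apply: HD.
Qed.

(** A small x is dilated by q = (D + 1)/e into the unit ball, where [cc_norm] is at most D;
    homogeneity then divides by q. *)
Lemma cc_norm_small (e : R) : 0 < e -> exists2 r, 0 < r & forall x, `|x| <= r -> cc_norm x <= e.
Proof.
move=> e0; have [D D0 HD] := cc_norm_ball_le 1.
have D1 : 0 < D + 1 by rewrite ltr_wpDl.
pose q := (D + 1) / e; have q0 : 0 < q by rewrite divr_gt0.
pose K := \sum_j `|q| ^+ deg j.
have K0 : 0 <= K by apply: sumr_ge0 => j _; apply: exprn_ge0.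
have K1 : 0 < K + 1 by rewrite ltr_wpDl.
exists (1 / (K + 1)) => [|x]; first by rewrite divr_gt0.
rewrite ler_pdivlMr // => xK.
have qx : `|delta q x| <= 1.
  apply: le_trans (dilation_bound G _ _) _; apply: le_trans xK.
  by rewrite mulrC ler_wpM2l // lerDl.
have := HD _ qx; rewrite cc_norm_dilation // /q mulrAC ler_pdivrMr // => H.
rewrite -(ler_pM2l D1); apply: le_trans H _.
by rewrite ler_pM2r // lerDl.
Qed.

Lemma cc_norm_scale x : x != 0 ->
  exists y, x = delta (cc_norm x) y /\ cc_norm y = 1.
Proof.
move=> x0; have r0 := cc_norm_gt0 x0; exists (delta (cc_norm x)^-1 x).
rewrite dilation_comp divff ?gt_eqF // dilation1; split => //.
by rewrite cc_norm_dilation ?invr_gt0 // mulVf // gt_eqF.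
Qed.

(** Bounds on the unit ball of [cc_norm], extended by homogeneity. By left invariance this compares
    d(x, y) with d(y, x). *)
Lemma cc_norm_opp : exists2 C, 0 < C & forall x, cc_norm (- x) <= C * cc_norm x.
Proof.
have [M M0 HM] := cc_norm_ball_bounded; have [D D0 HD] := cc_norm_ball_le M.
exists (D + 1) => [|x]; first by rewrite ltr_wpDl.
have [->|x0] := eqVneq x 0; first by rewrite oppr0 cc_norm0 mulr0.
have r0 := cc_norm_gt0 x0; have [y [xy y1]] := cc_norm_scale x0.
rewrite {1}xy -dilationN cc_norm_dilation // mulrC ler_pM2r //.
by apply: le_trans (HD _ _) _; rewrite ?lerDl // normrN; apply: HM; rewrite y1.
Qed.

End PolygonalCurves.

(** * Porosity and differentiability *)

Section Porosity.
Variables (R : realType) (M : Type) (rho : M -> M -> R).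
Hypothesis rho_ge0 : forall x y, 0 <= rho x y.
Implicit Types (A : set M) (x y : M).

Definition porosity_points A (lambda : R) : set M :=
  [set x | A x /\ porous_at rho A lambda x].

(** Holes of A are also holes of every subset of A. *)
Lemma porous_porosity_points A lambda : 0 < lambda ->
  porous rho (porosity_points A lambda).
Proof.
move=> l0; exists lambda => // a [_ [x [xa xna xA]]]; exists x; split => // k.
by rewrite -subset0 -(xA k) => y [Hy [Ay _]].
Qed.

(** Contraposition: if every radius 1/(k+1) fails, the failing points y_k are centres of holes
    converging to x. *)
Lemma not_porous_at A lambda x : ~ porous_at rho A lambda x ->
  exists2 d, 0 < d & forall y, y <> x -> rho y x < d ->
    exists2 z, A z & rho y z < lambda * rho x y.
Proof.
move=> nP; apply: contrapT => H; apply: nP.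
have /choice[y Hy] k : exists y, [/\ y <> x, rho y x < k.+1%:R^-1 &
    [set z | rho y z < lambda * rho x y] `&` A = set0].
  apply: contrapT => Hk; apply: H; exists k.+1%:R^-1; first by rewrite invr_gt0.
  move=> y yx yk; apply: contrapT => Hz; apply: Hk; exists y; split => //.
  by rewrite -subset0 => z [Hyz Az]; apply: Hz; exists z.
exists y; split; [|by move=> k; have [] := Hy k|by move=> k; have [] := Hy k].
apply/cvgrPdist_le => e e0; have /cvgrPdist_le/(_ e e0) := @cvg_harmonic R.
apply: filterS => k; rewrite !sub0r !normrN !ger0_norm ?invr_ge0 //; apply: le_trans.
by have [_ /ltW] := Hy k.
Qed.

End Porosity.

Lemma common_radius (R : realType) (I : finType) (Q : I -> R -> Prop) :
  (forall i, exists2 d, 0 < d & forall r, r < d -> Q i r) ->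
  exists2 d, 0 < d & forall r, r < d -> forall i, Q i r.
Proof.
move=> H; have /choice[d Hd] i : exists d, 0 < d /\ forall r, r < d -> Q i r.
  by have [d d0 Hd] := H i; exists d.
exists (\big[Num.min/1]_i d i).
  by apply: lt_bigmin => // i _; have [] := Hd i.
move=> r rd i; have [_] := Hd i; apply; apply: lt_le_trans rd _.
exact: bigmin_le.
Qed.

(** * The exceptional set and the Pansu derivative *)

Section Differentiability.
Variables (R : realType) (n s : nat) (G : carnot_group R n s).
Notation V := 'rV[R]_n.
Local Notation "x ** y" := (cmul G x y) (at level 40, left associativity).
Local Notation deg := (cdeg G).
Local Notation e_ j := (delta_mx 0 j : V).
Local Notation delta := (dilation G).
Local Notation cc_norm := (cc_norm G).
Implicit Types (x y z v w p : V) (f : V -> R).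

Lemma cc_dist_ge0 x y : 0 <= cc_dist G x y.
Proof. by rewrite cc_distE; apply: cc_norm_ge0. Qed.

Definition increment_set f j (q e r : R) : set V :=
  [set z | forall t, `|t| < r -> `|f (z ** (t *: e_ j)) - f z - t * q| <= e * `|t|].

(** In order: the direction, the rational slope, and the naturals l, k, m for which the tolerance,
    the radius and the porosity constant are 1/(l+1), 1/(k+1), 1/(m+1). The type is countable, which
    makes the union sigma-porous. *)
Definition exceptional_index : Type := ('I_n * rat * nat * nat * nat)%type.

Definition exceptional_piece f (a : exceptional_index) : set V :=
  let: (j, q, l, k, m) := a in
  porosity_points (cc_dist G)
    (increment_set f j (ratr q) l.+1%:R^-1 k.+1%:R^-1) m.+1%:R^-1.

Definition exceptional_set f : set V := \bigcup_a exceptional_piece f a.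

Lemma sigma_porous_exceptional_set f : sigma_porous (cc_dist G) (exceptional_set f).
Proof.
(* Numbers that code no index give the empty set, which is porous vacuously. *)
exists (fun k => if unpickle k is Some a then exceptional_piece f a else set0).
  move=> k; case: unpickle => [[[[[j q] l] k'] m]|]; last by exists 1.
  by apply: porous_porosity_points; rewrite invr_gt0.
apply/seteqP; split=> x [a _ Hx].
  by exists (pickle a); [exact: I|rewrite pickleK].
by move: Hx; case: (unpickle a) => [b Hb|[]]; exists b.
Qed.

(** By left invariance the conjugate measures the distance between two points after right
    translation by exp(t X_j). Stated at unit scale and uniformly in |t| <= C, it is later
    transported to scale r by a dilation. The 1/2 keeps the truncated norm below 1. *)
Lemma conjugation_small (C e : R) : 0 < e -> exists2 r, 0 < r &
  forall w t j, cc_norm w <= r -> `|t| <= C ->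
    cc_norm w <= e /\ cc_norm ((- (t *: e_ j)) ** w ** (t *: e_ j)) <= e.
Proof.
move=> e0; have [r r0 Hr] := cc_norm_small G e0.
have [K K0 HK] := sandwich_lipschitz G (`|C|) 1.
have [D D0 HD] := cc_norm_lower_bound G.
have K1 : 0 < K + 1 by rewrite ltr_wpDl.
exists (Num.min e (Num.min (1 / 2) (r / (K + 1)) / D)) => [|w t j].
  by rewrite lt_min e0 divr_gt0 // lt_min !divr_gt0.
rewrite le_min ler_pdivlMr // => /andP[we wD] tC; split => //; apply: Hr.
have te : `|t *: e_ j| <= `|C|.
  rewrite normrZ; apply: le_trans (_ : `|t| * 1 <= _).
    rewrite ler_wpM2l //; apply: norm_le_coord => // i; rewrite !mxE eqxx /=.
    by case: (i == j); rewrite ?normr1 ?normr0.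
  by rewrite mulr1 (le_trans tC) // ler_norm.
have wmin : Num.min 1 `|w| <= Num.min (1 / 2) (r / (K + 1)).
  by apply: le_trans (HD w) _; rewrite mulrC.
have [w1 wr] : `|w| <= 1 /\ `|w| <= r / (K + 1).
  move: wmin; rewrite le_min => /andP[]; case: (leP 1 `|w|) => h h1 h2; first by lra.
  by split => //; apply: ltW.
rewrite -[X in `|X|]subr0.
have <- : (- (t *: e_ j)) ** 0 ** (t *: e_ j) = 0 by rewrite cmulx0 cmul_Nx.
apply: le_trans (HK _ _ _ _ _ _ _ _) _; rewrite ?normrN ?normr0 // subr0.
move: wr; rewrite ler_pdivlMr // mulrC; apply: le_trans.
by rewrite ler_wpM2r // lerDl.
Qed.

Lemma horizontal_dilation (r t : R) j : deg j = 1%N ->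
  delta r (t *: e_ j) = (r * t) *: e_ j.
Proof.
move=> j1; rewrite dilationZ (@dilation_layer _ _ _ G r 1) ?expr1 ?scalerA 1?mulrC //.
by have := @layer_delta _ _ _ G j; rewrite j1.
Qed.

Lemma has_dir_derivativeP f x j : has_dir_derivative G f x (e_ j) ->
  exists c, forall e, 0 < e -> exists2 r, 0 < r &
    forall t, `|t| < r -> `|f (x ** (t *: e_ j)) - f x - t * c| <= e * `|t|.
Proof.
move=> /cvg_ex[c /cvgrPdist_le H]; exists c => e e0.
have [r /= r0 Hr] := H e e0; exists r => // t tr.
have [->|t0] := eqVneq t 0.
  by rewrite scale0r cmulx0 subrr mul0r subr0 normr0 mulr0.
have := Hr t; rewrite /= sub0r normrN => /(_ tr t0).
rewrite -(ler_pM2r (x := `|t|)) ?normr_gt0 // -normrM mulrBl divfK //.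
by rewrite distrC (mulrC c).
Qed.

Section LipschitzFunction.
Variables (f : V -> R) (K : R).
Hypothesis K0 : 0 <= K.
Hypothesis f_lipschitz : forall x y, `|f x - f y| <= K * cc_dist G x y.

Lemma increment_step x j (c e C D : R) : deg j = 1%N -> 0 < e -> 0 <= C -> 0 <= D ->
  ~ exceptional_set f x ->
  (forall e, 0 < e -> exists2 r, 0 < r &
    forall t, `|t| < r -> `|f (x ** (t *: e_ j)) - f x - t * c| <= e * `|t|) ->
  exists2 d, 0 < d & forall r, r < d -> 0 < r -> forall p t,
    cc_norm p <= D -> `|t| <= C ->
    `|f (x ** delta r p ** ((r * t) *: e_ j)) - f (x ** delta r p) - r * t * c| <= e * r.
Proof.
move=> j1 e0 C0 D0 xE Hc.
(* Error budget at scale r: 2 K eta r for moving both endpoints from y to z, C eta r for z in A, and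
   C eta r / 2 for replacing c by the rational q. The sum stays below (2 (K + C) + 1) eta r. *)
have S0 : 0 < 2 * (K + C) + 1 by rewrite ltr_wpDl // mulr_ge0 // addr_ge0.
pose e1 := e / (2 * (K + C) + 1); have e10 : 0 < e1 by rewrite divr_gt0.
have harm (b : R) : 0 < b -> exists k, k.+1%:R^-1 <= b.
  move=> b0; exists (Num.bound b^-1).
  rewrite invf_ple ?posrE // ltW //; apply: lt_le_trans (archi_boundP _) _.
    by rewrite invr_ge0 ltW.
  by rewrite ler_nat.
have [l le1] := harm _ e10; pose eta : R := l.+1%:R^-1.
have eta0 : 0 < eta by rewrite invr_gt0.
have [q Hq] : exists q : rat, `|ratr q - c| <= eta / 2.
  have [|q] := @rat_in_itvoo R (c - eta / 2) (c + eta / 2); first by move: eta0; lra.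
  by rewrite in_itv /= => /andP[q1 q2]; exists q; rewrite ler_norml; lra.
have [r1 r10 Hr1] := Hc (eta / 2) (divr_gt0 eta0 (ltr0n R 2)).
have [k kr1] := harm _ r10.
set A := increment_set f j (ratr q) eta k.+1%:R^-1.
have Ax : A x.
  move=> t tk; have tr1 : `|t| < r1 by apply: lt_le_trans kr1.
  have := Hr1 t tr1.
  have -> : f (x ** (t *: e_ j)) - f x - t * ratr q =
    (f (x ** (t *: e_ j)) - f x - t * c) - t * (ratr q - c) by ring.
  move=> h; apply: le_trans (ler_normB _ _) _; rewrite normrM.
  have : `|t| * `|ratr q - c| <= `|t| * (eta / 2) by rewrite ler_wpM2l.
  by move: h; lra.
have [mu mu0 Hmu] := conjugation_small C eta0.
(* Since y is within D r of x, this porosity constant leaves a point of A within mu r of y, at every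
   scale r. *)
have [m Hm] := harm (mu / (D + 1)) (divr_gt0 mu0 (ltr_wpDl D0 ltr01)).
have nP : ~ porous_at (cc_dist G) A m.+1%:R^-1 x.
  by move=> P; apply: xE; exists (j, q, l, k, m).
have [d d0 Hd] := not_porous_at cc_dist_ge0 nP.
have [Cs Cs0 HCs] := cc_norm_opp G.
have CsD : 0 < Cs * D + 1 by rewrite ltr_wpDl // mulr_ge0 // ltW.
have C1 : 0 < C + 1 by rewrite ltr_wpDl.
(* The first bound puts y within d of x, with [Cs] paying for the exchange of arguments; the second
   keeps |r t| below the radius in the definition of A. *)
exists (Num.min (d / (Cs * D + 1)) (k.+1%:R^-1 / (C + 1))) => [|r].
  by rewrite lt_min !divr_gt0 // invr_gt0.
rewrite lt_min !ltr_pdivlMr // => /andP[rd rk] r0 p t pD tC.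
have rt : `|r * t| <= C * r by rewrite normrM gtr0_norm // mulrC ler_wpM2r // ltW.
have rtk : `|r * t| < k.+1%:R^-1.
  by apply: le_lt_trans rt _; apply: le_lt_trans rk; move: r0; lra.
set y := x ** delta r p; set h : V := (r * t) *: e_ j.
have pr : cc_norm (delta r p) <= D * r.
  by rewrite cc_norm_dilation // mulrC ler_wpM2r // ltW.
(* The point of A near y, written as y ** [delta r w]. For p = 0 the point y is x itself, which lies
   in A; non-porosity only speaks of y different from x. *)
have [w [Aw wr]] : exists w, A (y ** delta r w) /\ cc_norm w <= mu.
  have [p0|p0] := eqVneq p 0.
    by exists 0; rewrite /y p0 !dilation0 !cmulx0 cc_norm0; split => //; apply: ltW.
  have yx : y <> x.
    move=> yx; have : delta r p = 0 by rewrite -(cmulKx G x (delta r p)) -/y yx cmul_Nx.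
    move=> rp0; have : cc_norm (delta r p) = 0 by rewrite rp0 cc_norm0.
    by rewrite cc_norm_dilation // => /eqP; rewrite mulf_eq0 !gt_eqF // cc_norm_gt0.
  have dyx : cc_dist G y x < d.
    rewrite cc_distE /y cmul_opp -cmulA cmul_Nx cmulx0.
    apply: le_lt_trans (HCs _) _; apply: le_lt_trans rd.
    apply: le_trans (_ : Cs * (D * r) <= _); first by rewrite ler_wpM2l // ltW.
    by move: r0; lra.
  have [z Az yz] := Hd y yx dyx.
  exists (delta r^-1 ((- y) ** z)); split.
    by rewrite dilation_comp divff ?gt_eqF // dilation1 cmulKVx.
  rewrite cc_norm_dilation ?invr_gt0 // ler_pdivrMl // -cc_distE; apply: le_trans (ltW yz) _.
  rewrite cc_distE /y cmulKx; move: Hm; rewrite ler_pdivlMr ?ltr_wpDl // => Hm.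
  have m0 : 0 <= m.+1%:R^-1 :> R by rewrite invr_ge0.
  apply: le_trans (_ : m.+1%:R^-1 * (D * r) <= _); first by rewrite ler_wpM2l.
  by move: Hm r0 m0; set a := m.+1%:R^-1; nra.
have [we1 we2] := Hmu w t j wr tC.
set z := y ** delta r w in Aw *.
have f1 : `|f y - f z| <= K * (eta * r).
  apply: le_trans (f_lipschitz _ _) _; rewrite ler_wpM2l //.
  by rewrite cc_distE /z cmulKx cc_norm_dilation // mulrC ler_wpM2r // ltW.
have f2 : `|f (y ** h) - f (z ** h)| <= K * (eta * r).
  apply: le_trans (f_lipschitz _ _) _; rewrite ler_wpM2l //.
  rewrite cc_distE /z cmul_opp.
  have -> : (- h) ** (- y) ** (y ** delta r w ** h) =
      delta r ((- (t *: e_ j)) ** w ** (t *: e_ j)).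
    have gen u v w' : (- u) ** (- v) ** (v ** w' ** u) = (- u) ** w' ** (u : V).
      by rewrite !cmulA cmulxVK.
    by rewrite gen !dilation_mul dilationN horizontal_dilation.
  by rewrite cc_norm_dilation // mulrC ler_wpM2r // ltW.
have f3 := Aw _ rtk.
have -> : f (y ** h) - f y - r * t * c = (f (y ** h) - f (z ** h)) +
  (f (z ** h) - f z - r * t * ratr q) - (f y - f z) + r * t * (ratr q - c) by ring.
have f4 : `|r * t * (ratr q - c)| <= (C * r) * (eta / 2) by rewrite normrM ler_pM.
have f5 : eta * `|r * t| <= eta * (C * r) by rewrite ler_wpM2l // ltW.
have f6 : (2 * (K + C) + 1) * eta <= e.
  by rewrite mulrC -ler_pdivlMr.
apply: le_trans (ler_normD _ _) _.
apply: le_trans (lerD (ler_normB _ _) f4) _.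
apply: le_trans (lerD (lerD (ler_normD _ _) f1) (lexx _)) _.
have f7 : (2 * (K + C) + 1) * eta * r <= e * r by rewrite ler_wpM2r // ltW.
have f8 : 0 <= C * r * eta by rewrite !mulr_ge0 // ltW.
have f9 : 0 <= eta * r by rewrite mulr_ge0 // ltW.
by move: f2 f3 f5 f7 f8 f9; rewrite /h; lra.
Qed.

Lemma pansu_estimate x (c : 'I_n -> R) (e : R) : 0 < e -> ~ exceptional_set f x ->
  (forall j, deg j = 1%N -> forall e, 0 < e -> exists2 r, 0 < r &
    forall t, `|t| < r -> `|f (x ** (t *: e_ j)) - f x - t * c j| <= e * `|t|) ->
  exists2 d, 0 < d & forall h, cc_norm h < d ->
    `|f (x ** h) - f x - \sum_(j < n | deg j == 1%N) c j * h 0 j| <= e * cc_norm h.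
Proof.
move=> e0 xE Hc; pose L (h : V) := \sum_(j < n | deg j == 1%N) c j * h 0 j.
have [M M0 HM] := cc_norm_ball_bounded G.
have [N [C0 HC0]] := reachable_ball G M.
pose C := `|C0|; have [D D0 HD] := cc_norm_hprod G N C.
(* Each of the at most N telescoping steps is allowed the error e r / (N + 1). *)
have N1 : 0 < N%:R + 1 :> R by rewrite ltr_wpDl.
have [d d0 Hd] : exists2 d, 0 < d & forall r, r < d -> forall j, deg j = 1%N ->
    0 < r -> forall p t, cc_norm p <= D -> `|t| <= C ->
    `|f (x ** delta r p ** ((r * t) *: e_ j)) - f (x ** delta r p) - r * t * c j| <=
    e / (N%:R + 1) * r.
  apply: common_radius => j; have [j1|j1] := eqVneq (deg j) 1%N; last first.
    by exists 1 => // r _ j1'; rewrite j1' eqxx in j1.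
  have [d d0 Hd] := increment_step j1 (divr_gt0 e0 N1) (normr_ge0 C0) D0 xE (Hc j j1).
  by exists d => // r rd _; apply: Hd.
exists d => // h hd; have [->|h0] := eqVneq h 0.
  rewrite cmulx0 subrr sub0r normrN big1 ?normr0; last by move=> j _; rewrite mxE mulr0.
  by rewrite mulr_ge0 ?cc_norm_ge0 // ltW.
have r0 := cc_norm_gt0 G h0; set r := cc_norm h in hd r0 *.
have [y [hy y1]] := cc_norm_scale G h0; rewrite -/r in hy.
have [|l [lN lC ly]] := HC0 y; first by apply: HM; rewrite y1.
have {}lC := hword_le (ler_norm C0) lC; rewrite -/C in lC.
have LE u : L (delta r u) = r * L u.
  rewrite /L mulr_sumr; apply: eq_bigr => j /eqP j1.
  by rewrite mxE j1 expr1 mulrCA.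
(* Induction on prefixes of the word: prefixes obey the same bounds N and C, so D bounds the norm of
   every intermediate product. *)
have main l' : (size l' <= N)%N -> hword G C l' ->
    `|f (x ** delta r (hprod G l')) - f x - r * L (hprod G l')| <=
    (size l')%:R * (e / (N%:R + 1) * r).
  elim/last_ind: l' => [_ _|l' [j t] IH].
    rewrite /hprod /= dilation0 cmulx0 /L subrr sub0r normrN big1 ?mulr0 ?normr0 ?mul0r //.
    by move=> j _; rewrite mxE mulr0.
  rewrite size_rcons => lN' ; rewrite /hword all_rcons => /andP[/andP[/= /eqP j1 tC] lC'].
  have {}IH := IH (ltnW lN') lC'.
  have := Hd r hd j j1 r0 (hprod G l') t (HD l' (ltnW lN') lC') tC.
  set p := hprod G l' in IH *.
  have -> : hprod G (rcons l' (j, t)) = p ** (t *: e_ j) by rewrite hprod_rcons.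
  rewrite dilation_mul horizontal_dilation // cmulA => H.
  have -> : L (p ** (t *: e_ j)) = L p + t * c j.
    rewrite /L; under eq_bigr => i /eqP i1 do rewrite (coord_mul_horizontal _ _ i1) mulrDr.
    rewrite big_split /=; congr (_ + _); rewrite (bigD1 j) ?j1 //= !mxE !eqxx mulr1.
    by rewrite big1 ?addr0 1?mulrC // => i /andP[_ /negbTE ij]; rewrite !mxE ij !mulr0.
  set a := f (x ** delta r p) in IH H *.
  set b := f (x ** delta r p ** ((r * t) *: e_ j)) in H *.
  have -> : b - f x - r * (L p + t * c j) = (b - a - r * t * c j) + (a - f x - r * L p).
    ring.
  rewrite -natr1 mulrDl mul1r; apply: le_trans (ler_normD _ _) _.
  by rewrite addrC lerD.
have := main l lN lC; rewrite ly -LE -hy => H; apply: le_trans H _.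
rewrite mulrA ler_wpM2r ?(ltW r0) // mulrCA ler_piMr ?(ltW e0) //.
rewrite ler_pdivrMr // mul1r; apply: le_trans (_ : N%:R <= _); first by rewrite ler_nat.
by rewrite lerDl.
Qed.

End LipschitzFunction.

End Differentiability.

Theorem corollary4p8 (R : realType) (n s : nat) (G : carnot_group R n s)
    (f : 'rV[R]_n -> R) (hf : cc_lipschitz G f) :
  exists2 P : set 'rV[R]_n, sigma_porous (cc_dist G) P &
    forall x : 'rV[R]_n, ~ P x ->
      (forall i : 'I_n, cdeg G i = 1%N ->
         has_dir_derivative G f x (delta_mx 0%R i)) ->
      pansu_differentiable G f x.
Proof.
exists (exceptional_set G f); first exact: sigma_porous_exceptional_set.
move=> x xE Hx; have [K HK] := hf.
have f_lip y z : `|f y - f z| <= `|K| * cc_dist G y z.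
  by apply: le_trans (HK y z) _; rewrite ler_wpM2r ?cc_dist_ge0 // ler_norm.
have /choice[c Hc] j : exists c, cdeg G j = 1%N -> forall e, 0 < e ->
    exists2 r, 0 < r & forall t, `|t| < r ->
      `|f (cmul G x (t *: delta_mx 0 j)) - f x - t * c| <= e * `|t|.
  have [j1|j1] := eqVneq (cdeg G j) 1%N; last by exists 0 => j1'; rewrite j1' eqxx in j1.
  by have [c Hc] := has_dir_derivativeP (Hx j j1); exists c.
pose L (h : 'rV[R]_n) := \sum_(j < n | cdeg G j == 1%N) c j * h 0 j.
exists L.
  split=> [y z|r y r0]; rewrite /L.
    by rewrite -big_split; apply: eq_bigr => j /eqP j1 /=; rewrite coord_mul_horizontal // mulrDr.
  by rewrite mulr_sumr; apply: eq_bigr => j /eqP j1; rewrite mxE j1 expr1 mulrCA.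
(* The quotient has d(h, 0) = [cc_norm (- h)] in the denominator, whereas [pansu_estimate] is in
   terms of [cc_norm h]; hence the tolerance e / C. *)
have [C C0 HC] := cc_norm_opp G.
apply/cvgrPdist_le => e e0.
have eC : 0 < e / C by rewrite divr_gt0.
have [d d0 Hd] := pansu_estimate (normr_ge0 K) f_lip eC xE Hc.
have d2 : 0 < d / 2 by rewrite divr_gt0.
have [r r0 Hr] := cc_norm_small G d2.
apply/nbhs_ballP; exists r => //= h; rewrite -ball_normE /= sub0r normrN => hr h0.
have hd : cc_norm G h < d by have := Hr h (ltW hr); move: d0; lra.
rewrite sub0r normrN cc_distE cmulx0 normrM normr_id normfV (ger0_norm (cc_norm_ge0 G _)).
rewrite ler_pdivrMr; last by rewrite cc_norm_gt0 // oppr_eq0.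
apply: le_trans (Hd h hd) _; have := HC (- h); rewrite opprK => H.
by rewrite mulrAC ler_pdivrMr // -mulrA ler_wpM2l ?(ltW e0) // mulrC.
Qed.
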